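(* Let $\rho\ge 0$. There exists $c=c(\rho)\in(0,\infty)$ such that, for any $L,K\in 2\mathbb{N}\cup\{1\}$ satisfying $K\le\sqrt{\log L}$ and for any $\varepsilon>0$, $$\frac{\mathbb{E}_{L,K,\rho}\big(|L_o|\big)}{|\mathbb{S}_{L,K}|}\le c\sqrt{\frac{K}{\log L}},$$ $$\mathbb{P}_{L,K,\rho}\big(|L_o|>\varepsilon\,|\mathbb{S}_{L,K}|\big)\le c\,\varepsilon^{-1}\sqrt{\frac{K}{\log L}},$$ $$\sum_{x\in\mathbb{S}_{L,K}}\frac{\mathbb{G}_{L,K,\rho}(o,x)}{|\mathbb{S}_{L,K}|}\le c\sqrt{\frac{K}{\log L}}.$$
   Context: $\mathbb{N}=\{1,2,\dots\}$. For $L,K\in 2\mathbb{N}\cup\{1\}$ the slab torus $\mathbb{S}_{L,K}$ is the graph with vertex set $\big((-\tfrac L2,\tfrac L2]\cap\mathbb{Z}\big)^2\times\big((-\tfrac K2,\tfrac K2]\cap\mathbb{Z}\big)$ with nearest-neighbour edges and periodic boundary conditions: two distinct vertices are joined by an edge iff they differ by $\pm e_i$ for some Cartesian vector $e_i$, $i\in\{1,2,3\}$, modulo $(L,L,K)$ (for $K=1$ this is the planar torus). $|\mathbb{S}_{L,K}|$ is the number of vertices and $o$ is the origin. Let $G=(V,E)$ be a finite bipartite graph. A dimer configuration of a graph is a perfect matching. For $A\subset V$, $\mathcal{D}_G(A)$ is the set of dimer configurations of the subgraph of $G$ with vertex set $V\setminus A$ and all edges of $E$ not touching $A$ (for $A=V$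 it has exactly one, empty, element). Monomer double-dimer model: the configuration space is $$\Omega:=\{\omega=(M,d_1,d_2): M\subset V,\ (d_1,d_2)\in\mathcal{D}_G(M)\times\mathcal{D}_G(M)\},$$ where $M$ is the set of monomers and $d_1,d_2$ are the blue and red dimers. For $\rho\ge0$ (monomer activity) the probability measure on $\Omega$ is $\mathbb{P}_{G,\rho}(\omega)=\rho^{|M|}/\mathbb{Z}_{G,\rho}$, with $\mathbb{Z}_{G,\rho}$ the normalising constant ($0^0=1$), and $\mathbb{E}_{G,\rho}$ is its expectation. Superimposing $d_1$ and $d_2$, each $\omega\in\Omega$ is a collection of monomers and disjoint self-avoiding loops, a loop being either an alternating cycle of blue and red dimers of length at least four, or (length two) a blue and a red dimer on the same edge. $L_x(\omega)$ is the loop touching $x$ ($L_x(\omega)=\emptyset$ if $x\in M$), and $|L_x|(\omega)$ is the number of vertices touched by $L_x(\omega)$ ($0$ if $x\in M$). Two-point function: for $x,y\in V$ at odd graph distance, $\Omega_{x,y}$ is the set of triplets $\omega=(M,d_1,d_2)$ with $M\subset V\setminus\{x,y\}$, $d_1\in\mathcal{D}_G(\{x,y\}\cup M)$, $d_2\in\mathcal{D}_G(M)$; for $x,y$ at even distance, it is the set of triplets with $M\subset V\setminus\{x,y\}$, $d_1\in\mathcal{D}_G(\{x\}\cup M)$, $d_2\in\mathcal{D}_G(\{y\}\cup M)$. Then $$\mathbb{G}_{G,\rho}(x,y):=\frac{\sum_{\omega=(M,d_1,d_2)\in\Omega_{x,y}}\rho^{|M|}}{\mathbb{Z}_{G,\rho}}.$$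 When $G=\mathbb{S}_{L,K}$ the subscript $G$ is replaced by $L,K$. *)

(* Defs.v *)
From HB Require Import structures.
From mathcomp Require Import all_boot all_order all_algebra.
From mathcomp Require Import all_classical all_reals all_analysis.

Set Implicit Arguments.
Unset Strict Implicit.
Unset Printing Implicit Defensive.

Import Order.TTheory GRing.Theory Num.Theory.

Local Open Scope ring_scope.

(* A finite simple graph is given by its symmetric irreflexive adjacency
   relation [e] on a finite type [V]; an edge is a two-element set. *)
Definition edges (V : finType) (e : rel V) : {set {set V}} :=
  [set [set p.1; p.2] | p : V * V & e p.1 p.2].

Definition edges_avoiding (V : finType) (e : rel V) (A : {set V}) :
    {set {set V}} :=
  [set f in edges e | [disjoint f & A]].

Definition dimers (V : finType) (e : rel V) (A : {set V}) :
    {set {set {set V}}} :=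
  [set d : {set {set V}} | (d \subset edges_avoiding e A) &&
    [forall x : V, (x \notin A) ==> (#|[set f in d | x \in f]| == 1%N)]].

Definition config (V : finType) : finType :=
  ({set V} * {set {set V}} * {set {set V}})%type.

Definition monomers (V : finType) (w : config V) : {set V} := w.1.1.
Definition blue (V : finType) (w : config V) : {set {set V}} := w.1.2.
Definition red (V : finType) (w : config V) : {set {set V}} := w.2.

Definition Omega (V : finType) (e : rel V) : {set config V} :=
  [set w : config V | (blue w \in dimers e (monomers w)) &&
                      (red w \in dimers e (monomers w))].

Definition partition_function (R : realType) (V : finType) (e : rel V)
    (rho : R) : R :=
  \sum_(w in Omega e) rho ^+ #|monomers w|.

Definition mass (R : realType) (V : finType) (e : rel V) (rho : R)
    (w : config V) : R :=
  rho ^+ #|monomers w| / partition_function e rho.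

Definition Pr (R : realType) (V : finType) (e : rel V) (rho : R)
    (A : pred (config V)) : R :=
  \sum_(w in Omega e | A w) mass e rho w.

Definition Ex (R : realType) (V : finType) (e : rel V) (rho : R)
    (X : config V -> R) : R :=
  \sum_(w in Omega e) X w * mass e rho w.

(* [s] lists the vertices of a loop in cyclic order, starting with a blue dimer:
   the dimers {s_0,s_1}, {s_1,s_2}, ..., {s_(k-1),s_0} are alternately blue and
   red.  Size 2 is the case of a blue and a red dimer on the same edge. *)
Definition is_loop (V : finType) (w : config V) (s : seq V) : Prop :=
  [/\ uniq s, (0 < size s)%N, ~~ odd (size s) &
      forall (x0 : V) (i : nat), (i < size s)%N ->
        [set nth x0 s i; nth x0 s (i.+1 %% size s)]
          \in (if odd i then red w else blue w)].

(* The vertices touched by the loop L_x. *)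
Definition loop_vertices (V : finType) (w : config V) (x : V) : {set V} :=
  if x \in monomers w then finset.set0
  else [set y : V | `[< exists s : seq V, [/\ is_loop w s, x \in s & y \in s] >]].

Definition loop_size (V : finType) (w : config V) (x : V) : nat :=
  #|loop_vertices w x|.

Definition walk (V : finType) (e : rel V) (n : nat) (x y : V) : bool :=
  [exists p : n.-tuple V, path e x p && (last x p == y)].

(* A shortest walk has length less than #|V|, so this is the graph distance,
   with the junk value #|V| when x and y are not connected. *)
Definition gdist (V : finType) (e : rel V) (x y : V) : nat :=
  find (fun n => walk e n x y) (iota 0 #|V|).

Definition Omega2 (V : finType) (e : rel V) (x y : V) : {set config V} :=
  [set w : config V | (monomers w \subset ~: [set x; y]) &&
    if odd (gdist e x y) then
      (blue w \in dimers e ([set x; y] :|: monomers w)) &&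
      (red w \in dimers e (monomers w))
    else
      (blue w \in dimers e (x |: monomers w)) &&
      (red w \in dimers e (y |: monomers w))].

Definition two_point (R : realType) (V : finType) (e : rel V) (rho : R)
    (x y : V) : R :=
  (\sum_(w in Omega2 e x y) rho ^+ #|monomers w|) / partition_function e rho.

(* The set 2N \cup {1}, where N = {1, 2, ...}. *)
Definition side (n : nat) : bool := (n == 1%N) || ((0 < n)%N && ~~ odd n).

Lemma side_gt0 (n : nat) : side n -> (0 < n)%N.
Proof. by case: n. Qed.

(* Each coordinate in (-n/2, n/2] is represented by its residue modulo n in
   {0, ..., n-1}; the adjacency depends on coordinates only modulo (L, L, K). *)
Definition torus (L K : nat) : finType := ('I_L * 'I_L * 'I_K)%type.

Definition cyc_step (n : nat) (i j : 'I_n) : bool :=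
  (j == i.+1 %[mod n])%N || (i == j.+1 %[mod n])%N.

Definition torus_adj (L K : nat) : rel (torus L K) :=
  fun u v => (u != v) &&
    [|| [&& cyc_step u.1.1 v.1.1, u.1.2 == v.1.2 & u.2 == v.2],
        [&& u.1.1 == v.1.1, cyc_step u.1.2 v.1.2 & u.2 == v.2] |
        [&& u.1.1 == v.1.1, u.1.2 == v.1.2 & cyc_step u.2 v.2]].

Definition origin (L K : nat) (hL : side L) (hK : side K) : torus L K :=
  (Ordinal (side_gt0 hL), Ordinal (side_gt0 hL), Ordinal (side_gt0 hK)).

Lemma cyc_step_sym (n : nat) : symmetric (@cyc_step n).
Proof. by move=> i j; rewrite /cyc_step orbC. Qed.

Lemma torus_adj_sym (L K : nat) : symmetric (@torus_adj L K).
Proof.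
move=> u v; rewrite /torus_adj eq_sym ![cyc_step u.1.1 _]cyc_step_sym.
rewrite [cyc_step u.1.2 _]cyc_step_sym [cyc_step u.2 _]cyc_step_sym.
by rewrite [u.1.1 == _]eq_sym [u.1.2 == _]eq_sym [u.2 == _]eq_sym.
Qed.

Lemma torus_adj_irrefl (L K : nat) : irreflexive (@torus_adj L K).
Proof. by move=> u; rewrite /torus_adj eqxx. Qed.

(* Main.v *)
Require Import Defs.
From HB Require Import structures.
From mathcomp Require Import all_boot all_order all_algebra.
From mathcomp Require Import ring lra zify.

(** The two-point function is a ratio [Zdef A / Zdef 0], where [Zdef A] sums the
    weights of configurations with defects: vertices that one colour leaves
    uncovered without a monomer. The probability that one loop joins [o] to [x]
    is at most a sum of 144 such ratios, because removing the loop edge after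
    [o] and the one after [x], and exchanging colours on the arc in between,
    leaves one defect of each colour near [o] and near [x], and the loop can be
    recovered ([loop_opened], [recolour_inj]). It remains to prove that two
    distant groups of defects have a ratio of order [sqrt (K / log rad)] when
    their distance exceeds a multiple of [rad], and to take [rad] of order
    [sqrt L]; the remaining pairs are a fraction of order [rad / L].

    The mirrors used here pass between the vertices. Given the set [S] of
    dimers that cross a mirror, the two halves are independent, so [Zdef] is a
    scalar product [sum_S half_weight A S * half_weight B S] ([cut_sum]).
    Cauchy-Schwarz then gives [reflection_positivity]; applied to the vertical
    mirror half way between [o] and [x] it leaves the case of defects facing
    their own mirror images, on one row or on two adjacent rows.

    That case uses a second, horizontal mirror adjacent to all the defects.
    There a defect acts like a crossing dimer ([half_weight_shift]): the
    defects shift the argument of the function [psi] describing the pure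
    system. Weigh the crossing dimers by a staggered charge whose profile is
    1 near the defects and 0 near their images. The shifted functions live at
    charges differing by at least 1, so they overlap little as soon as the
    charge has a small variance in the pure system ([uncertainty]).

    To bound this variance, extend the profile to a function above the mirror
    that decays logarithmically in the two long directions. A matching covers
    each non-monomer exactly once, which gives a conservation law ([flux_sum])
    expressing the charge through the horizontal and vertical dimers, weighted
    by the gradient [u] of the profile. The energy [sum u ^+ 2] is of order
    [K / log rad], as for the Dirichlet problem in the plane.

    The core is therefore that the statistic [sum_x u x * (e_x \in d)] has
    variance at most a constant times [sum_x u x ^+ 2] ([blue_variance]), where
    [e_x] are the edges in one direction and [u] is odd under an involution
    exchanging neighbouring lines. For one mirror, replace [u] by the symmetric
    extension of either half, cut off on the edges that lie on the mirror. The
    parallelogram defect of the quadratic form is a complete square plus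
    [|a psi|^2 - |a' psi|^2], where [a] and [a'] lower and raise crossing edges
    weighted by [u]. These commute for disjoint edges, so the difference costs
    only a multiple of the energy cut off ([raise_lower_bound], [one_plane]). Averaged over
    all mirrors the cut-off energy is a fixed fraction of the total, and
    iterating contracts any crude constant to an absolute one ([form_bound]). *)

Set Implicit Arguments.
Unset Strict Implicit.
Unset Printing Implicit Defensive.

Import Order.TTheory GRing.Theory Num.Theory.

Local Open Scope ring_scope.

(** * Matchings and their traces on the two sides of a mirror *)

Section Matchings.
Variables (V : finType) (e : rel V).
Implicit Types (A B S : {set V}) (d : {set {set V}}) (x y : V).

Lemma edgesP (f : {set V}) :
  reflect (exists x y, e x y /\ f = [set x; y]) (f \in edges e).
Proof.
apply: (iffP imsetP) => [[[x y]]|[x [y [exy ->]]]].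
  by rewrite inE /= => exy ->; exists x, y; split.
by exists (x, y); rewrite ?inE.
Qed.

Lemma dimersP A d :
  reflect ((forall f, f \in d -> f \in edges e /\ [disjoint f & A]) /\
           forall x, x \notin A -> #|[set f in d | x \in f]| = 1%N)
          (d \in dimers e A).
Proof.
rewrite inE; apply: (iffP andP) => -[].
  move=> /subsetP sub /forallP cov; split=> [f /sub|x xA]; first by rewrite inE => /andP.
  by apply/eqP; apply: (implyP (cov x)).
move=> sub cov; split; first by apply/subsetP => f /sub[fe fA]; rewrite inE fe.
by apply/forallP => x; apply/implyP => /cov ->.
Qed.

Lemma dimer_edge A d f : d \in dimers e A -> f \in d ->
  exists x y, [/\ e x y, f = [set x; y], x \notin A & y \notin A].
Proof.
move=> /dimersP[sub _] /sub[/edgesP[x [y [exy ->]]]].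
move=> /pred0P dis; exists x, y; split=> //.
  by have := dis x; rewrite /= !inE eqxx /= => ->.
by have := dis y; rewrite /= !inE eqxx orbT /= => ->.
Qed.

Lemma dimer_ex A d x : d \in dimers e A -> x \notin A ->
  exists2 f, f \in d & x \in f.
Proof.
move=> /dimersP[_ cov] /cov /eqP /cards1P[f def_f].
have := set11 f; rewrite -def_f inE => /andP[fd xf]; by exists f.
Qed.

Lemma dimer_uniq A d x f g : d \in dimers e A ->
  f \in d -> g \in d -> x \in f -> x \in g -> f = g.
Proof.
move=> dA fd gd xf xg.
have xA : x \notin A.
  have [a [b [_ def_f aA bA]]] := dimer_edge dA fd.
  by move: xf; rewrite def_f !inE => /orP[] /eqP ->.
have /dimersP[_ cov] := dA; have /eqP /cards1P[h def_h] := cov x xA.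
have : f \in [set h] by rewrite -def_h inE fd.
have : g \in [set h] by rewrite -def_h inE gd.
by rewrite !inE => /eqP -> /eqP ->.
Qed.

Lemma in_dimers A d :
  (forall f, f \in d -> f \in edges e) ->
  (forall f x, f \in d -> x \in f -> x \notin A) ->
  (forall x, x \notin A -> exists f, [/\ f \in d, x \in f &
     forall g, g \in d -> x \in g -> g = f]) ->
  d \in dimers e A.
Proof.
move=> de dA cov; apply/dimersP; split=> [f fd|x /cov[f [fd xf uni]]].
  split; first exact: de.
  by apply/pred0P => x /=; apply/negP => /andP[xf]; apply/negP/(dA f).
apply/eqP/cards1P; exists f; apply/setP => g; rewrite !inE.
apply/andP/eqP => [[gd xg]|->//]; exact: uni.
Qed.

End Matchings.

(** The mirror passes between vertices, so a vertex never coincides with its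
    image, and only edges orthogonal to the mirror cross it. *)
Record reflection (V : finType) (e : rel V) (t : V -> V) (H : {set V}) : Prop :=
  Reflection {
    refl_inv : involutive t;
    refl_adj : forall x y, e (t x) (t y) = e x y;
    refl_half : forall x, (t x \in H) = (x \notin H);
    refl_cross : forall x y, e x y -> x \in H -> y \notin H -> y = t x }.

Section Cut.
Variables (V : finType) (e : rel V) (t : V -> V) (H : {set V}).
Hypotheses (e_sym : symmetric e) (R : reflection e t H).
Implicit Types (A B S : {set V}) (d : {set {set V}}) (x y : V).

Let tK : involutive t := refl_inv R.
Let tI : injective t := can_inj tK.
Let tH x : (t x \in H) = (x \notin H) := refl_half R x.

(** The near endpoints of the edges that cross the mirror. *)
Definition rim : {set V} := [set x in H | e x (t x)].
(** The crossing dimers, recorded by their endpoints in [H]. *)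
Definition crossing d : {set V} := [set x in H | [set x; t x] \in d].
Definition rung S : {set {set V}} := [set [set x; t x] | x in S].

Lemma mem_timg A x : (x \in t @: A) = (t x \in A).
Proof.
apply/imsetP/idP => [[y yA ->]|xA]; first by rewrite tK.
by exists (t x); rewrite ?tK.
Qed.

Lemma rim_half x : x \in rim -> x \in H. Proof. by rewrite inE => /andP[]. Qed.

Lemma cross_edge d A f x y : d \in dimers e A -> f \in d -> f = [set x; y] ->
  e x y -> x \in H -> y \notin H -> y = t x /\ x \in crossing d.
Proof.
move=> dA fd ef exy xH yH; rewrite {f}ef in fd.
have yE := refl_cross R exy xH yH; split=> //.
by rewrite inE xH -yE.
Qed.

Lemma crossing_rim d A : d \in dimers e A -> crossing d \subset rim.
Proof.
move=> dA; apply/subsetP => x; rewrite !inE => /andP[xH xd]; rewrite xH /=.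
have [a [b [eab /setP ab _ _]]] := dimer_edge dA xd.
have xt : x != t x by apply/eqP => xt; have := tH x; rewrite -xt xH.
have /orP[] : (a == x) || (a == t x).
- by have := ab a; rewrite !inE eqxx.
- move/eqP => ax; subst a; have := ab (t x); rewrite !inE eqxx orbT /= => /esym.
  by rewrite eq_sym (negPf xt) /= => /eqP ->.
move/eqP => ax; subst a; have := ab x; rewrite !inE eqxx /= => /esym.
by rewrite (negPf xt) /= => /eqP xb; rewrite e_sym {2}xb.
Qed.

Definition glue S (p : {set {set V}} * {set {set V}}) := p.1 :|: p.2 :|: rung S.
Definition within (U : {set V}) d := [set f in d | f \subset U].

Lemma glue_dimers A S d1 d2 : S \subset rim -> [disjoint S & A] ->
    [disjoint t @: S & A] ->
  d1 \in dimers e (~: H :|: A :|: S) -> d2 \in dimers e (H :|: A :|: t @: S) ->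
  [/\ glue S (d1, d2) \in dimers e A, crossing (glue S (d1, d2)) = S,
      within H (glue S (d1, d2)) = d1 & within (~: H) (glue S (d1, d2)) = d2].
Proof.
move=> sS SA tSA D1 D2.
have SH x : x \in S -> x \in H by move=> xS; apply: rim_half (subsetP sS _ xS).
have d1P f x : f \in d1 -> x \in f -> [/\ x \in H, x \notin A & x \notin S].
  move=> fd xf; have [a [b [_ ef aA bA]]] := dimer_edge D1 fd.
  have : x \notin ~: H :|: A :|: S by move: xf; rewrite ef !inE => /orP[]/eqP->; move: aA bA; rewrite !inE.
  by rewrite !inE !negb_or negbK => /andP[/andP[-> ->] ->].
have d2P f x : f \in d2 -> x \in f -> [/\ x \notin H, x \notin A & x \notin t @: S].
  move=> fd xf; have [a [b [_ ef aA bA]]] := dimer_edge D2 fd.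
  have : x \notin H :|: A :|: t @: S.
    by move: xf; rewrite ef in_set2 => /orP[]/eqP->.
  by rewrite !(in_setU) !negb_or => /andP[/andP[-> ->] ->].
have ne f d B : d \in dimers e B -> f \in d -> exists x, x \in f.
  by move=> dB fd; have [a [b [_ -> _ _]]] := dimer_edge dB fd; exists a; rewrite !inE eqxx.
have SnA x : x \in S -> x \notin A by move=> xS; rewrite (disjointFr SA).
have tSnA x : x \in S -> t x \notin A.
  by move=> xS; rewrite (disjointFr tSA) ?mem_timg ?tK.
have inG f : f \in glue S (d1, d2) -> [\/ f \in d1, f \in d2 | exists2 x, x \in S & f = [set x; t x]].
  rewrite /glue !in_setU /= => /orP[/orP[]|/imsetP]; by [constructor 1|constructor 2|constructor 3].
split.
- apply: in_dimers.
  + move=> f /inG[/(dimer_edge D1)|/(dimer_edge D2)|[x xS ->]].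
    * by move=> [a [b [eab -> _ _]]]; apply/edgesP; exists a, b.
    * by move=> [a [b [eab -> _ _]]]; apply/edgesP; exists a, b.
    * apply/edgesP; exists x, (t x); split=> //.
      by have := subsetP sS _ xS; rewrite inE => /andP[].
  + move=> f x /inG[fd|fd|[y yS ->]].
    * by case/(d1P f x fd).
    * by case/(d2P f x fd).
    * by rewrite !inE => /orP[]/eqP->; [apply: SnA|apply: tSnA].
  + move=> x xA; case: (boolP (x \in S)) => xS.
      exists [set x; t x]; split; first by rewrite !in_setU; apply/orP; right; apply: imset_f.
        by rewrite !inE eqxx.
      move=> g /inG[gd xg|gd xg|[y yS ->]].
      * by have [_ _] := d1P g x gd xg; rewrite xS.
      * by have [] := d2P g x gd xg; rewrite SH.
      * by rewrite !inE => /orP[/eqP->//|/eqP xy]; have := SH _ xS; rewrite xy tH SH.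
    case: (boolP (t x \in S)) => txS.
      exists [set t x; x]; split.
        by rewrite !in_setU; apply/orP; right; apply/imsetP; exists (t x); rewrite ?tK.
        by rewrite !inE eqxx orbT.
      have xnH : x \notin H by rewrite -tH SH.
      move=> g /inG[gd xg|gd xg|[y yS ->]].
      * by have [] := d1P g x gd xg; rewrite (negPf xnH).
      * by have [_ _] := d2P g x gd xg; rewrite mem_timg txS.
      * rewrite !inE => /orP[/eqP xy|/eqP ->]; last by rewrite tK.
        by move: xS; rewrite xy yS.
    case: (boolP (x \in H)) => xH.
      have xn : x \notin ~: H :|: A :|: S by rewrite !inE xH (negPf xA) (negPf xS).
      have [f fd xf] := dimer_ex D1 xn; exists f; split=> //; first by rewrite !in_setU fd.
      move=> g /inG[gd xg|gd xg|[y yS ->]].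
      * exact: dimer_uniq D1 gd fd xg xf.
      * by have [] := d2P g x gd xg; rewrite xH.
      * rewrite !inE => /orP[]/eqP xy; first by move: xS; rewrite xy yS.
        by move: txS; rewrite xy tK yS.
    have xn : x \notin H :|: A :|: t @: S.
      by rewrite !(in_setU) mem_timg (negPf xH) (negPf xA) (negPf txS).
    have [f fd xf] := dimer_ex D2 xn; exists f; split=> //.
      by rewrite !in_setU fd orbT.
    move=> g /inG[gd xg|gd xg|[y yS ->]].
      * by have [] := d1P g x gd xg; rewrite (negPf xH).
      * exact: dimer_uniq D2 gd fd xg xf.
      * rewrite !inE => /orP[]/eqP xy; first by move: xS; rewrite xy yS.
        by move: txS; rewrite xy tK yS.
- apply/setP => x; rewrite inE; apply/andP/idP => [[xH /inG[xd|xd|[y yS]]]|xS].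
  + by have [] := d1P _ (t x) xd; rewrite ?tH ?xH // !inE eqxx orbT.
  + by have [] := d2P _ x xd; rewrite ?xH // !inE eqxx.
  + move=> /setP /(_ x); rewrite !inE eqxx /= => /esym/orP[]/eqP xy; first by rewrite xy.
    by move: xH; rewrite xy tH SH.
  + split; first exact: SH.
    by rewrite !in_setU; apply/orP; right; apply: imset_f.
- apply/setP => f; rewrite inE; apply/andP/idP => [[/inG[//|fd|[y yS ->]] /subsetP sub]|fd].
  + by have [x xf] := ne _ _ _ D2 fd; have [] := d2P _ _ fd xf; rewrite sub.
  + by have := sub (t y); rewrite !inE eqxx orbT tH SH // => /(_ isT).
  + split; first by rewrite !in_setU fd.
    by apply/subsetP => x /(d1P _ _ fd)[].
- apply/setP => f; rewrite inE; apply/andP/idP => [[/inG[fd|//|[y yS ->]] /subsetP sub]|fd].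
  + by have [x xf] := ne _ _ _ D1 fd; have [] := d1P _ _ fd xf; have := sub _ xf; rewrite inE => /negPf ->.
  + by have := sub y; rewrite !inE eqxx SH // => /(_ isT).
  + split; first by rewrite !in_setU fd orbT.
    by apply/subsetP => x /(d2P _ _ fd)[]; rewrite inE.
Qed.

Lemma cut_dimers A d : d \in dimers e A ->
  [/\ [disjoint crossing d & A], [disjoint t @: crossing d & A],
      within H d \in dimers e (~: H :|: A :|: crossing d),
      within (~: H) d \in dimers e (H :|: A :|: t @: crossing d) &
      glue (crossing d) (within H d, within (~: H) d) = d].
Proof.
move=> dA.
have crP x : x \in crossing d -> [/\ x \in H, [set x; t x] \in d, x \notin A & t x \notin A].
  rewrite inE => /andP[xH xd]; split=> //; have [a [b [_ /setP ab aA bA]]] := dimer_edge dA xd.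
    by have := ab x; rewrite !inE eqxx /= => /esym/orP[]/eqP->.
  by have := ab (t x); rewrite !inE eqxx orbT /= => /esym/orP[]/eqP->.
have edP f : f \in d -> [\/ f \subset H, f \subset ~: H | exists2 x, x \in crossing d & f = [set x; t x]].
  move=> fd; have [a [b [eab ef _ _]]] := dimer_edge dA fd.
  have [aH|aH] := boolP (a \in H); have [bH|bH] := boolP (b \in H).
  - by constructor 1; rewrite ef; apply/subsetP => z; rewrite !inE => /orP[]/eqP->.
  - have [bE ac] := cross_edge dA fd ef eab aH bH.
    by constructor 3; exists a => //; rewrite ef bE.
  - have ef' : f = [set b; a] by rewrite ef setUC.
    have eba : e b a by rewrite e_sym.
    have [aE bc] := cross_edge dA fd ef' eba bH aH.
    by constructor 3; exists b => //; rewrite ef' aE.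
  - by constructor 2; rewrite ef; apply/subsetP => z; rewrite !inE => /orP[]/eqP->.
split.
- by apply/pred0P => x /=; apply/negP => /andP[/crP[_ _ /negP]].
- by apply/pred0P => x /=; apply/negP => /andP[]; rewrite mem_timg => /crP[_ _ _]; rewrite tK => /negP.
- apply: in_dimers.
  + move=> f; rewrite inE => /andP[fd _]; have [a [b [eab -> _ _]]] := dimer_edge dA fd.
    by apply/edgesP; exists a, b.
  + move=> f x; rewrite inE => /andP[fd /subsetP fH] xf; rewrite !in_setU in_setC fH //=.
    rewrite negb_or; apply/andP; split.
      have [a [b [_ ef aA bA]]] := dimer_edge dA fd.
      by move: xf; rewrite ef !inE => /orP[]/eqP->.
    apply/negP => /crP[xH xd _ _]; have fE := dimer_uniq dA fd xd xf _.
    have : t x \in H by apply: fH; rewrite fE !inE eqxx ?orbT.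
    by rewrite tH xH.
  + move=> x; rewrite !in_setU in_setC !negb_or negbK => /andP[/andP[xH xA] xc].
    have [f fd xf] := dimer_ex dA xA; exists f; split=> //.
      rewrite inE fd /=; have [//|/subsetP sub|[y yc ef]] := edP f fd.
        by have := sub _ xf; rewrite inE xH.
      move: xf; rewrite ef !inE => /orP[]/eqP xy; first by move: xc; rewrite xy yc.
      by have [] := crP _ yc; move: xH; rewrite xy tH => /negPf ->.
    by move=> g; rewrite inE => /andP[gd _] xg; apply: dimer_uniq dA gd fd xg xf.
- apply: in_dimers.
  + move=> f; rewrite inE => /andP[fd _]; have [a [b [eab -> _ _]]] := dimer_edge dA fd.
    by apply/edgesP; exists a, b.
  + move=> f x; rewrite inE => /andP[fd /subsetP fH] xf.
    have := fH _ xf; rewrite !in_setU in_setC => /negPf -> /=.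
    rewrite negb_or; apply/andP; split.
      have [a [b [_ ef aA bA]]] := dimer_edge dA fd.
      by move: xf; rewrite ef !inE => /orP[]/eqP->.
    rewrite mem_timg; apply/negP => /crP[xH]; rewrite tK => xd _ _.
    have fE := dimer_uniq dA fd xd xf _.
    have : t x \in ~: H by apply: fH; rewrite fE !inE eqxx ?orbT.
    by rewrite inE xH.
  + move=> x; rewrite !in_setU !negb_or mem_timg => /andP[/andP[xH xA] xc].
    have [f fd xf] := dimer_ex dA xA; exists f; split=> //.
      rewrite inE fd /=; have [/subsetP sub|//|[y yc ef]] := edP f fd.
        by have := sub _ xf; rewrite (negPf xH).
      move: xf; rewrite ef !inE => /orP[]/eqP xy; last by move: xc; rewrite xy tK yc.
      by have [] := crP _ yc; move: xH; rewrite xy => /negPf ->.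
    by move=> g; rewrite inE => /andP[gd _] xg; apply: dimer_uniq dA gd fd xg xf.
- apply/setP => f; rewrite !in_setU ![f \in within _ _]inE; apply/orP/idP.
    by case=> [/orP[]/andP[]//|/imsetP[x /crP[_ xd _ _] ->]].
  move=> fd; rewrite fd /=; have [->|->|[x xc ->]] := edP f fd; [by left|by left; rewrite orbT|].
  by right; apply: imset_f.
Qed.

(** A matching is the same thing as its crossing edges together with one matching
    on each side of what they leave uncovered; [glue] and [cut_dimers] are the
    two directions. *)
Lemma card_cut A S : S \subset rim ->
  #|[set d in dimers e A | crossing d == S]| =
  ([disjoint S & A] && [disjoint t @: S & A] *
   (#|dimers e (~: H :|: A :|: S)| * #|dimers e (H :|: A :|: t @: S)|))%N.
Proof.
move=> sS; case: (boolP (_ && _)) => [/andP[SA tSA]|dis]; last first.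
  rewrite mul0n; apply/eqP; rewrite cards_eq0; apply/eqP/setP => d; rewrite !inE.
  apply/negP => /andP[dA /eqP crd]; move: dis.
  have dA' : d \in dimers e A by rewrite inE.
  by have [] := cut_dimers dA'; rewrite crd => -> ->.
rewrite mul1n -cardsX -(card_in_imset (f := glue S)).
  apply: eq_card => d; apply/idP/imsetP.
    rewrite inE => /andP[dA /eqP crd]; have [_ _] := cut_dimers dA; rewrite crd => D1 D2 gl.
    by exists (within H d, within (~: H) d); rewrite ?gl // in_setX D1.
  move=> [[d1 d2]]; rewrite in_setX => /andP[D1 D2] ->.
  by have [D c _ _] := glue_dimers sS SA tSA D1 D2; rewrite inE D c eqxx.
move=> [d1 d2] [d3 d4]; rewrite !in_setX => /andP[D1 D2] /andP[D3 D4] eq12.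
have [_ _ w1 w2] := glue_dimers sS SA tSA D1 D2.
have [_ _ w3 w4] := glue_dimers sS SA tSA D3 D4.
by move: w1 w2; rewrite eq12 w3 w4 => -> ->.
Qed.

End Cut.

(** * Factorisation of the partition function with defects *)

Lemma sum_cauchy_schwarz (R : realFieldType) (I : finType) (a b : I -> R) :
  (\sum_i a i * b i) ^+ 2 <= (\sum_i a i ^+ 2) * (\sum_i b i ^+ 2).
Proof.
have H : 0 <= \sum_i \sum_j (a i * b j - a j * b i) ^+ 2.
  by apply: sumr_ge0 => i _; apply: sumr_ge0 => j _; apply: sqr_ge0.
have E : \sum_i \sum_j (a i * b j - a j * b i) ^+ 2 =
    2 * ((\sum_i a i ^+ 2) * (\sum_i b i ^+ 2)) - 2 * (\sum_i a i * b i) ^+ 2.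
  have -> : \sum_i \sum_j (a i * b j - a j * b i) ^+ 2 =
    \sum_i \sum_j (a i ^+ 2 * b j ^+ 2) + \sum_i \sum_j (a j ^+ 2 * b i ^+ 2)
    - 2 * \sum_i \sum_j (a i * b i * (a j * b j)).
    rewrite mulr_sumr -big_split -sumrB /=; apply: eq_bigr => i _.
    rewrite mulr_sumr -big_split -sumrB /=; apply: eq_bigr => j _.
    by rewrite sqrrB; ring.
  rewrite [X in _ + X - _]exchange_big /=.
  have -> : \sum_i \sum_j (a i ^+ 2 * b j ^+ 2) = (\sum_i a i ^+ 2) * (\sum_i b i ^+ 2).
    by rewrite mulr_suml; apply: eq_bigr => i _; rewrite mulr_sumr.
  have -> : \sum_i \sum_j (a i * b i * (a j * b j)) = (\sum_i a i * b i) ^+ 2.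
    by rewrite expr2 mulr_suml; apply: eq_bigr => i _; rewrite mulr_sumr.
  by ring.
by move: H; rewrite E; lra.
Qed.

Lemma disjointU4 (V : finType) (X A1 S1 A2 S2 : {set V}) :
  [disjoint X & (A1 :|: S1) :|: (A2 :|: S2)] =
  [&& [disjoint X & A1], [disjoint S1 & X], [disjoint X & A2] & [disjoint S2 & X]].
Proof. by rewrite -!setI_eq0 !setIUr !setU_eq0 -!(setIC X) -!andbA. Qed.

Section Defects.
Variables (R : realFieldType) (V : finType) (e : rel V) (rho : R).
Hypothesis rho_ge0 : 0 <= rho.
Local Notation pset := ({set V} * {set V})%type.

(** [A.1] and [A.2] are the defects: vertices that the blue, respectively the red,
    dimers leave uncovered although there is no monomer. *)
Definition defect_configs (A : pset) : {set config V} :=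
  [set w : config V | [&& [disjoint monomers w & A.1 :|: A.2],
     blue w \in dimers e (A.1 :|: monomers w) &
     red w \in dimers e (A.2 :|: monomers w)]].

Definition Zdef (A : pset) : R :=
  \sum_(w in defect_configs A) rho ^+ #|monomers w|.

Lemma defect_configs0 : defect_configs (set0, set0) = Omega e.
Proof. by apply/setP => w; rewrite !inE /= !set0U disjoint_sym disjoints_subset sub0set. Qed.

Lemma defect_sum (A : pset) (F : config V -> R) :
  \sum_(w in defect_configs A) F w =
  \sum_(M : {set V} | [disjoint M & A.1 :|: A.2]) \sum_(b in dimers e (A.1 :|: M))
     \sum_(r in dimers e (A.2 :|: M)) F (M, b, r).
Proof.
under [RHS]eq_bigr => M _ do rewrite pair_big_dep /=.
rewrite pair_big_dep /=.
rewrite (reindex (fun p : {set V} * ({set {set V}} * {set {set V}}) => (p.1, p.2.1, p.2.2))) /=.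
  by apply: eq_big => [[M [b r]]|[M [b r]] _] //=; rewrite inE.
by exists (fun w => (w.1.1, (w.1.2, w.2))) => [[M [b r]]|[[M b] r]].
Qed.

Lemma Zdef_ge0 A : 0 <= Zdef A.
Proof. by apply: sumr_ge0 => w _; apply: exprn_ge0. Qed.

Variables (t : V -> V) (H : {set V}).
Hypotheses (e_sym : symmetric e) (Rf : reflection e t H).
Let tK : involutive t := refl_inv Rf.
Let tI : injective t := can_inj tK.
Let tH x : (t x \in H) = (x \notin H) := refl_half Rf x.
Local Notation bd := (rim e t H).
Local Notation cr := (crossing t H).

Definition mirror (A B : pset) : pset := (A.1 :|: t @: B.1, A.2 :|: t @: B.2).

Lemma card_dimers_refl (A : {set V}) : #|dimers e (t @: A)| = #|dimers e A|.
Proof.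
pose F (d : {set {set V}}) : {set {set V}} := [set (t @: f : {set V}) | f : {set V} in d].
have tKs : involutive (fun f : {set V} => t @: f).
  by move=> f; rewrite -imset_comp -[RHS]imset_id; apply: eq_imset => x; apply: tK.
have FK : involutive F.
  by move=> d; rewrite /F -imset_comp -[RHS]imset_id; apply: eq_imset => x; apply: tKs.
have memF (d : {set {set V}}) (f : {set V}) : (f \in F d) = (t @: f \in d).
  apply/imsetP/idP => [[g gd ->]|fd]; first by rewrite tKs.
  by exists (t @: f); rewrite ?tKs.
have key (B : {set V}) d : d \in dimers e B -> F d \in dimers e (t @: B).
  move=> dB; apply: in_dimers.
  - move=> f; rewrite memF => /(dimer_edge dB)[x [y [exy ef _ _]]].
    apply/edgesP; exists (t x), (t y); rewrite (refl_adj Rf) exy; split=> //.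
    by rewrite -[f]tKs ef imsetU1 imset_set1.
  - move=> f x; rewrite memF => fd xf; rewrite (mem_timg Rf).
    have [a [b [_ ef aB bB]]] := dimer_edge dB fd.
    have : t x \in t @: f by apply: imset_f.
    by rewrite ef in_set2 => /orP[]/eqP->.
  - move=> x; rewrite (mem_timg Rf) => xB.
    have [f fd xf] := dimer_ex dB xB; exists (t @: f).
    rewrite memF tKs fd; split=> //; first by rewrite (mem_timg Rf).
    move=> g; rewrite memF => gd xg; apply: (can_inj tKs); rewrite tKs.
    by apply: dimer_uniq dB gd fd _ xf; apply: imset_f.
rewrite -(card_imset _ (can_inj FK)); apply: eq_card => d.
apply/imsetP/idP => [[d' d'A ->]|dA].
  by have := key _ _ d'A; rewrite tKs.
by exists (F d); rewrite ?FK //; apply: key.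
Qed.

Lemma cut_count (A B M1 M2 S : {set V}) :
  A \subset H -> B \subset H -> M1 \subset H -> M2 \subset H -> S \subset bd ->
  #|[set d in dimers e ((A :|: t @: B) :|: (M1 :|: t @: M2)) | cr d == S]| =
  ([&& [disjoint S & A], [disjoint S & B], [disjoint S & M1] & [disjoint S & M2]] *
   (#|dimers e (~: H :|: (A :|: S) :|: M1)| * #|dimers e (~: H :|: (B :|: S) :|: M2)|))%N.
Proof.
move=> AH BH M1H M2H Sbd; rewrite (card_cut e_sym Rf) //.
have SH : S \subset H by apply: subset_trans Sbd _; apply/subsetP => x; apply: rim_half.
have sub (U : {set V}) x : U \subset H -> x \in U -> x \in H by move=> /subsetP; apply.
have nsub (U : {set V}) x : U \subset H -> x \notin H -> x \in U = false.
  by move=> UH; apply: contraNF; apply: sub.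
congr (_ * (_ * _))%N.
- congr (nat_of_bool _); rewrite -!setI_eq0; apply/andP/and4P.
    move=> [/eqP/setP E1 /eqP/setP E2]; split; apply/eqP/setP => x.
    + by have := E1 x; rewrite !inE; case: (x \in S) => //=; case: (x \in A).
    + have := E2 (t x); rewrite !(inE, mem_timg Rf) tK.
      by case: (x \in S) => //=; case: (x \in B); rewrite ?orbT.
    + by have := E1 x; rewrite !inE; case: (x \in S) => //=; case: (x \in M1); rewrite ?orbT.
    + have := E2 (t x); rewrite !(inE, mem_timg Rf) tK.
      by case: (x \in S) => //=; case: (x \in M2); rewrite ?orbT.
  move=> [/eqP/setP E1 /eqP/setP E2 /eqP/setP E3 /eqP/setP E4]; split; apply/eqP/setP => x.
    have := E1 x; have := E3 x; rewrite !(inE, mem_timg Rf).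
    case: (boolP (x \in S)) => //= xS -> ->; have := sub _ _ SH xS => xH.
    by rewrite (nsub B) ?(nsub M2) // tH xH.
  have := E2 (t x); have := E4 (t x); rewrite !(inE, mem_timg Rf).
  case: (boolP (t x \in S)) => //= xS -> ->; have := sub _ _ SH xS; rewrite tH => xH.
  by rewrite (nsub A) ?(nsub M1).
- congr #|pred_of_set (dimers e _)|; apply/setP => x.
  rewrite !(inE, mem_timg Rf); case: (boolP (x \in H)) => //= xH.
  rewrite (nsub B) ?(nsub M2) ?tH ?xH // !orbF.
  by case: (x \in A); case: (x \in S); rewrite ?orbT ?orbF.
- rewrite -[RHS]card_dimers_refl; congr #|pred_of_set (dimers e _)|; apply/setP => x.
  rewrite !(inE, mem_timg Rf) tH negbK; case: (boolP (x \in H)) => //= xH.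
  rewrite (nsub A) ?(nsub M1) //=.
  by case: (t x \in B); case: (t x \in S); rewrite ?orbT ?orbF.
Qed.

(** The contribution of one side, with defects [A] and with the crossing dimers
    [S.1], [S.2] of the two colours. The vertices of [S] are treated as
    covered, exactly like defects, which is the origin of [half_weight_shift]. *)
Definition half_weight (A S : pset) : R :=
  if [&& S.1 \subset bd, S.2 \subset bd, [disjoint S.1 & A.1] & [disjoint S.2 & A.2]]
  then \sum_(M : {set V} | (M \subset H) &&
                 [disjoint M & (A.1 :|: S.1) :|: (A.2 :|: S.2)])
    rho ^+ #|M| * (#|dimers e (~: H :|: (A.1 :|: S.1) :|: M)|)%:R
                * (#|dimers e (~: H :|: (A.2 :|: S.2) :|: M)|)%:R
  else 0.

Lemma half_weight_ge0 A S : 0 <= half_weight A S.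
Proof.
rewrite /half_weight; case: ifP => // _; apply: sumr_ge0 => M _.
by rewrite !mulr_ge0 ?exprn_ge0 ?ler0n.
Qed.

Lemma sum_cr (D : {set {set {set V}}}) (g : {set V} -> R) :
  \sum_(d in D) g (cr d) = \sum_S g S * (#|[set d in D | cr d == S]|)%:R.
Proof.
rewrite (partition_big cr predT) //=; apply: eq_bigr => S _.
rewrite (eq_bigr (fun=> g S)) => [|d /andP[_ /eqP->]//].
rewrite sumr_const mulr_natr; congr (_ *+ _).
by apply: eq_card => d; rewrite !inE.
Qed.

(** A monomer set is a pair of monomer sets of the near side, one of them reflected. *)
Lemma sum_split_set (F : {set V} -> R) :
  \sum_M F M = \sum_(M1 : {set V} | M1 \subset H) \sum_(M2 : {set V} | M2 \subset H) F (M1 :|: t @: M2).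
Proof.
rewrite pair_big /=.
rewrite (reindex_onto (fun p : pset => p.1 :|: t @: p.2)
   (fun M => (M :&: H, (t @: M) :&: H))) /=.
  apply: eq_bigl => [[M1 M2]] /=; rewrite xpair_eqE; apply/andP/andP => -[].
    by move=> /eqP <- /eqP <-; rewrite !subsetIr.
  move=> /subsetP s1 /subsetP s2; split; apply/eqP/setP => x; rewrite !(inE, mem_timg Rf) ?tK.
    case: (boolP (x \in H)) => xH; rewrite ?andbT ?andbF.
      by case: (boolP (t x \in M2)) => [/s2|]; rewrite ?tH ?xH ?orbF.
    by symmetry; apply: contraNF xH => /s1.
  case: (boolP (x \in H)) => xH; rewrite ?andbT ?andbF.
    by case: (boolP (t x \in M1)) => [/s1|]; rewrite ?tH ?xH.
  by symmetry; apply: contraNF xH => /s2.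
move=> M _; apply/setP => x; rewrite !(inE, mem_timg Rf) tK tH.
by case: (x \in H); rewrite ?andbT ?andbF ?orbF.
Qed.

(** Once the crossing dimers are fixed the two sides do not interact, and the
    reflection turns the far side into another near side. *)
Lemma cut_sum (A B : pset) (h : pset -> R) :
  A.1 \subset H -> A.2 \subset H -> B.1 \subset H -> B.2 \subset H ->
  \sum_(w in defect_configs (mirror A B)) h (cr (blue w), cr (red w)) * rho ^+ #|monomers w|
  = \sum_S h S * (half_weight A S * half_weight B S).
Proof.
move=> A1H A2H B1H B2H.
rewrite defect_sum /=.
pose N (A S M : {set V}) : R := (#|dimers e (~: H :|: (A :|: S) :|: M)|)%:R.
have step (M1 M2 : {set V}) : M1 \subset H -> M2 \subset H ->
  (if [disjoint M1 :|: t @: M2 & (A.1 :|: t @: B.1) :|: (A.2 :|: t @: B.2)] then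
  \sum_(b in dimers e (A.1 :|: t @: B.1 :|: (M1 :|: t @: M2)))
  \sum_(r in dimers e (A.2 :|: t @: B.2 :|: (M1 :|: t @: M2)))
     h (cr b, cr r) * rho ^+ #|M1 :|: t @: M2| else 0) =
  \sum_(S : pset) h S * (
    (if [&& S.1 \subset bd, S.2 \subset bd, [disjoint S.1 & A.1] & [disjoint S.2 & A.2]] then
     if [disjoint M1 & (A.1 :|: S.1) :|: (A.2 :|: S.2)] then
       rho ^+ #|M1| * N A.1 S.1 M1 * N A.2 S.2 M1 else 0 else 0) *
    (if [&& S.1 \subset bd, S.2 \subset bd, [disjoint S.1 & B.1] & [disjoint S.2 & B.2]] then
     if [disjoint M2 & (B.1 :|: S.1) :|: (B.2 :|: S.2)] then
       rho ^+ #|M2| * N B.1 S.1 M2 * N B.2 S.2 M2 else 0 else 0)).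
  move=> M1H M2H.
  have disM : [disjoint M1 :|: t @: M2 & (A.1 :|: t @: B.1) :|: (A.2 :|: t @: B.2)] =
     [&& [disjoint M1 & A.1], [disjoint M1 & A.2], [disjoint M2 & B.1] & [disjoint M2 & B.2]].
    rewrite -!setI_eq0; apply/eqP/and4P.
      move=> /setP E; split; apply/eqP/setP => x.
      + by have := E x; rewrite !inE; case: (x \in M1) => //=; case: (x \in A.1).
      + by have := E x; rewrite !inE; case: (x \in M1) => //=; case: (x \in A.2); rewrite ?orbT.
      + have := E (t x); rewrite !(inE, mem_timg Rf) tK.
        by case: (x \in M2); rewrite ?andbF //= orbT /=; case: (x \in B.1); rewrite ?orbT.
      + have := E (t x); rewrite !(inE, mem_timg Rf) tK.
        by case: (x \in M2); rewrite ?andbF //= orbT /=; case: (x \in B.2); rewrite ?orbT.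
    move=> [/eqP/setP E1 /eqP/setP E2 /eqP/setP E3 /eqP/setP E4]; apply/setP => x.
    have := E1 x; have := E2 x; have := E3 (t x); have := E4 (t x).
    have nsub (U : {set V}) y : U \subset H -> y \notin H -> y \in U = false.
      by move=> /subsetP UH; apply: contraNF; apply: UH.
    rewrite !(inE, mem_timg Rf); case: (boolP (x \in H)) => xH.
      rewrite !(nsub M2) ?(nsub B.1) ?(nsub B.2) ?tH ?xH //=.
      by case: (x \in M1) => //= _ _ -> ->.
    rewrite !(nsub M1) ?(nsub A.1) ?(nsub A.2) //=.
    by case: (t x \in M2) => //= -> ->.
  case: ifP => [|dis].
    rewrite disM => /and4P[d1 d2 d3 d4].
    have cardM : #|M1 :|: t @: M2| = (#|M1| + #|M2|)%N.
      rewrite cardsU (card_imset _ tI).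
      suff -> : M1 :&: t @: M2 = set0 by rewrite cards0 subn0.
      apply/setP => x; rewrite !(inE, mem_timg Rf); apply/negP => /andP[/(subsetP M1H) xH /(subsetP M2H)].
      by rewrite tH xH.
    rewrite cardM.
    under eq_bigr => b _ do rewrite (sum_cr _ (fun S2 => h (cr b, S2) * rho ^+ (#|M1| + #|M2|))).
    rewrite (sum_cr _ (fun S1 => \sum_S (h (S1, S) * rho ^+ (#|M1| + #|M2|) * _))).
    under eq_bigr => S1 _ do rewrite mulr_suml.
    rewrite pair_big /=; apply: eq_bigr => -[S1 S2] _ /=.
    case: (boolP (S1 \subset bd)) => S1b /=; last first.
      rewrite mul0r mulr0.
      suff -> : #|[set d in dimers e (A.1 :|: t @: B.1 :|: (M1 :|: t @: M2)) | cr d == S1]| = 0%N by rewrite mulr0.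
      apply/eqP; rewrite cards_eq0; apply/eqP/setP => d; rewrite [LHS]inE [RHS]inE.
      apply/negP => /andP[dA /eqP crd]; move: S1b; rewrite -crd.
      by rewrite (crossing_rim e_sym Rf dA).
    case: (boolP (S2 \subset bd)) => S2b /=; last first.
      rewrite mul0r mulr0.
      suff -> : #|[set d in dimers e (A.2 :|: t @: B.2 :|: (M1 :|: t @: M2)) | cr d == S2]| = 0%N by rewrite mulr0 mul0r.
      apply/eqP; rewrite cards_eq0; apply/eqP/setP => d; rewrite [LHS]inE [RHS]inE.
      apply/negP => /andP[dA /eqP crd]; move: S2b; rewrite -crd.
      by rewrite (crossing_rim e_sym Rf dA).
    rewrite !cut_count //.
    rewrite !disjointU4 d1 d2 d3 d4 /= exprD !natrM /N.
    case: [disjoint S1 & A.1]; case: [disjoint S2 & A.2]; case: [disjoint S1 & B.1];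
    case: [disjoint S2 & B.2]; case: [disjoint S1 & M1]; case: [disjoint S2 & M1];
    case: [disjoint S1 & M2]; case: [disjoint S2 & M2]; rewrite /=; ring.
  rewrite big1 // => -[S1 S2] _ /=.
  rewrite !disjointU4; move: dis; rewrite disM.
  case: [disjoint M1 & A.1]; case: [disjoint M1 & A.2];
  case: [disjoint M2 & B.1]; case: [disjoint M2 & B.2] => //= _;
  rewrite ?andbF /=; do ?case: ifP => _; rewrite ?mulr0 ?mul0r ?mulr0 //.
rewrite big_mkcond /= sum_split_set.
rewrite (eq_bigr _ (fun M1 M1H => eq_bigr _ (fun M2 M2H => step M1 M2 M1H M2H))).
under eq_bigr => M1 M1H do rewrite exchange_big /=.
rewrite exchange_big /=; apply: eq_bigr => S _.
under eq_bigr => M1 M1H do rewrite -mulr_sumr -mulr_sumr.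
rewrite -mulr_sumr -mulr_suml; congr (_ * (_ * _)); rewrite /half_weight; case: ifP => _;
 by rewrite ?big_mkcondr //= big1.
Qed.

End Defects.

(** * Reflection positivity and the uncertainty inequality *)

Lemma sum_setU (M : nmodType) (T : finType) (A B : {set T}) (f : T -> M) :
  [disjoint A & B] ->
  \sum_(x in A :|: B) f x = \sum_(x in A) f x + \sum_(x in B) f x.
Proof.
move=> dAB; rewrite -bigU //; apply: eq_bigl => x; by rewrite !inE.
Qed.

Section Uncertainty.
Variables (R : realFieldType) (V : finType) (e : rel V) (rho : R).
Hypothesis rho_ge0 : 0 <= rho.
Variables (t : V -> V) (H : {set V}).
Hypotheses (e_sym : symmetric e) (Rf : reflection e t H).
Local Notation pset := ({set V} * {set V})%type.
Local Notation bd := (rim e t H).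
Local Notation cr := (crossing t H).
Local Notation Z := (Zdef e rho (set0, set0)).
Local Notation Zd := (Zdef e rho).
Local Notation Wf := (half_weight e rho t H).
Local Notation psi := (Wf (set0, set0)).

Lemma Zdef_cut (A B : pset) :
  A.1 \subset H -> A.2 \subset H -> B.1 \subset H -> B.2 \subset H ->
  Zd (mirror t A B) = \sum_S Wf A S * Wf B S.
Proof.
move=> A1 A2 B1 B2; have E := cut_sum rho e_sym Rf (fun=> 1) A1 A2 B1 B2.
by etransitivity; [etransitivity; [|exact: E]|]; apply: eq_bigr => ? _; rewrite mul1r.
Qed.

(** The factorisation is a scalar product, so this is Cauchy-Schwarz. *)
Lemma reflection_positivity (A B : pset) :
  A.1 \subset H -> A.2 \subset H -> B.1 \subset H -> B.2 \subset H ->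
  Zd (mirror t A B) ^+ 2 <= Zd (mirror t A A) * Zd (mirror t B B).
Proof.
move=> A1 A2 B1 B2; rewrite !Zdef_cut //.
have := sum_cauchy_schwarz (Wf A) (Wf B).
by under [X in _ <= X * _]eq_bigr => ? _ do rewrite expr2;
   under [X in _ <= _ * X]eq_bigr => ? _ do rewrite expr2.
Qed.

Lemma mirror0 : mirror t (set0, set0) (set0, set0) = (set0, set0).
Proof. by rewrite /mirror /= !imset0 !setU0. Qed.

Lemma sum_psi (h : pset -> R) :
  \sum_(w in defect_configs e (set0, set0)) h (cr (blue w), cr (red w)) * rho ^+ #|monomers w|
  = \sum_S h S * psi S ^+ 2.
Proof.
by rewrite -{1}mirror0 cut_sum ?sub0set.
Qed.

Lemma Z_psi : Z = \sum_S psi S ^+ 2.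
Proof.
have E := sum_psi (fun=> 1).
by etransitivity; [etransitivity; [|exact: E]|]; apply: eq_bigr => ? _; rewrite mul1r.
Qed.

Definition psetU (A B : pset) : pset := (A.1 :|: B.1, A.2 :|: B.2).
Definition pdisj (A B : pset) := [disjoint A.1 & B.1] && [disjoint A.2 & B.2].

(** Defects next to the mirror play the same role as crossing dimers, so a half-weight
    with such defects is a shifted [psi]. *)
Lemma half_weight_shift (A S : pset) : A.1 \subset bd -> A.2 \subset bd ->
  Wf A S = if pdisj S A then psi (psetU S A) else 0.
Proof.
move=> A1 A2; rewrite /half_weight /pdisj /psetU /= !subUset A1 A2 !andbT.
rewrite !(disjoint_sym _ set0) !disjoints_subset !sub0set !andbT.
rewrite -!disjoints_subset.
case: [disjoint S.1 & A.1]; case: [disjoint S.2 & A.2]; rewrite ?andbF ?andbT //.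
by rewrite !set0U !(setUC A.1) !(setUC A.2).
Qed.

(** The shift by [A] is injective on the sets disjoint from [A], and the half-weight
    vanishes on the others. *)
Lemma sum_half_weight_le (A : pset) (h : pset -> R) : A.1 \subset bd -> A.2 \subset bd ->
  (forall S, 0 <= h S) ->
  \sum_S h (psetU S A) * Wf A S ^+ 2 <= \sum_S h S * psi S ^+ 2.
Proof.
move=> A1 A2 h0.
rewrite (bigID (fun S => pdisj S A)) /= [X in _ + X]big1 ?addr0; last first.
  by move=> S /negPf nd; rewrite half_weight_shift // nd expr0n mulr0.
rewrite (eq_bigr (fun S => h (psetU S A) * psi (psetU S A) ^+ 2)); last first.
  by move=> S d; rewrite half_weight_shift // d.
rewrite [X in _ <= X](bigID (fun T : pset => (A.1 \subset T.1) && (A.2 \subset T.2))) /=.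
rewrite [X in _ <= X + _](reindex_onto (fun S => psetU S A)
  (fun T => (T.1 :\: A.1, T.2 :\: A.2))) /=; last first.
  move=> [T1 T2] /andP[/= s1 s2]; rewrite /psetU /=; congr pair.
    by rewrite setUC setDE setUIr setUCr setIT; apply/setUidPr.
  by rewrite setUC setDE setUIr setUCr setIT; apply/setUidPr.
have -> : \sum_(S | pdisj S A) h (psetU S A) * psi (psetU S A) ^+ 2 =
  \sum_(j | (A.1 \subset (psetU j A).1) && (A.2 \subset (psetU j A).2) &&
         (((psetU j A).1 :\: A.1, (psetU j A).2 :\: A.2) == j))
    h (psetU j A) * psi (psetU j A) ^+ 2.
  apply: eq_bigl => -[S1 S2]; rewrite /psetU /pdisj /= !subsetUr /= xpair_eqE.
  have E (X Y : {set V}) : ((X :|: Y) :\: Y == X) = [disjoint X & Y].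
    rewrite setDUl setDv setU0 -setI_eq0; apply/eqP/eqP => [<-|XY].
      by rewrite setDE -setIA [_ :&: Y]setIC setICr setI0.
    by rewrite setDE; apply/setIidPl; rewrite -disjoints_subset -setI_eq0 XY.
  by rewrite !E.
rewrite lerDl; apply: sumr_ge0 => S _; apply: mulr_ge0; rewrite ?sqr_ge0 //.
Qed.

Lemma sum_half_weight_sqr_le (A : pset) : A.1 \subset bd -> A.2 \subset bd ->
  \sum_S Wf A S ^+ 2 <= Z.
Proof.
move=> A1 A2; rewrite Z_psi; have := sum_half_weight_le (h := fun=> 1) A1 A2 (fun=> ler01).
by rewrite -!mulr_sumr !mul1r.
Qed.

Lemma Zdef_mirror_le (A B : pset) : A.1 \subset bd -> A.2 \subset bd ->
  B.1 \subset bd -> B.2 \subset bd -> Zd (mirror t A B) <= Z.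
Proof.
have sub : bd \subset H by apply/subsetP => x; apply: rim_half.
move=> A1 A2 B1 B2.
have HA := sum_half_weight_sqr_le A1 A2; have HB := sum_half_weight_sqr_le B1 B2.
rewrite -(@ler_pXn2r _ 2) ?nnegrE ?Zdef_ge0 //.
rewrite Zdef_cut ?(subset_trans _ sub) //.
apply: (le_trans (sum_cauchy_schwarz _ _)).
by rewrite expr2; apply: ler_pM => //; apply: sumr_ge0 => S _; apply: sqr_ge0.
Qed.

Definition charge (c1 c2 : V -> R) (S : pset) : R :=
  \sum_(x in S.1) c1 x + \sum_(x in S.2) c2 x.

Lemma chargeU c1 c2 S A : pdisj S A ->
  charge c1 c2 (psetU S A) = charge c1 c2 S + charge c1 c2 A.
Proof.
move=> /andP[d1 d2]; rewrite /charge /psetU /= !sum_setU //.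
by ring.
Qed.

(** If inserting the defects [A] below and the defects [B] above the mirror
    changes the flux through the mirror by different amounts, then the two
    shifted wave functions overlap only where the flux is large. *)
Lemma uncertainty (c1 c2 : V -> R) (A B : pset) : A.1 \subset bd -> A.2 \subset bd ->
  B.1 \subset bd -> B.2 \subset bd ->
  ((charge c1 c2 A - charge c1 c2 B) * Zd (mirror t A B)) ^+ 2 <=
  4 * (\sum_(w in defect_configs e (set0, set0))
         charge c1 c2 (cr (blue w), cr (red w)) ^+ 2 * rho ^+ #|monomers w|) * Z.
Proof.
have sub : bd \subset H by apply/subsetP => x; apply: rim_half.
move=> A1 A2 B1 B2; rewrite (sum_psi (fun S => charge c1 c2 S ^+ 2)).
set X := \sum_S _.
have bound (C D : pset) : C.1 \subset bd -> C.2 \subset bd ->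
  D.1 \subset bd -> D.2 \subset bd ->
  (\sum_S (charge c1 c2 (psetU S C) * Wf C S) * Wf D S) ^+ 2 <= X * Z.
  move=> C1 C2 D1 D2; apply: (le_trans (sum_cauchy_schwarz _ _)).
  apply: ler_pM; try (by apply: sumr_ge0 => S _; apply: sqr_ge0).
    have := sum_half_weight_le (h := fun S => charge c1 c2 S ^+ 2) C1 C2 (fun=> sqr_ge0 _).
    by under eq_bigr => S _ do rewrite -exprMn.
  exact: sum_half_weight_sqr_le.
have HA := bound A B A1 A2 B1 B2; have HB := bound B A B1 B2 A1 A2.
rewrite Zdef_cut ?(subset_trans _ sub) //.
have -> : (charge c1 c2 A - charge c1 c2 B) * \sum_S Wf A S * Wf B S =
   (\sum_S (charge c1 c2 (psetU S A) * Wf A S) * Wf B S) -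
   (\sum_S (charge c1 c2 (psetU S B) * Wf B S) * Wf A S).
  rewrite mulr_sumr -sumrB; apply: eq_bigr => S _.
  have [dA|dA] := boolP (pdisj S A); last first.
    by rewrite (half_weight_shift S A1 A2) (negPf dA); ring.
  have [dB|dB] := boolP (pdisj S B); last first.
    by rewrite (half_weight_shift S B1 B2) (negPf dB); ring.
  by rewrite !chargeU //; ring.
move: HA HB; set a := \sum_S _; set b := \sum_S _ => HA HB.
have : (a - b) ^+ 2 <= 2 * (a ^+ 2 + b ^+ 2) by have := sqr_ge0 (a + b); nra.
by nra.
Qed.

End Uncertainty.

(** * Raising and lowering a crossing edge *)

Lemma sum_inj_le (R : realFieldType) (I J : finType) (P : pred I) (h : I -> J) (f : J -> R) :
  {in P &, injective h} -> (forall j, 0 <= f j) ->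
  \sum_(i | P i) f (h i) <= \sum_j f j.
Proof.
move=> hI f0; have -> : \sum_(i | P i) f (h i) = \sum_(j in [set h i | i in P]) f j.
  by rewrite big_imset //=; apply: eq_bigl => i.
rewrite [X in _ <= X](bigID (mem [set h i | i in P])) /=.
by rewrite lerDl; apply: sumr_ge0.
Qed.

Section Ladder.
Variables (R : realFieldType) (V : finType) (psi : {set V} * {set V} -> R).
Hypothesis psi_ge0 : forall S, 0 <= psi S.
Local Notation pset := ({set V} * {set V})%type.
Implicit Types (p q : {set V}) (S : pset).

(** [lower] and [raise] are adjoint to each other: they absorb an edge of the mirror
    into the set of crossing dimers, respectively release it. *)
Definition lower p S : R := if [disjoint S.1 & p] then psi (S.1 :|: p, S.2) else 0.
Definition raise p S : R := if p \subset S.1 then psi (S.1 :\: p, S.2) else 0.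
Local Notation norm2 := (\sum_S psi S ^+ 2).

Lemma lower_ge0 p S : 0 <= lower p S.
Proof. by rewrite /lower; case: ifP. Qed.

Lemma raise_ge0 p S : 0 <= raise p S.
Proof. by rewrite /raise; case: ifP. Qed.

Lemma setDUK (p X : {set V}) : [disjoint X & p] -> (X :|: p) :\: p = X.
Proof.
move=> dXp; rewrite setDUl setDv setU0 setDE; apply/setIidPl.
by rewrite -disjoints_subset.
Qed.

Lemma setUDK (p X : {set V}) : p \subset X -> (X :\: p) :|: p = X.
Proof. by move=> pX; rewrite setUC setDE setUIr setUCr setIT; apply/setUidPr. Qed.

Lemma lower_norm p : \sum_S lower p S ^+ 2 <= norm2.
Proof.
rewrite (eq_bigr (fun S => if [disjoint S.1 & p] then psi (S.1 :|: p, S.2) ^+ 2 else 0)); last first.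
  by move=> S _; rewrite /lower; case: ifP => // _; rewrite expr0n.
rewrite -big_mkcond /=; apply: (@sum_inj_le _ _ _ (fun S : pset => [disjoint S.1 & p])
   (fun S : pset => (S.1 :|: p, S.2)) (fun S => psi S ^+ 2)).
  move=> [S1 S2] [T1 T2] /= d1 d2 [e1 ->]; congr pair.
  by have := setDUK d1; rewrite /= e1 setDUK.
by move=> S; apply: sqr_ge0.
Qed.

Lemma raise_norm p : \sum_S raise p S ^+ 2 <= norm2.
Proof.
rewrite (eq_bigr (fun S => if p \subset S.1 then psi (S.1 :\: p, S.2) ^+ 2 else 0)); last first.
  by move=> S _; rewrite /raise; case: ifP => // _; rewrite expr0n.
rewrite -big_mkcond /=; apply: (@sum_inj_le _ _ _ (fun S : pset => p \subset S.1)
   (fun S : pset => (S.1 :\: p, S.2)) (fun S => psi S ^+ 2)).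
  move=> [S1 S2] [T1 T2] /= d1 d2 [e1 ->]; congr pair.
  by have := setUDK d1; rewrite /= e1 setUDK.
by move=> S; apply: sqr_ge0.
Qed.

(** Both sides run over [S = T :|: p :|: q] with [T] disjoint from [p] and [q], and
    pair the value at [T :|: p] with the value at [T :|: q]. *)
Lemma ladder_commute p q : [disjoint p & q] ->
  \sum_S raise p S * raise q S = \sum_S lower p S * lower q S.
Proof.
move=> dpq.
rewrite (bigID (fun S : pset => p :|: q \subset S.1)) /= [X in _ + X]big1 ?addr0; last first.
  move=> S; rewrite subUset /raise.
  by case: (p \subset S.1) => //=; rewrite ?mul0r // => /negPf ->; rewrite mulr0.
rewrite [RHS](bigID (fun S : pset => [disjoint S.1 & p :|: q])) /= [X in _ = _ + X]big1 ?addr0; last first.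
  move=> S; rewrite -setI_eq0 setIUr setU_eq0 !setI_eq0 /lower.
  by case: [disjoint S.1 & p] => //=; rewrite ?mul0r // => /negPf ->; rewrite mulr0.
rewrite (reindex_onto (fun S : pset => (S.1 :|: (p :|: q), S.2))
   (fun S => (S.1 :\: (p :|: q), S.2))) /=; last first.
  by move=> [S1 S2] /= pq; rewrite setUDK.
apply: eq_big => [[S1 S2]|[S1 S2]] /=.
  rewrite subsetUr /= xpair_eqE eqxx andbT; apply/eqP/idP => [<-|]; last exact: setDUK.
  by rewrite disjoints_subset setDE subsetIr.
rewrite subsetUr /= xpair_eqE eqxx andbT => /eqP eS.
have /andP[dp dq] : [disjoint S1 & p] && [disjoint S1 & q].
  by rewrite -!setI_eq0 -setU_eq0 -setIUr setI_eq0 -eS disjoints_subset setDE subsetIr.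
have dqp : [disjoint q & p] by rewrite disjoint_sym.
have dis (X Y Z : {set V}) : [disjoint X & Z] -> [disjoint Y & Z] -> [disjoint X :|: Y & Z].
  by rewrite -!setI_eq0 setIUl setU_eq0 => -> ->.
rewrite /raise /lower /= dp dq.
rewrite (subset_trans (subsetUl p q) (subsetUr S1 _)) (subset_trans (subsetUr p q) (subsetUr S1 _)).
have -> : S1 :|: (p :|: q) = (S1 :|: q) :|: p by rewrite (setUC p) setUA.
rewrite setDUK; last exact: dis.
have -> : (S1 :|: q) :|: p = (S1 :|: p) :|: q by rewrite -!setUA (setUC p).
rewrite setDUK; last exact: dis.
by rewrite mulrC.
Qed.

Lemma prod_le_norm (f g : pset -> R) : (forall S, 0 <= f S) -> (forall S, 0 <= g S) ->
  \sum_S f S ^+ 2 <= norm2 -> \sum_S g S ^+ 2 <= norm2 ->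
  0 <= \sum_S f S * g S <= norm2.
Proof.
move=> f0 g0 fn gn; apply/andP; split; first by apply: sumr_ge0 => S _; apply: mulr_ge0.
have : \sum_S f S * g S <= \sum_S (2^-1 * f S ^+ 2 + 2^-1 * g S ^+ 2).
  by apply: ler_sum => S _; have := sqr_ge0 (f S - g S); nra.
rewrite big_split /= -!mulr_sumr; lra.
Qed.

(** Raising and lowering commute for disjoint edges, so only the pairs of
    incident edges contribute to the difference of the two norms. *)
Lemma raise_lower_bound (T : V -> V) (F : V -> R) : injective T ->
  \sum_S (\sum_x F x * raise [set x; T x] S) ^+ 2 <=
  \sum_S (\sum_x F x * lower [set x; T x] S) ^+ 2 + 3 * (\sum_x F x ^+ 2) * norm2.
Proof.
move=> TI; set N := norm2.
have N0 : 0 <= N by apply: sumr_ge0 => S _; apply: sqr_ge0.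
pose ed x := [set x; T x].
have expand (G : V -> pset -> R) : \sum_S (\sum_x F x * G x S) ^+ 2 =
   \sum_x \sum_y F x * F y * \sum_S G x S * G y S.
  under eq_bigr => S _ do rewrite expr2 mulr_suml.
  rewrite exchange_big /=; apply: eq_bigr => x _.
  under eq_bigr => S _ do rewrite mulr_sumr.
  rewrite exchange_big /=; apply: eq_bigr => y _.
  by rewrite mulr_sumr; apply: eq_bigr => S _; ring.
rewrite (expand (fun x => raise (ed x))) (expand (fun x => lower (ed x))).
rewrite -lerBlDl -sumrB.
under eq_bigr => x _ do rewrite -sumrB.
have bnd x y : F x * F y * (\sum_S raise (ed x) S * raise (ed y) S) -
    F x * F y * (\sum_S lower (ed x) S * lower (ed y) S) <=
    2^-1 * N * ((F x ^+ 2 + F y ^+ 2) * ((y == x)%:R + (y == T x)%:R + (x == T y)%:R)).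
  have [dxy|] := boolP [disjoint ed x & ed y].
    rewrite (ladder_commute dxy) subrr; apply: mulr_ge0; first by nra.
    by apply: mulr_ge0; rewrite ?addr_ge0 ?sqr_ge0 ?ler0n.
  rewrite -setI_eq0 => /set0Pn[z]; rewrite !inE => zxy.
  have c1 : 1 <= (y == x)%:R + (y == T x)%:R + (x == T y)%:R :> R.
    have : (y == x) || (y == T x) || (x == T y).
      case/andP: zxy => /orP[]/eqP-> /orP[].
      - by move=> /eqP ->; rewrite eqxx.
      - by move=> ->; rewrite orbT.
      - by move=> /eqP <-; rewrite eqxx orbT.
      - by rewrite (inj_eq TI) => /eqP ->; rewrite eqxx.
    case: (y == x); case: (y == T x); case: (x == T y) => //= _; rewrite ?addr0 ?add0r; lra.
  have /andP[r0 r1] := prod_le_norm (raise_ge0 (ed x)) (raise_ge0 (ed y)) (raise_norm _) (raise_norm _).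
  have /andP[l0 l1] := prod_le_norm (lower_ge0 (ed x)) (lower_ge0 (ed y)) (lower_norm _) (lower_norm _).
  move: r0 r1 l0 l1; set r := \sum_S _ * _; set l := \sum_S _ * _; rewrite -/N => r0 r1 l0 l1.
  set c := _ + _ + _ in c1 *.
  have h1 : F x * F y * r - F x * F y * l <= 2^-1 * (F x ^+ 2 + F y ^+ 2) * N.
    have p1 := sqr_ge0 (F x - F y); have p2 := sqr_ge0 (F x + F y).
    have -> : F x * F y * r - F x * F y * l = F x * F y * (r - l) by ring.
    have [d|d] := lerP 0 (r - l).
      apply: (@le_trans _ _ (2^-1 * (F x ^+ 2 + F y ^+ 2) * (r - l))).
        by apply: ler_wpM2r => //; nra.
      by apply: ler_wpM2l; [nra|lra].
    apply: (@le_trans _ _ (2^-1 * (F x ^+ 2 + F y ^+ 2) * (l - r))).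
      have -> : F x * F y * (r - l) = - (F x * F y) * (l - r) by ring.
      by apply: ler_wpM2r; [lra|nra].
    by apply: ler_wpM2l; [nra|lra].
  apply: (le_trans h1).
  have -> : 2^-1 * N * ((F x ^+ 2 + F y ^+ 2) * c) = 2^-1 * (F x ^+ 2 + F y ^+ 2) * N * c by ring.
  by apply: ler_peMr => //; apply: mulr_ge0 => //; nra.
apply: (le_trans (ler_sum _ (fun x _ => ler_sum _ (fun y _ => bnd x y)))).
under eq_bigr => x _ do rewrite -mulr_sumr.
rewrite -mulr_sumr.
have pick1 (x : V) (f : V -> R) (z : V) : \sum_y f y * (y == z)%:R = f z.
  rewrite (bigD1 z) //= eqxx mulr1 big1 ?addr0 // => y /negPf ->.
  by rewrite mulr0.
have sT : \sum_x F (T x) ^+ 2 = \sum_x F x ^+ 2 by rewrite [RHS](reindex_inj TI).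
have -> : \sum_x \sum_y (F x ^+ 2 + F y ^+ 2) * ((y == x)%:R + (y == T x)%:R + (x == T y)%:R)
   = 6 * \sum_x F x ^+ 2.
  have sp x : \sum_y (F x ^+ 2 + F y ^+ 2) * ((y == x)%:R + (y == T x)%:R + (x == T y)%:R) =
     2 * F x ^+ 2 + (F x ^+ 2 + F (T x) ^+ 2) + \sum_y (F x ^+ 2 + F y ^+ 2) * (x == T y)%:R.
    under eq_bigr => y _ do rewrite !mulrDr.
    rewrite !big_split /= (pick1 x (fun y => F x ^+ 2 + F y ^+ 2)) (pick1 x (fun y => F x ^+ 2 + F y ^+ 2)).
    by congr (_ + _ + _); ring.
  under eq_bigr => x _ do rewrite sp.
  rewrite big_split /= [X in _ + X]exchange_big /=.
  under [X in _ + X]eq_bigr => y _ do rewrite (pick1 y (fun x => F x ^+ 2 + F y ^+ 2)).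
  rewrite !big_split /= -mulr_sumr sT; ring.
by rewrite le_eqVlt; apply/orP; left; apply/eqP; field.
Qed.

End Ladder.

(** * Reflecting one half of a linear statistic *)

Section PairForm.
Variables (R : realFieldType) (V : finType) (e : rel V) (rho : R) (T : V -> V).
Local Notation Zd := (Zdef e rho).
Local Notation Z := (Zd (set0, set0)).

Definition edge_at x : {set V} := [set x; T x].

(** The unnormalised probability that two distinct edges of the family [edge_at]
    are both blue; see [sum_two_edges]. *)
Definition edge_corr (x y : V) : R :=
  if [disjoint edge_at x & edge_at y] then Zd (edge_at x :|: edge_at y, set0) else 0.

Definition corr_form (u v : V -> R) : R := \sum_x \sum_y u x * v y * edge_corr x y.

Lemma edge_corrC x y : edge_corr x y = edge_corr y x.
Proof. by rewrite /edge_corr disjoint_sym setUC. Qed.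

Hypothesis rho_ge0 : 0 <= rho.
Variables (t : V -> V) (H : {set V}) (iota : V -> V).
Hypotheses (e_sym : symmetric e) (Rf : reflection e t H).
Hypotheses (TI : injective T) (tT : forall x, t (T x) = T (t x))
  (TH : forall x, (T x \in H) = (x \in H)).
Hypotheses (iota_adj : forall x, e x (iota x)) (iotaT : forall x, iota (T x) = T (iota x))
  (iotaK : involutive iota) (iota_t : forall x, iota (t x) = t (iota x)).
Local Notation bd := (rim e t H).
Local Notation Wf := (half_weight e rho t H).
Local Notation psi := (Wf (set0, set0)).
Local Notation W := (fun x => Wf (edge_at x, set0)).
Let tK : involutive t := refl_inv Rf.
Let tH x : (t x \in H) = (x \notin H) := refl_half Rf x.

Lemma iota_cross x : x \in H -> iota x \notin H -> iota x = t x.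
Proof. by move=> xH ixH; apply: (refl_cross Rf). Qed.

Lemma edge_at_half x : x \in H -> edge_at x \subset H.
Proof. by move=> xH; apply/subsetP => y; rewrite !inE => /orP[]/eqP->; rewrite ?TH. Qed.

Lemma edge_at_rim x : x \in H -> iota x \notin H -> edge_at x \subset bd.
Proof.
move=> xH ixH; apply/subsetP => y; rewrite !inE => /orP[]/eqP->.
  by rewrite xH -iota_cross //= iota_adj.
by rewrite TH xH tT -iota_cross //= -iotaT iota_adj.
Qed.

Lemma edge_at_mirror x : edge_at (t x) = t @: edge_at x.
Proof. by rewrite /edge_at imsetU1 imset_set1 tT. Qed.

Lemma corr_across x y : x \in H -> y \in H ->
  edge_corr x (t y) = \sum_S W x S * W y S.
Proof.
move=> xH yH; rewrite /edge_corr ifT; last first.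
  rewrite -setI_eq0; apply/eqP/setP => z; rewrite in_setI in_set0.
  apply/negP => /andP[/(subsetP (edge_at_half xH)) zH].
  by rewrite edge_at_mirror (mem_timg Rf) => /(subsetP (edge_at_half yH)); rewrite tH zH.
rewrite -(Zdef_cut rho e_sym Rf) ?edge_at_half ?sub0set //.
by rewrite /mirror /= imset0 setU0 edge_at_mirror.
Qed.

Lemma corr_refl x y : x \in H -> y \in H -> edge_corr (t x) (t y) = edge_corr x y.
Proof.
move=> xH yH; rewrite /edge_corr.
have -> : [disjoint edge_at (t x) & edge_at (t y)] = [disjoint edge_at x & edge_at y].
  rewrite !edge_at_mirror -!setI_eq0 -imsetI ?imset_eq0 //.
  by move=> ? ? _ _; apply: (can_inj tK).
case: ifP => // _; have s : edge_at x :|: edge_at y \subset H by rewrite subUset !edge_at_half.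
have E1 := Zdef_cut rho e_sym Rf (A := (edge_at x :|: edge_at y, set0)) (B := (set0, set0))
  s (sub0set _) (sub0set _) (sub0set _).
have E2 := Zdef_cut rho e_sym Rf (B := (edge_at x :|: edge_at y, set0)) (A := (set0, set0))
  (sub0set _) (sub0set _) s (sub0set _).
move: E1 E2; rewrite /mirror /= !imset0 !setU0 set0U imsetU -!edge_at_mirror => -> ->.
by apply: eq_bigr => S _; rewrite mulrC.
Qed.

(** When the edge at [y] lies on the mirror, making it blue amounts to covering its
    endpoints by crossing dimers that are absent from the other side. *)
Lemma corr_raise x y : x \in H -> y \in H -> edge_at y \subset bd ->
  edge_corr x y = \sum_S W x S * raise psi (edge_at y) S.
Proof.
move=> xH yH ybd; rewrite /edge_corr; case: ifPn => [dxy|]; last first.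
  rewrite -setI_eq0 => /set0Pn[z]; rewrite in_setI => /andP[zx zy].
  rewrite big1 // => S _; rewrite /raise; case: ifP => [yS|]; last by rewrite mulr0.
  rewrite /half_weight /= ifF ?mul0r //; apply/negP => /and4P[_ _ dS _].
  by have := disjointFr dS (subsetP yS _ zy); rewrite zx.
have -> : Zd (edge_at x :|: edge_at y, set0) = Zd (mirror t (edge_at x :|: edge_at y, set0) (set0, set0)).
  by rewrite /mirror /= !imset0 !setU0.
have exyH : edge_at x :|: edge_at y \subset H by rewrite subUset !edge_at_half.
rewrite (Zdef_cut rho e_sym Rf) ?sub0set //.
rewrite (bigID (fun S : {set V} * {set V} => [disjoint S.1 & edge_at y])) /=.
rewrite [X in _ + X]big1 ?addr0; last first.
  move=> S dS; rewrite /half_weight /= ifF ?mul0r //.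
  apply/negP => /and4P[_ _]; rewrite -setI_eq0 setIUr setU_eq0 => /andP[_].
  by rewrite setI_eq0 (negPf dS).
rewrite [RHS](bigID (fun S : {set V} * {set V} => edge_at y \subset S.1)) /=.
rewrite [X in _ = _ + X]big1 ?addr0; last first.
  by move=> S yS; rewrite /raise (negPf yS) mulr0.
rewrite [RHS](reindex_onto (fun S : {set V} * {set V} => (S.1 :|: edge_at y, S.2))
   (fun S => (S.1 :\: edge_at y, S.2))) /=; last first.
  by move=> [S1 S2] /= yS; rewrite setUDK.
apply: eq_big => [[S1 S2]|[S1 S2] /= dS].
  rewrite subsetUr /= xpair_eqE eqxx andbT; apply/idP/eqP => [|<-]; first exact: setDUK.
  by rewrite disjoints_subset setDE subsetIr.
rewrite /raise /= subsetUr setDUK //; congr (_ * _).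
rewrite /half_weight /= subUset ybd andbT.
have -> : [disjoint S1 & edge_at x :|: edge_at y] = [disjoint S1 :|: edge_at y & edge_at x].
  rewrite -!setI_eq0 setIUr setIUl !setU_eq0 !setI_eq0 dS andbT.
  by rewrite (disjoint_sym (edge_at y)) dxy andbT.
have -> : edge_at x :|: edge_at y :|: S1 = edge_at x :|: (S1 :|: edge_at y) by rewrite (setUC S1) setUA.
by [].
Qed.

(** The symmetric extension of [u] from the half [H], cut off where the involution
    [iota] crosses the mirror; [inner2] extends from the other half. *)
Definition inner1 (u : V -> R) x : R :=
  let y := if x \in H then x else t x in if iota y \in H then u y else 0.
Definition inner2 (u : V -> R) x : R :=
  let y := if x \in H then x else t x in if iota y \in H then u (t y) else 0.

(** [v] and [w] are the two halves of [u], both seen from [H]. *)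
Lemma corr_form_split (u v w : V -> R) :
  (forall x, x \in H -> u x = v x) -> (forall x, x \in H -> u (t x) = w x) ->
  (forall x, x \notin H -> v x = 0) -> (forall x, x \notin H -> w x = 0) ->
  corr_form u u = \sum_x \sum_y ((v x * v y + w x * w y) * edge_corr x y
      + (v x * w y + w x * v y) * edge_corr x (t y)).
Proof.
move=> uv uw v0 w0.
have uE x : u x = v x + w (t x).
  have [xH|xH] := boolP (x \in H); first by rewrite uv // w0 ?addr0 // tH xH.
  by rewrite v0 // add0r -uw ?tK // tH.
have tI : injective t := can_inj tK.
rewrite /corr_form.
transitivity (\sum_x \sum_y (v x * v y * edge_corr x y) +
  (\sum_x \sum_y (v x * w (t y) * edge_corr x y)) +
  (\sum_x \sum_y (w (t x) * v y * edge_corr x y)) +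
  (\sum_x \sum_y (w (t x) * w (t y) * edge_corr x y))).
  rewrite -!big_split; apply: eq_bigr => x _ /=; rewrite -!big_split; apply: eq_bigr => y _ /=.
  by rewrite !uE; ring.
have -> : \sum_x \sum_y (v x * w (t y) * edge_corr x y) =
          \sum_x \sum_y (v x * w y * edge_corr x (t y)).
  apply: eq_bigr => x _; rewrite (reindex_inj tI); apply: eq_bigr => y _.
  by rewrite tK.
have -> : \sum_x \sum_y (w (t x) * v y * edge_corr x y) =
          \sum_x \sum_y (w x * v y * edge_corr x (t y)).
  rewrite (reindex_inj tI); apply: eq_bigr => x _; apply: eq_bigr => y _ /=.
  rewrite tK; have [yH|yH] := boolP (y \in H); last by rewrite v0 //; ring.
  have [xH|xH] := boolP (x \in H); last by rewrite w0 //; ring.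
  congr (_ * _); rewrite edge_corrC !corr_across //.
  by apply: eq_bigr => S _; rewrite mulrC.
have -> : \sum_x \sum_y (w (t x) * w (t y) * edge_corr x y) =
          \sum_x \sum_y (w x * w y * edge_corr x y).
  rewrite (reindex_inj tI); apply: eq_bigr => x _.
  rewrite (reindex_inj tI); apply: eq_bigr => y _ /=.
  rewrite !tK; have [yH|yH] := boolP (y \in H); last by rewrite (w0 y) //; ring.
  have [xH|xH] := boolP (x \in H); last by rewrite w0 //; ring.
  by rewrite corr_refl.
rewrite -!big_split; apply: eq_bigr => x _ /=; rewrite -!big_split; apply: eq_bigr => y _ /=.
ring.
Qed.

Local Notation cross_energy u := (\sum_(x in H | iota x \notin H) u x ^+ 2).

(** The cut-off terms occur in both halves, where [u] has opposite values. *)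
Lemma inner_energy (u : V -> R) : (forall x, u (iota x) = - u x) ->
  \sum_x inner1 u x ^+ 2 + \sum_x inner2 u x ^+ 2 =
  2 * (\sum_x u x ^+ 2 - 2 * cross_energy u).
Proof.
move=> anti; have tI : injective t := can_inj tK.
have split_sum (f : V -> R) : \sum_x f x = \sum_(x in H) (f x + f (t x)).
  rewrite big_split /= [X in _ + X](reindex_inj tI) /= (bigID (mem H)) /=; congr (_ + _).
  by apply: eq_big => [x|x _]; rewrite ?tK // tH.
rewrite !split_sum -big_split /= mulrBr mulr_sumr [X in _ = _ - X]mulrA mulr_sumr.
rewrite big_mkcondr /= -sumrB; apply: eq_bigr => x xH.
rewrite /inner1 /inner2 tH xH /= tK.
case: ifPn => [_|ixH] /=; first by ring.
have -> : u (t x) = - u x by rewrite -iota_cross.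
by ring.
Qed.

Lemma inner1_anti (u : V -> R) : (forall x, u (iota x) = - u x) ->
  forall x, inner1 u (iota x) = - inner1 u x.
Proof.
move=> anti x; rewrite /inner1.
have [xH|xH] := boolP (x \in H); have [ixH|ixH] := boolP (iota x \in H).
- by rewrite iotaK xH.
- by rewrite (iota_cross xH) // tK (negPf ixH) oppr0.
- by rewrite iotaK (negPf xH) ifN ?oppr0 // iota_t tH ixH.
by rewrite -iota_t iotaK tH xH iota_t tH ixH -iota_t anti.
Qed.

Lemma inner2_anti (u : V -> R) : (forall x, u (iota x) = - u x) ->
  forall x, inner2 u (iota x) = - inner2 u x.
Proof.
move=> anti x; have E v : inner2 u v = inner1 (fun z => u (t z)) v by [].
by rewrite !E inner1_anti // => z; rewrite -iota_t anti.
Qed.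

(** Reflecting either half of [u] onto the other one loses at most a multiple of the
    energy carried by the crossing edges. The defect of the parallelogram law is a
    complete square plus the gap between raising and lowering. *)
Lemma one_plane (u : V -> R) : (forall x, u (iota x) = - u x) ->
  corr_form u u <= 2^-1 * corr_form (inner1 u) (inner1 u)
     + 2^-1 * corr_form (inner2 u) (inner2 u) + 3 * cross_energy u * Z.
Proof.
move=> anti.
pose A x := if (x \in H) && (iota x \in H) then u x else 0.
pose A' x := if (x \in H) && (iota x \in H) then u (t x) else 0.
pose F x := if (x \in H) && (iota x \notin H) then u x else 0.
pose dl x := A x - A' x.
have A0 x : x \notin H -> A x = 0 by rewrite /A => /negPf ->.
have A'0 x : x \notin H -> A' x = 0 by rewrite /A' => /negPf ->.
have F0 x : x \notin H -> F x = 0 by rewrite /F => /negPf ->.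
have Q1 : corr_form (inner1 u) (inner1 u) = \sum_x \sum_y ((A x * A y + A x * A y) * edge_corr x y
      + (A x * A y + A x * A y) * edge_corr x (t y)).
  by apply: corr_form_split => // x xH; rewrite /inner1 /A ?tH ?tK xH.
have Q2 : corr_form (inner2 u) (inner2 u) = \sum_x \sum_y ((A' x * A' y + A' x * A' y) * edge_corr x y
      + (A' x * A' y + A' x * A' y) * edge_corr x (t y)).
  by apply: corr_form_split => // x xH; rewrite /inner2 /A' ?tH ?tK xH.
have Q0 : corr_form u u = \sum_x \sum_y
     (((A x + F x) * (A y + F y) + (A' x - F x) * (A' y - F y)) * edge_corr x y
      + ((A x + F x) * (A' y - F y) + (A' x - F x) * (A y + F y)) * edge_corr x (t y)).
  apply: (corr_form_split (v := fun x => A x + F x) (w := fun x => A' x - F x)) => x xH.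
  - by rewrite /A /F xH /=; case: (iota x \in H); rewrite ?addr0 ?add0r.
  - rewrite /A' /F xH /=; case: (boolP (iota x \in H)) => ixH; rewrite ?subr0 // sub0r.
    by rewrite -iota_cross.
  - by rewrite A0 // F0 // addr0.
  - by rewrite A'0 // F0 // subr0.
pose X S := \sum_x dl x * W x S.
pose P S := \sum_x F x * lower psi (edge_at x) S.
pose G S := \sum_x F x * raise psi (edge_at x) S.
have dl0 x : x \notin H -> dl x = 0 by move=> xH; rewrite /dl A0 // A'0 // subr0.
have PW S : P S = \sum_x F x * W x S.
  apply: eq_bigr => x _; rewrite /F; case: ifP => [/andP[xH ixH]|]; last by rewrite !mul0r.
  rewrite (half_weight_shift _ _ (A := (edge_at x, set0))) ?sub0set ?edge_at_rim // /lower /pdisj /psetU /= setU0.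
  by rewrite [[disjoint S.2 & set0]]disjoint_sym [X in _ && X]disjoints_subset sub0set andbT.
have bil (f g : V -> R) (a b : V -> {set V} * {set V} -> R) :
   \sum_S (\sum_x f x * a x S) * (\sum_y g y * b y S) =
   \sum_x \sum_y f x * g y * \sum_S a x S * b y S.
  under eq_bigr => S _ do rewrite mulr_suml.
  rewrite exchange_big /=; apply: eq_bigr => x _.
  under eq_bigr => S _ do rewrite mulr_sumr.
  rewrite exchange_big /=; apply: eq_bigr => y _.
  by rewrite mulr_sumr; apply: eq_bigr => S _; ring.
have across (f g : V -> R) : (forall x, x \notin H -> f x = 0) -> (forall x, x \notin H -> g x = 0) ->
   \sum_x \sum_y f x * g y * edge_corr x (t y) = \sum_S (\sum_x f x * W x S) * (\sum_y g y * W y S).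
  move=> f0 g0; rewrite bil; apply: eq_bigr => x _; apply: eq_bigr => y _.
  have [xH|xH] := boolP (x \in H); last by rewrite f0 // !mul0r.
  have [yH|yH] := boolP (y \in H); last by rewrite g0 // mulr0 !mul0r.
  by rewrite corr_across.
have same (f : V -> R) : (forall x, x \notin H -> f x = 0) ->
   \sum_x \sum_y f x * F y * edge_corr x y = \sum_S (\sum_x f x * W x S) * G S.
  move=> f0; rewrite bil; apply: eq_bigr => x _; apply: eq_bigr => y _.
  have [xH|xH] := boolP (x \in H); last by rewrite f0 // !mul0r.
  rewrite /F; case: ifP => [/andP[yH iyH]|]; last by rewrite mulr0 !mul0r.
  by rewrite corr_raise // edge_at_rim.
(* The terms linear in the inner part complete the square [(X + P - G) ^+ 2]. *)
have main : 2^-1 * corr_form (inner1 u) (inner1 u) + 2^-1 * corr_form (inner2 u) (inner2 u)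
    - corr_form u u = \sum_S (X S + P S - G S) ^+ 2 + \sum_S P S ^+ 2 - \sum_S G S ^+ 2.
  transitivity (\sum_x \sum_y dl x * dl y * edge_corr x (t y)
     + \sum_x \sum_y dl x * F y * edge_corr x (t y)
     + \sum_x \sum_y F x * dl y * edge_corr x (t y)
     + 2 * \sum_x \sum_y F x * F y * edge_corr x (t y)
     - \sum_x \sum_y dl x * F y * edge_corr x y
     - \sum_x \sum_y F x * dl y * edge_corr x y
     - 2 * \sum_x \sum_y F x * F y * edge_corr x y).
    rewrite Q1 Q2 Q0 !mulr_sumr -!(big_split, sumrB) /=; apply: eq_bigr => x _.
    rewrite !mulr_sumr -!(big_split, sumrB) /=; apply: eq_bigr => y _.
    by rewrite /dl; field.
  have -> : \sum_x \sum_y F x * dl y * edge_corr x y = \sum_x \sum_y dl x * F y * edge_corr x y.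
    rewrite exchange_big; apply: eq_bigr => x _; apply: eq_bigr => y _.
    by rewrite edge_corrC; ring.
  rewrite !across // !same // !mulr_sumr -!(big_split, sumrB) /=; apply: eq_bigr => S _.
  by rewrite -!PW -!/(X S); ring.
have rl := raise_lower_bound (half_weight_ge0 e rho_ge0 t H (set0, set0)) F TI.
have FE : \sum_x F x ^+ 2 = cross_energy u.
  rewrite [RHS]big_mkcond /=; apply: eq_bigr => x _; rewrite /F; case: ifP => // _.
  by rewrite expr0n.
have sq : 0 <= \sum_S (X S + P S - G S) ^+ 2 by apply: sumr_ge0 => S _; apply: sqr_ge0.
move: rl; rewrite FE -(Z_psi rho e_sym Rf) => rl.
have {}rl : \sum_S G S ^+ 2 <= \sum_S P S ^+ 2 + 3 * cross_energy u * Z by exact: rl.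
move: main sq rl; lra.
Qed.

End PairForm.

(** * The variance of a linear statistic of the dimers *)

Section AddRemove.
Variables (V : finType) (e : rel V).
Implicit Types (A f g : {set V}) (d : {set {set V}}).

Lemma dimers_del A d f : d \in dimers e A -> f \in d -> d :\ f \in dimers e (f :|: A).
Proof.
move=> dA fd; apply: in_dimers.
- move=> g; rewrite !inE => /andP[_ gd]; have [a [b [eab -> _ _]]] := dimer_edge dA gd.
  by apply/edgesP; exists a, b.
- move=> g x; rewrite !inE => /andP[gf gd] xg; rewrite negb_or; apply/andP; split.
    by apply: contraNN gf => xf; apply/eqP; apply: dimer_uniq dA gd fd xg xf.
  have [a [b [_ eg aA bA]]] := dimer_edge dA gd.
  by move: xg; rewrite eg !inE => /orP[]/eqP->.
- move=> x; rewrite !inE negb_or => /andP[xf xA].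
  have [g gd xg] := dimer_ex dA xA; exists g; rewrite !inE gd andbT; split=> //.
    by apply: contraNneq xf => <-.
  by move=> h; rewrite !inE => /andP[_ hd] xh; apply: dimer_uniq dA hd gd xh xg.
Qed.

Lemma dimers_add A d f : d \in dimers e (f :|: A) -> f \in edges e -> [disjoint f & A] ->
  f |: d \in dimers e A /\ f \notin d.
Proof.
move=> dA fe fA.
have dP g x : g \in d -> x \in g -> (x \notin f) && (x \notin A).
  move=> gd xg; have [a [b [_ eg aA bA]]] := dimer_edge dA gd.
  by rewrite -negb_or -in_setU; move: xg; rewrite eg in_set2 => /orP[]/eqP->.
split; last first.
  apply/negP => fd; have [a [b [_ ef _ _]]] := dimer_edge dA fd.
  by have := dP f a fd; rewrite ef !inE eqxx => /(_ isT).
apply: in_dimers.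
- move=> g; rewrite !inE => /orP[/eqP->//|gd].
  by have [a [b [eab -> _ _]]] := dimer_edge dA gd; apply/edgesP; exists a, b.
- move=> g x; rewrite !inE => /orP[/eqP-> xf|gd xg]; first by rewrite (disjointFr fA).
  by case/andP: (dP _ _ gd xg).
- move=> x xA; have [xf|xf] := boolP (x \in f).
    exists f; rewrite !inE eqxx; split=> // g; rewrite !inE => /orP[/eqP->//|gd] xg.
    by have := dP _ _ gd xg; rewrite xf.
  have xfA : x \notin f :|: A by rewrite in_setU negb_or xf.
  have [g gd xg] := dimer_ex dA xfA; exists g; rewrite !inE gd orbT; split=> // h.
  rewrite !inE => /orP[/eqP->|hd] xh; first by rewrite xh in xf.
  exact: dimer_uniq dA hd gd xh xg.
Qed.

End AddRemove.

Lemma in_defect (V : finType) (e : rel V) (A : {set V} * {set V}) M b r :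
  ((M, b, r) \in defect_configs e A) =
  [&& [disjoint M & A.1 :|: A.2], b \in dimers e (A.1 :|: M) & r \in dimers e (A.2 :|: M)].
Proof. by rewrite inE. Qed.

Lemma disjoint0r (V : finType) (M : {set V}) : [disjoint M & set0].
Proof. by rewrite -setI_eq0 setI0. Qed.

Section Variance.
Variables (R : realFieldType) (V : finType) (e : rel V) (rho : R) (T : V -> V).
Hypotheses (rho_ge0 : 0 <= rho) (e_sym : symmetric e).
Hypotheses (TI : injective T) (T_adj : forall x, e x (T x)) (TT : forall x, T (T x) != x).
Local Notation Zd := (Zdef e rho).
Local Notation Z := (Zd (set0, set0)).
Local Notation ed := (edge_at T).
Local Notation corr := (edge_corr e rho T).
Local Notation form := (corr_form e rho T).
Local Notation Om := (defect_configs e (set0, set0)).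
Local Notation wt w := (rho ^+ #|monomers w|).

Lemma edge_at_edge x : ed x \in edges e.
Proof. by apply/edgesP; exists x, (T x). Qed.

Lemma edge_at_inj : injective ed.
Proof.
move=> x y E; have : x \in ed y by rewrite -E !inE eqxx.
rewrite !inE => /orP[/eqP//|/eqP xTy].
have : y \in ed x by rewrite E !inE eqxx.
rewrite !inE => /orP[/eqP//|/eqP yTx].
by have := TT y; rewrite -xTy -yTx eqxx.
Qed.

Lemma sum_two_edges x y : x != y ->
  \sum_(w in Om | (ed x \in blue w) && (ed y \in blue w)) wt w = corr x y.
Proof.
move=> xy; rewrite /edge_corr; case: ifPn => [dxy|ndxy]; last first.
  rewrite big1 // => w /andP[]; rewrite inE => /and3P[_ bD _] /andP[xb yb].
  move: ndxy; rewrite -setI_eq0 => /set0Pn[z]; rewrite in_setI => /andP[zx zy].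
  by have /edge_at_inj/eqP := dimer_uniq bD xb yb zx zy; rewrite (negPf xy).
rewrite (reindex_onto (fun w : config V => (monomers w, ed x |: (ed y |: blue w), red w))
   (fun w => (monomers w, (blue w :\ ed x) :\ ed y, red w))) /=; last first.
  move=> [[M b] r] /andP[_ /andP[/= xb yb]]; congr (_, _, _).
  apply/setP => f; rewrite /blue /= in xb yb *; rewrite !inE.
  case: eqVneq => [->|_] /=; first by rewrite xb.
  by case: eqVneq => [->|_] /=; rewrite ?yb.
apply: eq_bigl => -[[M b] r].
rewrite /blue /monomers /red /= !in_defect /= !set0U !setU0 disjoint0r.
rewrite setU11 setU1r ?setU11 //= !xpair_eqE !eqxx !andbT /=.
have EU : ed y :|: (ed x :|: M) = ed x :|: ed y :|: M by rewrite setUA (setUC (ed y)).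
apply/andP/and3P.
  move=> [/andP[bD rD] /eqP <-]; split=> //.
    have dM (f : {set V}) : f \in ed x |: (ed y |: b) -> [disjoint f & M].
      move=> fb; have [p [q [_ -> pM qM]]] := dimer_edge bD fb.
      by rewrite disjoints_subset; apply/subsetP => z; rewrite !inE => /orP[]/eqP->.
    rewrite disjoint_sym -setI_eq0 setIUl setU_eq0 !setI_eq0.
    by rewrite !dM // !inE eqxx ?orbT.
  have b1 : ed x \in ed x |: (ed y |: b) by rewrite !inE eqxx.
  have b2 : ed y \in (ed x |: (ed y |: b)) :\ ed x.
    by rewrite !inE eqxx orbT (inj_eq edge_at_inj) eq_sym xy.
  by have := dimers_del (dimers_del bD b1) b2; rewrite EU.
move=> [dM bD rD].
have [dxM dyM] : [disjoint ed x & M] /\ [disjoint ed y & M].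
  by move: dM; rewrite disjoint_sym -!setI_eq0 setIUl setU_eq0 => /andP[].
have bD' : b \in dimers e (ed y :|: (ed x :|: M)) by rewrite EU.
have [b1 nb1] : ed y |: b \in dimers e (ed x :|: M) /\ ed y \notin b.
  apply: dimers_add => //; first exact: edge_at_edge.
  rewrite -setI_eq0 setIUr setU_eq0 !setI_eq0 dyM andbT.
  by rewrite disjoint_sym.
have [b2 nb2] := dimers_add b1 (edge_at_edge x) dxM.
split; first by rewrite b2 rD.
by rewrite setU1K // setU1K.
Qed.

Lemma sub_sum_le (P : pred (config V)) : 0 <= \sum_(w in Om | P w) wt w <= Z.
Proof.
apply/andP; split; first by apply: sumr_ge0 => w _; apply: exprn_ge0.
rewrite /Zdef [X in _ <= X](bigID P) /= lerDl.
by apply: sumr_ge0 => w _; apply: exprn_ge0.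
Qed.

Lemma corr_diag x : corr x x = 0.
Proof. by rewrite /edge_corr ifF // -setI_eq0 setIid; apply/negbTE/set0Pn; exists x; rewrite !inE eqxx. Qed.

Lemma corr_bound x y : 0 <= corr x y <= Z.
Proof.
have [->|xy] := eqVneq x y; first by rewrite corr_diag lexx Zdef_ge0.
by rewrite -sum_two_edges // sub_sum_le.
Qed.

Lemma form_crude u : form u u <= (#|V|)%:R * (\sum_x u x ^+ 2) * Z.
Proof.
have Z0 : 0 <= Z by apply: Zdef_ge0.
apply: (@le_trans _ _ (\sum_x \sum_y (2^-1 * Z * u x ^+ 2 + 2^-1 * Z * u y ^+ 2))).
  apply: ler_sum => x _; apply: ler_sum => y _.
  have /andP[c0 cZ] := corr_bound x y.
  apply: (@le_trans _ _ (2^-1 * (u x ^+ 2 + u y ^+ 2) * corr x y)).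
    by apply: ler_wpM2r => //; have := sqr_ge0 (u x - u y); nra.
  have -> : 2^-1 * Z * u x ^+ 2 + 2^-1 * Z * u y ^+ 2 = 2^-1 * (u x ^+ 2 + u y ^+ 2) * Z by ring.
  by apply: ler_wpM2l => //; have := sqr_ge0 (u x); have := sqr_ge0 (u y); nra.
under eq_bigr => x _ do rewrite big_split /= sumr_const -mulr_sumr.
rewrite big_split /= sumr_const sumrMnl -!mulr_sumr -mulr_natr.
rewrite le_eqVlt; apply/orP; left; apply/eqP; by field.
Qed.

Variables (J : finType) (tt : J -> V -> V) (HH : J -> {set V}) (iota : V -> V).
Hypotheses (Rf : forall j, reflection e (tt j) (HH j)).
Hypotheses (tT : forall j x, tt j (T x) = T (tt j x))
  (TH : forall j x, (T x \in HH j) = (x \in HH j)).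
Hypotheses (iota_adj : forall x, e x (iota x)) (iotaT : forall x, iota (T x) = T (iota x))
  (iotaK : involutive iota) (iota_t : forall j x, iota (tt j x) = tt j (iota x)).
Hypothesis planes : forall x, exists j, iota x = tt j x.
Local Notation cross_energy u j := (\sum_(x in HH j | iota x \notin HH j) u x ^+ 2).
Local Notation nJ := ((#|J|)%:R : R).

(** Each pair exchanged by [iota] is exchanged by some mirror, so the energies cut
    off by the individual mirrors add up to at least half of the total. *)
Lemma cross_energy_sum (u : V -> R) : (forall x, u (iota x) = - u x) ->
  \sum_x u x ^+ 2 <= 2 * \sum_j cross_energy u j.
Proof.
move=> anti; have iI : injective iota := can_inj iotaK.
have dbl j : 2 * cross_energy u j = \sum_(x | (x \in HH j) (+) (iota x \in HH j)) u x ^+ 2.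
  rewrite [RHS](bigID (mem (HH j))) /=.
  have -> : \sum_(i | ((i \in HH j) (+) (iota i \in HH j)) && (i \notin HH j)) u i ^+ 2
          = cross_energy u j.
    rewrite (reindex_inj iI) /=; apply: eq_big => [x|x _]; last by rewrite anti sqrrN.
    by rewrite iotaK; case: (x \in _); case: (iota x \in _).
  have -> : \sum_(i | ((i \in HH j) (+) (iota i \in HH j)) && (i \in HH j)) u i ^+ 2
          = cross_energy u j.
    by apply: eq_bigl => x; case: (x \in _); case: (iota x \in _).
  by ring.
rewrite mulr_sumr; under [X in _ <= X]eq_bigr => j _ do rewrite dbl big_mkcond /=.
rewrite [X in _ <= X]exchange_big /=; apply: ler_sum => x _.
have [j ij] := planes x; rewrite (bigD1 j) //= ij (refl_half (Rf j)).
have -> : (x \in HH j) (+) (x \notin HH j) by case: (x \in HH j).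
by rewrite lerDl; apply: sumr_ge0 => k _; case: ifP => // _; apply: sqr_ge0.
Qed.

(** Average [one_plane] over the mirrors. The energy kept is bounded with the
    constant assumed, the energy cut off with the better constant 3/2. *)
Lemma form_step (lam : R) : 0 <= lam ->
  (forall u, (forall x, u (iota x) = - u x) -> form u u <= (3/2 + lam) * (\sum_x u x ^+ 2) * Z) ->
  (forall u, (forall x, u (iota x) = - u x) ->
     nJ * form u u <= (nJ * (3/2 + lam) - lam) * (\sum_x u x ^+ 2) * Z).
Proof.
move=> lam0 IH u anti; have Z0 : 0 <= Z by apply: Zdef_ge0.
have one j : form u u <= (3/2 + lam) * (\sum_x u x ^+ 2) * Z - 2 * lam * Z * cross_energy u j.
  have P := one_plane rho_ge0 e_sym (Rf j) TI (tT j) (TH j) iota_adj iotaT anti.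
  have I1 := IH _ (inner1_anti (Rf j) iota_adj iotaK (iota_t j) anti).
  have I2 := IH _ (inner2_anti (Rf j) iota_adj iotaK (iota_t j) anti).
  have E := inner_energy (Rf j) iota_adj anti.
  move: P I1 I2 E.
  set q1 := form (inner1 _ _ _ _) _; set q2 := form (inner2 _ _ _ _) _.
  set n1 := \sum_x inner1 _ _ _ _ _ ^+ 2; set n2 := \sum_x inner2 _ _ _ _ _ ^+ 2.
  set n := \sum_x u x ^+ 2; set f := cross_energy u j => P I1 I2 E.
  have E2 : (3/2 + lam) * n1 * Z + (3/2 + lam) * n2 * Z =
     (3/2 + lam) * (2 * (n - 2 * f)) * Z by rewrite -E; ring.
  have E3 : (3/2 + lam) * n * Z - 2 * lam * Z * f =
      2^-1 * ((3/2 + lam) * (2 * (n - 2 * f)) * Z) + 3 * f * Z by field.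
  by rewrite E3; lra.
have : \sum_(j : J) form u u <=
    \sum_(j : J) ((3/2 + lam) * (\sum_x u x ^+ 2) * Z - 2 * lam * Z * cross_energy u j).
  by apply: ler_sum => j _; apply: one.
rewrite sumrB !sumr_const -mulr_sumr -(mulr_natl (form u u)) -(mulr_natl (_ * _ * Z) #|J|) => S.
have C := cross_energy_sum anti.
have C2 : lam * Z * (\sum_x u x ^+ 2) <= lam * Z * (2 * \sum_j cross_energy u j).
  by apply: ler_wpM2l => //; apply: mulr_ge0.
by lra.
Qed.

(** Each use of [form_step] multiplies the excess over 3/2 by [1 - 1 / #|J|]; starting
    from the excess [#|V|] of [form_crude] it is below 1 after [#|J| * #|V|] steps,
    by the Bernoulli inequality [bern]. *)
Lemma form_bound (u : V -> R) : (forall x, u (iota x) = - u x) ->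
  form u u <= 5/2 * (\sum_x u x ^+ 2) * Z.
Proof.
have Z0 : 0 <= Z by apply: Zdef_ge0.
have [V0|V0] := posnP #|V|.
  move=> _; apply: (le_trans (form_crude u)); rewrite V0.
  apply: ler_wpM2r => //; apply: ler_wpM2r; first by apply: sumr_ge0 => x _; apply: sqr_ge0.
  lra.
have [x0 _] : exists x0 : V, true by case/card_gt0P: V0 => x _; exists x.
have J1 : 1 <= nJ.
  have [j _] := planes x0; rewrite ler1n; apply/card_gt0P; by exists j.
pose q : R := 1 - nJ^-1.
have q0 : 0 <= q by rewrite subr_ge0 invf_le1 //; lra.
have nJ0 : nJ != 0 by apply/eqP => E; move: J1; rewrite E; lra.
have iter n (v : V -> R) : (forall x, v (iota x) = - v x) ->
   form v v <= (3/2 + (#|V|)%:R * q ^+ n) * (\sum_x v x ^+ 2) * Z.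
  elim: n v => [|n IH] v anti.
    apply: (le_trans (form_crude v)); rewrite expr0 mulr1; apply: ler_wpM2r => //.
    apply: ler_wpM2r; first by apply: sumr_ge0 => x _; apply: sqr_ge0.
    lra.
  have l0 : 0 <= (#|V|)%:R * q ^+ n by rewrite mulr_ge0 ?ler0n ?exprn_ge0.
  have S := form_step l0 IH anti.
  rewrite -(@ler_pM2l _ nJ); last by lra.
  apply: (le_trans S); rewrite le_eqVlt; apply/orP; left; apply/eqP.
  rewrite exprSr /q; field; exact: nJ0.
move=> anti; have := iter (#|J| * #|V|)%N u anti => B; apply: (le_trans B).
apply: ler_wpM2r => //; apply: ler_wpM2r; first by apply: sumr_ge0 => x _; apply: sqr_ge0.
have bern n : q ^+ n * (1 + n%:R / nJ) <= 1.
  elim: n => [|n IH]; first by rewrite expr0 mul1r mul0r addr0.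
  apply: le_trans IH; rewrite exprSr -mulrA; apply: ler_wpM2l; first exact: exprn_ge0.
  have -> : n.+1%:R = n%:R + 1 :> R by rewrite -addn1 natrD.
  have i0 : 0 <= nJ^-1 by rewrite invr_ge0 ler0n.
  have n0 : 0 <= n%:R :> R by apply: ler0n.
  by rewrite /q; nra.
have := bern (#|J| * #|V|)%N; rewrite natrM [nJ * _]mulrC mulfK //.
have := exprn_ge0 (#|J| * #|V|) q0; set Q := q ^+ _ => Q0.
by have := ler0n R #|V|; nra.
Qed.

(** The diagonal terms, absent from [corr_form], cost one more unit of energy. *)
Lemma blue_variance (u : V -> R) : (forall x, u (iota x) = - u x) ->
  \sum_(w in Om) (\sum_x u x * (ed x \in blue w)%:R) ^+ 2 * wt w <=
  7/2 * (\sum_x u x ^+ 2) * Z.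
Proof.
move=> anti.
have -> : \sum_(w in Om) (\sum_x u x * (ed x \in blue w)%:R) ^+ 2 * wt w =
   form u u + \sum_x u x ^+ 2 * \sum_(w in Om | ed x \in blue w) wt w.
  have E w : (\sum_x u x * (ed x \in blue w)%:R) ^+ 2 * wt w =
     \sum_x \sum_y u x * u y * (if (ed x \in blue w) && (ed y \in blue w) then wt w else 0).
    rewrite expr2 -mulrA mulr_suml; apply: eq_bigr => x _.
    rewrite mulr_suml mulr_sumr; apply: eq_bigr => y _.
    move: (rho ^+ _) => c.
    by case: (ed x \in blue w); case: (ed y \in blue w) => /=; ring.
  under eq_bigr => w _ do rewrite E.
  rewrite exchange_big /=.
  under eq_bigr => x _ do rewrite exchange_big /=.
  rewrite /corr_form -big_split /=; apply: eq_bigr => x _.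
  rewrite (bigD1 x) //= [in RHS](bigD1 x) //= corr_diag mulr0 add0r addrC; congr (_ + _).
    apply: eq_bigr => y yx; rewrite -mulr_sumr -big_mkcondr sum_two_edges //.
    by rewrite eq_sym.
  rewrite -mulr_sumr -big_mkcondr expr2; congr (_ * _).
  by apply: eq_bigl => w; rewrite andbb.
have B := form_bound anti.
have D : \sum_x u x ^+ 2 * \sum_(w in Om | ed x \in blue w) wt w <= (\sum_x u x ^+ 2) * Z.
  rewrite mulr_suml; apply: ler_sum => x _; apply: ler_wpM2l; first exact: sqr_ge0.
  by case/andP: (sub_sum_le (fun w => ed x \in blue w)).
lra.
Qed.

Lemma red_variance (u : V -> R) : (forall x, u (iota x) = - u x) ->
  \sum_(w in Om) (\sum_x u x * (ed x \in red w)%:R) ^+ 2 * wt w <=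
  7/2 * (\sum_x u x ^+ 2) * Z.
Proof.
move=> anti; apply: le_trans (blue_variance anti).
rewrite (reindex (fun w : config V => (w.1.1, w.2, w.1.2))) /=; last first.
  by exists (fun w : config V => (w.1.1, w.2, w.1.2)) => [[[M b] r]|[[M b] r]].
rewrite le_eqVlt; apply/orP; left; apply/eqP.
apply: eq_bigl => -[[M b] r]; rewrite !in_defect /=.
by congr (_ && _); rewrite andbC.
Qed.

End Variance.

(** * Arithmetic on a cycle of even length *)

Section Cyclic.
Variable l : nat.
Local Notation L := l.+2.
Implicit Types i j : 'I_L.

Lemma val_add i j : (i + j)%R = (if (i + j < L)%N then i + j else i + j - L)%N :> nat.
Proof.
have Hi := ltn_ord i; have Hj := ltn_ord j.
rewrite /= ; case: ifP => H; first by rewrite modn_small.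
rewrite -{1}[(i + j)%N](@subnK L) ?modnDr ?modn_small //; lia.
Qed.

Lemma val_opp i : (- i)%R = (if i == 0%N :> nat then 0 else L - i)%N :> nat.
Proof.
have Hi := ltn_ord i; rewrite /=; case: eqP => [->|ni]; first by rewrite subn0 modnn.
by rewrite modn_small //; lia.
Qed.

Lemma val_one : (1 : 'I_L)%R = 1%N :> nat. Proof. by []. Qed.

Definition valE := (val_add, val_opp, val_one).

Lemma cyc_stepE i j : cyc_step i j = (j == i + 1) || (i == j + 1).
Proof.
have key (i' j' : 'I_L) : (j' == i'.+1 %[mod L])%N = (j' == i' + 1).
  rewrite -val_eqE /= [X in _ = (_ == X)](_ : _ = (i'.+1 %% L)%N); last by rewrite [(1 %% _)%N]modn_small // addn1.
  by rewrite (modn_small (ltn_ord j')).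
by rewrite /cyc_step !key.
Qed.

(** Counted from [o], the positions 0 and 1, 2 and 3, and so on are exchanged. It
    commutes with every [flip], and each of its pairs is also a pair of some
    [flip], so the lines it matches can be reflected onto each other. *)
Definition pairing (o i : 'I_L) : 'I_L := if odd (i - o)%R then i - 1 else i + 1.

Definition flip (p i : 'I_L) : 'I_L := p + p + 1 - i.

Lemma flipK p : involutive (flip p).
Proof. by move=> i; rewrite /flip opprB addrC subrK. Qed.

Hypothesis evenL : ~~ odd l.

Lemma odd_shift i : odd (i + 1)%R = ~~ odd i.
Proof.
have Hi := ltn_ord i; rewrite valE val_one; case: ifP => H; first by rewrite addn1.
have -> : (i = l.+1 :> nat) by lia.
by rewrite addn1 subnn /= negbK (negPf evenL).
Qed.

Lemma odd_unshift i : odd (i - 1)%R = ~~ odd i.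
Proof. by rewrite -[X in ~~ odd X](_ : (i - 1 + 1)%R = i :> nat) ?odd_shift ?negbK // subrK. Qed.

Lemma odd_opp i : odd (- i)%R = odd i.
Proof.
have Hi := ltn_ord i; rewrite valE; case: eqP => [->//|_].
by rewrite oddB 1?ltnW //= negbK (negPf evenL).
Qed.

Lemma odd_addI i j : odd (i + j)%R = odd i (+) odd j.
Proof.
have Hi := ltn_ord i; have Hj := ltn_ord j; rewrite valE; case: ifP => H; first by rewrite oddD.
rewrite oddB; last by lia.
by rewrite oddD /= negbK (negPf evenL) addbF.
Qed.

Lemma pairingK o : involutive (pairing o).
Proof.
move=> i; rewrite /pairing; case: (boolP (odd (i - o)%R)) => H.
  have -> : i - 1 - o = (i - o) - 1 by ring.
  by rewrite odd_unshift H /= subrK.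
have -> : i + 1 - o = (i - o) + 1 by ring.
by rewrite odd_shift H /= addrK.
Qed.

Lemma pairing_flip o p i : pairing o (flip p i) = flip p (pairing o i).
Proof.
rewrite /pairing; have -> : odd (flip p i - o)%R = ~~ odd (i - o)%R.
  have -> : flip p i - o = (p + p) + 1 + - (i - o) + - (o + o) by rewrite /flip; ring.
  by rewrite !(odd_opp, odd_addI) val_one /=; case: (odd p); case: (odd o); case: (odd i).
by rewrite /flip; case: (odd _) => /=; ring.
Qed.

Lemma pairing_is_flip o i : exists p, pairing o i = flip p i.
Proof.
rewrite /pairing /flip; case: ifP => _; [exists (i - 1)|exists i]; ring.
Qed.

Lemma pairing_half o i : ((pairing o i - o)%R)./2 = ((i - o)%R)./2 :> nat.
Proof.
rewrite /pairing; case: ifP => H.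
  have -> : i - 1 - o = (i - o) - 1 by ring.
  move: H; move: (i - o) => j H; have Hj := ltn_ord j.
  have j0 : (0 < j)%N by case: (nat_of_ord j) H.
  have : (j - 1)%R = (j - 1)%N :> nat.
    by rewrite !valE /=; case: ifP => ?; lia.
  by move=> ->; lia.
have -> : i + 1 - o = (i - o) + 1 by ring.
move: H; move: (i - o) => j H; have Hj := ltn_ord j.
have : (j + 1)%R = (j + 1)%N :> nat.
  by rewrite !valE; case: ifP => ?; [by []|lia].
by move=> ->; lia.
Qed.

End Cyclic.

(** * Reflections of the slab torus *)

Lemma neq_negb (b b' : bool) : b' != b -> b' = ~~ b.
Proof. by case: b b' => -[]. Qed.

Section TorusGeometry.
Variables (l K : nat).
Local Notation L := l.+2.
Local Notation V := (torus L K).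
Local Notation e := (@torus_adj L K).
Hypotheses (l_gt0 : (0 < l)%N) (evenL : ~~ odd l) (hK : side K).
Implicit Types (x y : V) (b : bool) (g h : 'I_L -> 'I_L).

(** The two long coordinates are indexed by a boolean so that each construction is
    made once for both; [true] is the first one. *)
Definition co b (x : V) : 'I_L := if b then x.1.1 else x.1.2.
Definition app b (g : 'I_L -> 'I_L) (x : V) : V :=
  if b then (g x.1.1, x.1.2, x.2) else (x.1.1, g x.1.2, x.2).
Definition translate b : V -> V := app b (fun i => i + 1).
Definition reflect_at b p : V -> V := app b (flip p).
(** The half torus below the mirror between the lines [p] and [p + 1]. A second
    mirror bounds it on the opposite side of the torus. *)
Definition half_space b (p : 'I_L) : {set V} := [set x | ((p - co b x)%R < L./2)%N].
Definition partner b o : V -> V := app b (pairing o).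
Definition par x : bool := odd x.1.1 (+) odd x.1.2 (+) odd x.2.

Lemma co_app b g x : co b (app b g x) = g (co b x). Proof. by case: b. Qed.
Lemma co_appN b g x : co (~~ b) (app b g x) = co (~~ b) x. Proof. by case: b. Qed.
Lemma co_appNN b g x : co b (app (~~ b) g x) = co b x. Proof. by case: b. Qed.
Lemma appC b g h x : app b g (app (~~ b) h x) = app (~~ b) h (app b g x). Proof. by case: b. Qed.
Lemma appM b g h x : app b g (app b h x) = app b (g \o h) x. Proof. by case: b. Qed.
Lemma app_eq b g h x : g (co b x) = h (co b x) -> app b g x = app b h x.
Proof. by case: b; rewrite /app /co => ->. Qed.
Lemma app_id b x : app b id x = x. Proof. by case: b x => -[[]]. Qed.
Lemma appK b g h : cancel g h -> cancel (app b g) (app b h).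
Proof. by move=> gK x; rewrite appM -[RHS](app_id b); apply: app_eq; apply: gK. Qed.
Lemma par_app b g x : odd (g (co b x)) = ~~ odd (co b x) -> par (app b g x) = ~~ par x.
Proof. by case: b; rewrite /par /app /co /= => ->; do 3 case: (odd _). Qed.

Definition third x y := [&& x.1 == y.1, x.2 != y.2 & cyc_step x.2 y.2].

Lemma add1_neq (i : 'I_L) : i + 1 != i.
Proof. by rewrite -subr_eq0 addrAC subrr add0r. Qed.

Lemma adjP x y : e x y -> [\/ exists b, y = translate b x, exists b, x = translate b y | third x y].
Proof.
case: x y => [[x1 x2] x3] [[y1 y2] y3]; rewrite /torus_adj /= => /andP[ne].
rewrite !cyc_stepE => /or3P[/and3P[/orP[]/eqP E /eqP E2 /eqP E3]|/and3P[/eqP E1 /orP[]/eqP E /eqP E3]|/and3P[/eqP E1 /eqP E2 c]].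
- by constructor 1; exists true; rewrite /translate /app /= E E2 E3.
- by constructor 2; exists true; rewrite /translate /app /= E E2 E3.
- by constructor 1; exists false; rewrite /translate /app /= E E1 E3.
- by constructor 2; exists false; rewrite /translate /app /= E E1 E3.
- constructor 3; rewrite /third /= E1 E2 eqxx /= c andbT.
  by apply: contraNneq ne => ->; rewrite E1 E2.
Qed.

Lemma adj_translate b x : e x (translate b x).
Proof.
case: b x => -[[x1 x2] x3]; rewrite /torus_adj /translate /app /= !eqxx /= !cyc_stepE eqxx /= ?orbT andbT.
  by apply/eqP => -[E]; have := add1_neq x1; rewrite -E eqxx.
by apply/eqP => -[E]; have := add1_neq x2; rewrite -E eqxx.
Qed.

Lemma adj_third x y : third x y -> e x y.
Proof.
case: x y => [[x1 x2] x3] [[y1 y2] y3]; rewrite /third /torus_adj /= xpair_eqE.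
move=> /and3P[/andP[/eqP-> /eqP->] ne c]; rewrite !eqxx c /= !orbT andbT.
by apply: contraNneq ne => -[->].
Qed.

Lemma par_adj x y : e x y -> par y = ~~ par x.
Proof.
case/adjP => [[b ->]|[b ->]|].
- by apply: par_app; rewrite odd_shift.
- by rewrite par_app ?negbK // odd_shift.
case: x y => [[x1 x2] x3] [[y1 y2] y3]; rewrite /third /= xpair_eqE /par /=.
move=> /and3P[/andP[/eqP-> /eqP->] ne c].
have {c} : odd y3 = ~~ odd x3.
  case/orP: hK => [/eqP K1|/andP[_ Kev]].
    case/negP: ne; rewrite -val_eqE /=; apply/eqP.
    by have := ltn_ord x3; have := ltn_ord y3; lia.
  have Ko : odd K = false by apply: negbTE.
  case/orP: c => /eqP; rewrite [X in X = _]modn_small ?ltn_ord // => /(congr1 odd);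
    by rewrite odd_mod //= => ->; rewrite ?negbK.
by move=> ->; do 3 case: (odd _).
Qed.

Lemma translateI b : injective (translate b).
Proof.
have gK : cancel (fun i : 'I_L => i + 1) (fun i => i - 1) by move=> i; rewrite addrK.
exact: can_inj (appK b gK).
Qed.

Lemma translate2 b x : translate b (translate b x) != x.
Proof.
apply/eqP => /(congr1 (co b)); rewrite !co_app -addrA.
move/eqP; rewrite -subr_eq0 addrAC subrr add0r -val_eqE /= => /eqP.
by rewrite !modn_small //=; lia.
Qed.

Lemma adj_reflect b p x y : e (reflect_at b p x) (reflect_at b p y) = e x y.
Proof.
have imp u v : e u v -> e (reflect_at b p u) (reflect_at b p v).
  have sh b' w : e (reflect_at b p w) (reflect_at b p (translate b' w)).
    have [->|] := eqVneq b' b.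
      have -> : reflect_at b p w = translate b (reflect_at b p (translate b w)).
        by rewrite /reflect_at /translate !appM; apply: app_eq; rewrite /= /flip; ring.
      by rewrite torus_adj_sym adj_translate.
    move/neq_negb ->; rewrite /reflect_at /translate appC; exact: adj_translate.
  case/adjP => [[b' ->]|[b' ->]|t]; [exact: sh|rewrite torus_adj_sym; exact: sh|].
  apply: adj_third; move: t; clear sh; case: b u v => -[[u1 u2] u3] [[v1 v2] v3]; rewrite /third /reflect_at /app /= !xpair_eqE;
  by move=> /and3P[/andP[/eqP-> /eqP->] -> ->]; rewrite !eqxx.
apply/idP/idP; last exact: imp.
have K' : involutive (reflect_at b p) by apply: appK; apply: flipK.
by move=> /imp; rewrite !K'.
Qed.

Lemma reflection_torus b p : reflection e (reflect_at b p) (half_space b p).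
Proof.
have Lh : (L = L./2 + L./2)%N by lia.
split.
- by apply: appK; apply: flipK.
- by move=> x y; apply: adj_reflect.
- move=> x; rewrite !inE co_app /flip.
  have -> : p - (p + p + 1 - co b x) = - (p - co b x) - 1 by ring.
  move: (p - co b x) => i; have Hi := ltn_ord i.
  have -> : (- i - 1)%R = (L.-1 - i)%N :> nat.
    by rewrite !valE /=; case: eqP => ?; case: ifP => ?; lia.
  by move: Lh Hi; rewrite -leqNgt; move: (L./2) => h; lia.
move=> x y exy; rewrite !inE.
have sub1 (j : 'I_L) : (j - 1)%R = (if j == 0%N :> nat then L.-1 else j.-1) :> nat.
  by have Hj := ltn_ord j; rewrite !valE /=; case: eqP => ?; case: ifP => ?; lia.
have cross i : ((p - i)%R < L./2)%N -> ~~ ((p - (i + 1))%R < L./2)%N -> i = p.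
  have -> : p - (i + 1) = (p - i) - 1 by ring.
  move=> j1 j2; suff : p - i == 0 by rewrite subr_eq0 => /eqP.
  have v0 : val (0 : 'I_L) = 0%N by [].
  rewrite -val_eqE v0; move: j1 j2; rewrite sub1; move: (p - i) => j.
  by have Hj := ltn_ord j; case: eqP => //; lia.
have cross' i : ((p - (i + 1))%R < L./2)%N -> ~~ ((p - i)%R < L./2)%N -> i = flip p (i + 1).
  have -> : p - (i + 1) = (p - i) - 1 by ring.
  move=> j1 j2; apply/eqP; rewrite -subr_eq0.
  have -> : i - flip p (i + 1) = - ((p - i) + (p - i)) by rewrite /flip; ring.
  move: j1 j2; move: (p - i) => j; have Hj := ltn_ord j.
  rewrite sub1; case: eqP => j0 j1 j2; first by lia.
  have jh : (j = L./2 :> nat) by lia.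
  by rewrite oppr_eq0 -val_eqE /= jh -Lh modnn.
have other b' z : b' != b -> co b (translate b' z) = co b z.
  by move/neq_negb ->; rewrite co_appNN.
case: (adjP exy) => [[b' ->]|[b' E]|t] xH yH.
- have [E|nb] := eqVneq b' b; last by move: yH; rewrite other // xH.
  subst b'; move: yH; rewrite co_app => yH; rewrite /reflect_at /translate; apply: app_eq.
  by rewrite (cross _ xH yH) /flip; ring.
- have [Eb|nb] := eqVneq b' b; last by move: xH; rewrite E other // => H; rewrite H in yH.
  subst b'; move: xH; rewrite E co_app => xH.
  rewrite /reflect_at /translate appM -[LHS](app_id b); apply: app_eq.
  exact: (cross' _ xH yH).
move: yH; have -> : co b y = co b x.
  by case/and3P: t => /eqP E _ _; rewrite /co E.
by rewrite xH.
Qed.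

Lemma translate_reflect b p x : reflect_at (~~ b) p (translate b x) = translate b (reflect_at (~~ b) p x).
Proof. by rewrite /reflect_at /translate appC. Qed.

Lemma translate_half b p x : (translate b x \in half_space (~~ b) p) = (x \in half_space (~~ b) p).
Proof. by rewrite !inE co_appN. Qed.

Lemma partner_flip b o x : exists p, partner b o x = reflect_at b p x.
Proof.
have [p E] := pairing_is_flip o (co b x); exists p; rewrite /partner /reflect_at.
exact: app_eq.
Qed.

Lemma partner_adj b o x : e x (partner b o x).
Proof.
rewrite /partner /pairing; have [H|H] := boolP (odd (co b x - o)%R).
  rewrite (app_eq (h := fun i => i - 1)); last by rewrite H.
  rewrite torus_adj_sym; set y := app b _ x.
  have -> : x = translate b y; last exact: adj_translate.
  rewrite /y /translate appM -[LHS](app_id b); apply: app_eq; by rewrite /= subrK.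
rewrite (app_eq (h := fun i => i + 1)); first exact: adj_translate.
by rewrite (negPf H).
Qed.

Lemma partnerK b o : involutive (partner b o).
Proof. by apply: appK; apply: pairingK. Qed.

Lemma partner_translate b o x : partner (~~ b) o (translate b x) = translate b (partner (~~ b) o x).
Proof. by rewrite /partner /translate appC. Qed.

Lemma partner_reflect b o p x : partner b o (reflect_at b p x) = reflect_at b p (partner b o x).
Proof. by rewrite /partner /reflect_at !appM; apply: app_eq; apply: pairing_flip. Qed.

End TorusGeometry.

(** * The logarithmic profile and the conservation law *)

Section Profile.
Variables (R : realFieldType) (rad : nat).
Hypothesis rad2 : (2 <= rad)%N.

Definition harmonic_sum (n : nat) : R := \sum_(1 <= k < n) (k%:R)^-1.
Local Notation Hs := harmonic_sum.

Lemma harmonic_sumS k : (0 < k)%N -> Hs k.+1 = Hs k + (k%:R)^-1.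
Proof. by move=> k0; rewrite /Hs big_nat_recr. Qed.

Lemma harmonic_sum_ge1 : 1 <= Hs rad.
Proof.
rewrite /Hs big_ltn // invr1 lerDl; apply: sumr_ge0 => k _.
by rewrite invr_ge0 ler0n.
Qed.

(** One at 0 and 1, then decreasing like a logarithm down to zero at [rad]: the
    discrete analogue of the potential of a disc in the plane. *)
Definition profile (n : nat) : R := 1 - Hs (minn n rad) / Hs rad.
Definition profile_gap k : R := if (0 < k < rad)%N then (k%:R * Hs rad)^-1 else 0.

Lemma harmonic_sum_neq0 : Hs rad != 0.
Proof. by apply/eqP => E; have := harmonic_sum_ge1; rewrite E; lra. Qed.

Lemma profile_small n : (n <= 1)%N -> profile n = 1.
Proof.
move=> n1; rewrite /profile (minn_idPl _); last by lia.
by rewrite /Hs big_geq // mul0r subr0.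
Qed.

Lemma profile_large n : (rad <= n)%N -> profile n = 0.
Proof. by move=> nr; rewrite /profile (minn_idPr nr) divff ?harmonic_sum_neq0 // subrr. Qed.

Lemma profile_gapE k : profile k - profile k.+1 = profile_gap k.
Proof.
rewrite /profile_gap; case: ifP => [/andP[k0 kr]|].
  rewrite /profile (minn_idPl (ltnW kr)) (minn_idPl kr) harmonic_sumS // invfM; field.
  by rewrite harmonic_sum_neq0 /= pnatr_eq0; lia.
move/negbT; rewrite negb_and -!leqNgt => /orP[k0|rk].
  by rewrite !profile_small ?subrr //; lia.
by rewrite !profile_large ?subrr //; lia.
Qed.

Lemma profile_step m a : (profile (maxn a m) - profile (maxn a.+1 m)) ^+ 2 =
  if (m <= a)%N then profile_gap a ^+ 2 else 0.
Proof.
case: leqP => am; first by rewrite !(maxn_idPl _) ?profile_gapE //; lia.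
by rewrite !(maxn_idPr _) ?subrr ?expr0n //; lia.
Qed.

(** The weight [8 * k] bounds the number of edges, per layer and direction, on which
    the profile drops from level [k] to level [k.+1]. *)
Lemma profile_gap_energy : \sum_(k < rad) (8 * k)%:R * profile_gap k ^+ 2 = 8 / Hs rad.
Proof.
rewrite -(big_mkord predT (fun k => (8 * k)%:R * profile_gap k ^+ 2)) big_ltn; last by lia.
rewrite /profile_gap /= expr0n mulr0 add0r.
have -> : 8 / Hs rad = \sum_(1 <= k < rad) (8 / Hs rad ^+ 2 * (k%:R)^-1).
  by rewrite -mulr_sumr -/(Hs rad); field; exact: harmonic_sum_neq0.
apply: eq_big_nat => k /andP[k1 kr]; rewrite k1 kr /= natrM; field.
by rewrite harmonic_sum_neq0 /= pnatr_eq0; lia.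
Qed.

End Profile.

Lemma count_lt m n : (\sum_(i < m) (i < n)%N <= n)%N.
Proof.
suff -> : (\sum_(i < m) (i < n)%N = minn m n)%N by exact: geq_minr.
by elim: m => [|m IH]; rewrite ?big_ord0 ?min0n // big_ord_recr /= IH; case: ltnP; lia.
Qed.

Lemma count_eq m c : (\sum_(i < m) (i == c :> nat) <= 1)%N.
Proof.
suff -> : (\sum_(i < m) (i == c :> nat) = (c < m))%N by case: (c < m)%N.
by elim: m => [|m IH]; rewrite ?big_ord0 // big_ord_recr /= IH; case: eqP; case: ltnP; lia.
Qed.

Lemma count_ge m n : (\sum_(i < m) (n <= i)%N = m - n)%N.
Proof. by elim: m => [|m IH]; rewrite ?big_ord0 // big_ord_recr /= IH; case: leqP; lia. Qed.

Section Conservation.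
Variables (R : realFieldType) (V : finType) (e : rel V).

Lemma dimer_sum (M : {set V}) (d : {set {set V}}) (g : V -> R) : d \in dimers e M ->
  \sum_(x | x \notin M) g x = \sum_(f in d) \sum_(x in f) g x.
Proof.
move=> dM; under [RHS]eq_bigr => f _ do rewrite big_mkcond /=.
rewrite [RHS]exchange_big /= big_mkcond; apply: eq_bigr => x _.
rewrite -big_mkcondr /= sumr_const; case: ifPn => xM.
  have /dimersP[_ cov] := dM; rewrite -[LHS]mulr1n; congr (_ *+ _).
  by rewrite -(cov x xM); apply: eq_card => f; rewrite !inE.
rewrite (_ : #|_| = 0%N) ?mulr0n //; apply: eq_card0 => f; rewrite !inE.
apply/negP => /andP[fd xf]; move: xM; have [a [b [_ ef aM bM]]] := dimer_edge dM fd.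
by move: xf; rewrite ef !inE => /orP[]/eqP->; rewrite ?aM ?bM.
Qed.

End Conservation.

(** * The flux through a horizontal mirror *)

Section Flux.
Variables (R : realFieldType) (rho : R) (l K rad : nat).
Local Notation L := l.+2.
Local Notation V := (torus L K).
Local Notation e := (@torus_adj L K).
Hypotheses (rho_ge0 : 0 <= rho) (l_gt0 : (0 < l)%N) (evenL : ~~ odd l) (hK : side K).
Hypotheses (rad2 : (2 <= rad)%N) (radL : (2 * rad < L./2)%N).
Variables (t a1 : 'I_L).
Implicit Types (x y : V) (b : bool).
Local Notation Om := (defect_configs e (set0, set0)).
Local Notation wt w := (rho ^+ #|monomers w|).
Local Notation Z := (Zdef e rho (set0, set0)).
Local Notation h := (profile R rad).
Local Notation ed b := (edge_at (@translate l K b)).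

Definition col_offset x : 'I_L := co true x - a1.
Definition row_offset x : 'I_L := co false x - (t + 1).
(** Distance on the cycle in units of two columns. Working with blocks of two makes
    the height invariant under the pairing of columns, and hence its gradient
    odd; the same is done with rows in [height]. *)
Definition fold_dist (z : nat) : nat := minn z./2 (L./2 - z./2).
Definition sign_of x : R := (-1) ^+ par x.
Definition height x : R := h (maxn (fold_dist (col_offset x)) (row_offset x)./2).
Definition staggered x : R := sign_of x * height x.
(** The trace of [height] on the row above the mirror, placed on the row [t] below. *)
Definition top_height x : R := if co false x == t then h (fold_dist (col_offset x)) else 0.
Definition top_charge x : R := sign_of x * top_height x.
Definition row_slope x : R := staggered x + staggered (translate true x).
(** The edges crossing the mirror are removed: they carry the charge itself. *)
Definition col_slope x : R := if co false x == t then 0 else staggered x + staggered (translate false x).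

Lemma sign_adj x y : e x y -> sign_of y = - sign_of x.
Proof. by move=> exy; rewrite /sign_of (par_adj l_gt0 evenL hK exy); case: (par x); rewrite /= ?expr0 ?expr1 ?opprK. Qed.

Lemma sign_sqr x : sign_of x ^+ 2 = 1. Proof. by rewrite /sign_of sqrr_sign. Qed.

Lemma staggered_third x y : third x y -> staggered x + staggered y = 0.
Proof.
move=> t3; rewrite /staggered (sign_adj (adj_third t3)).
have -> : height y = height x; last by rewrite mulNr subrr.
by case/and3P: t3 => /eqP E _ _; rewrite /height /col_offset /row_offset /co E.
Qed.

Lemma edge_at_translate_inj b : injective (ed b).
Proof. exact: (edge_at_inj (translate2 l_gt0 b)). Qed.

Lemma ed_disj x y : ed true x != ed false y.
Proof.
apply/eqP => E.
have cox z : z \in ed true x -> co false z = co false x.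
  by rewrite !inE => /orP[]/eqP->.
have y1 : co false y = co false x by apply: cox; rewrite E !inE eqxx.
have : co false (translate false y) = co false x by apply: cox; rewrite E !inE eqxx orbT.
by rewrite co_app -y1 => /eqP; rewrite (negPf (add1_neq _)).
Qed.

Lemma sum_pair (g : V -> R) x y : x != y -> \sum_(z in [set x; y]) g z = g x + g y.
Proof. by move=> xy; rewrite big_setU1 ?inE //= big_set1. Qed.

Lemma translate_neq b x : x != translate b x.
Proof. by apply/eqP => E; have := adj_translate b x; rewrite -E torus_adj_irrefl. Qed.

(** Each covered vertex lies in one dimer, and the two ends of a dimer along the
    third coordinate cancel. *)
Lemma conservation (M : {set V}) d : d \in dimers e M ->
  \sum_(x | x \notin M) staggered x =
  \sum_x (staggered x + staggered (translate true x)) * (ed true x \in d)%:R +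
  \sum_x (staggered x + staggered (translate false x)) * (ed false x \in d)%:R.
Proof.
move=> dM; rewrite (dimer_sum staggered dM).
have dir b : \sum_x (staggered x + staggered (translate b x)) * (ed b x \in d)%:R =
   \sum_(f in d) (if f \in [set ed b x | x : V] then \sum_(z in f) staggered z else 0).
  rewrite -big_mkcondr /=.
  transitivity (\sum_(f in [set ed b x | x : V]) (\sum_(z in f) staggered z) * (f \in d)%:R).
    rewrite big_imset /=; last by move=> ? ? _ _; apply: edge_at_translate_inj.
    apply: eq_big => [x|x _]; first by rewrite inE.
    by rewrite sum_pair ?translate_neq.
  rewrite [RHS]big_andbC big_mkcondr /=; apply: eq_bigr => f _.
  by case: (f \in d); rewrite ?mulr1 ?mulr0.
rewrite !dir -big_split /=; apply: eq_bigr => f fd.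
have [x [y [exy ef _ _]]] := dimer_edge dM fd.
have i1 b z : ed b z \in [set ed b x | x : V] by apply: imset_f.
have i2 b z : ed b z \notin [set ed (~~ b) x | x : V].
  apply/negP => /imsetP[w _]; case: b => /eqP; first by rewrite (negPf (ed_disj _ _)).
  by rewrite eq_sym (negPf (ed_disj _ _)).
have two b z : f = ed b z -> \sum_(z in f) staggered z =
  (if f \in [set ed true x | x : V] then \sum_(z in f) staggered z else 0) +
  (if f \in [set ed false x | x : V] then \sum_(z in f) staggered z else 0).
  move=> ->; case: b; rewrite i1.
    by rewrite (negPf (i2 true z)) addr0.
  by rewrite (negPf (i2 false z)) add0r.
case: (adjP exy) => [[b yE]|[b xE]|t3].
- by apply: (two b x); rewrite ef yE.
- by apply: (two b y); rewrite ef xE setUC.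
have xy : x != y by apply: contraTneq exy => ->; rewrite torus_adj_irrefl.
by rewrite ef sum_pair // (staggered_third t3); do 2 case: ifP => _; rewrite ?addr0.
Qed.

Lemma row_offset_top x : co false x = t -> row_offset x = l.+1 :> nat.
Proof.
move=> E; rewrite /row_offset E; have -> : t - (t + 1) = - 1 :> 'I_L by ring.
by rewrite valE /= subn1.
Qed.

(** In the conservation law the function jumps from 0 to [top_height] across the
    mirror, so its crossing edges contribute the charge. The sum over the covered
    vertices depends on the monomers only and drops out in the difference of
    the two colours. *)
Lemma flux_sum (M : {set V}) d : d \in dimers e M ->
  \sum_(x in crossing (@reflect_at l K false t) (@half_space l K false t) d) top_charge x =
  \sum_x row_slope x * (ed true x \in d)%:R + \sum_x col_slope x * (ed false x \in d)%:R
  - \sum_(x | x \notin M) staggered x.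
Proof.
move=> dM; rewrite (conservation dM) opprD addrACA subrr add0r -sumrB big_mkcond /=.
apply: eq_bigr => x _; rewrite inE /top_charge /top_height /col_slope.
case: eqP => [E|_]; last first.
  by rewrite mulr0 if_same subrr.
have xh : x \in @half_space l K false t.
  by rewrite inE E subrr /=; lia.
have -> : [set x; reflect_at false t x] = ed false x.
  rewrite /edge_at; congr [set x; _]; rewrite /reflect_at /translate; apply: app_eq.
  by rewrite E /flip; ring.
rewrite xh /= mul0r sub0r.
have gx : staggered x = 0.
  rewrite /staggered /height (profile_large R rad2) ?mulr0 //.
  rewrite leq_max (row_offset_top E); apply/orP; right; lia.
have gs : staggered (translate false x) = - (sign_of x * h (fold_dist (col_offset x))).
  rewrite /staggered (sign_adj (adj_translate false x)) mulNr; congr (- (_ * _)).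
  by rewrite /height /col_offset /row_offset co_app (co_appN false) E subrr maxn0.
by rewrite gx gs add0r mulNr opprK; case: (ed false x \in d); rewrite ?mulr1 ?mulr0.
Qed.

Lemma staggered_row x : staggered (partner false (t + 1) x) = - staggered x.
Proof.
rewrite /staggered (sign_adj (partner_adj false (t + 1) x)) mulNr; congr (- (_ * _)).
by rewrite /height /col_offset /row_offset /partner co_app co_appNN pairing_half.
Qed.

Lemma staggered_col x : staggered (partner true a1 x) = - staggered x.
Proof.
rewrite /staggered (sign_adj (partner_adj true a1 x)) mulNr; congr (- (_ * _)).
by rewrite /height /col_offset /row_offset /partner co_app co_appNN /fold_dist pairing_half.
Qed.

Lemma row_slope_anti x : row_slope (partner false (t + 1) x) = - row_slope x.
Proof. by rewrite /row_slope -(partner_translate true) !staggered_row opprD. Qed.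

Lemma col_slope_anti x : col_slope (partner true a1 x) = - col_slope x.
Proof.
rewrite /col_slope -(partner_translate false) !staggered_col /partner co_appNN.
by case: ifP => _; rewrite ?oppr0 ?opprD.
Qed.

Definition energy (u : V -> R) := \sum_x u x ^+ 2.

Lemma variance b o (u : V -> R) : (forall x, u (partner (~~ b) o x) = - u x) ->
  \sum_(w in Om) (\sum_x u x * (ed b x \in blue w)%:R) ^+ 2 * wt w <= 7/2 * energy u * Z /\
  \sum_(w in Om) (\sum_x u x * (ed b x \in red w)%:R) ^+ 2 * wt w <= 7/2 * energy u * Z.
Proof.
move=> anti.
have H1 : symmetric e by apply: torus_adj_sym.
have H3 : injective (@translate l K b) := @translateI l K b. have H4 := @adj_translate l K b. have H5 := @translate2 l K l_gt0 b.
have H6 := @reflection_torus l K l_gt0 evenL hK (~~ b).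
have H7 p x := @translate_reflect l K b p x. have H8 p x := @translate_half l K b p x.
have H9 := @partner_adj l K (~~ b) o. have H10 := @partner_translate l K b o.
have H11 := @partnerK l K evenL (~~ b) o.
have H12 p x := @partner_reflect l K evenL (~~ b) o p x.
have H13 := @partner_flip l K (~~ b) o.
by split; [apply: (blue_variance rho_ge0 H1 H3 H4 H5 H6 H7 H8 H9 H10 H11 H12 H13)
          |apply: (red_variance rho_ge0 H1 H3 H4 H5 H6 H7 H8 H9 H10 H11 H12 H13)].
Qed.

(** The charge is a signed sum of four statistics, each bounded by [variance];
    28 is 4 times 7/2, twice. *)
Lemma flux_variance :
  \sum_(w in Om) charge top_charge (fun x => - top_charge x)
     (crossing (@reflect_at l K false t) (@half_space l K false t) (blue w),
      crossing (@reflect_at l K false t) (@half_space l K false t) (red w)) ^+ 2 * wt w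
  <= 28 * (energy row_slope + energy col_slope) * Z.
Proof.
pose B b (u : V -> R) (d : {set {set V}}) : R := \sum_x u x * (ed b x \in d)%:R.
have E w : w \in Om -> charge top_charge (fun x => - top_charge x)
     (crossing (@reflect_at l K false t) (@half_space l K false t) (blue w),
      crossing (@reflect_at l K false t) (@half_space l K false t) (red w)) =
    B true row_slope (blue w) + B false col_slope (blue w) - B true row_slope (red w) - B false col_slope (red w).
  case: w => [[M d] d']; rewrite in_defect /= !set0U => /and3P[_ bD rD].
  by rewrite /charge /= sumrN (flux_sum bD) (flux_sum rD) /B /blue /red /=; ring.
have [v1 v2] := @variance true _ _ row_slope_anti.
have [v3 v4] := @variance false _ _ col_slope_anti.
apply: (@le_trans _ _ (\sum_(w in Om) (4 * (B true row_slope (blue w) ^+ 2 * wt w)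
   + 4 * (B false col_slope (blue w) ^+ 2 * wt w) + 4 * (B true row_slope (red w) ^+ 2 * wt w)
   + 4 * (B false col_slope (red w) ^+ 2 * wt w)))).
  apply: ler_sum => w wO; rewrite E //.
  move: (B true row_slope (blue w)) (B false col_slope (blue w)) (B true row_slope (red w)) (B false col_slope (red w)) => p q r s.
  have := exprn_ge0 #|monomers w| rho_ge0; move: (rho ^+ _) => c c0.
  have S : (p + q - r - s) ^+ 2 <= 4 * p ^+ 2 + 4 * q ^+ 2 + 4 * r ^+ 2 + 4 * s ^+ 2.
    have := sqr_ge0 (p - q); have := sqr_ge0 (p + r); have := sqr_ge0 (p + s).
    have := sqr_ge0 (q + r); have := sqr_ge0 (q + s); have := sqr_ge0 (r - s).
    nra.
  apply: (le_trans (ler_wpM2r c0 S)); rewrite le_eqVlt; apply/orP; left; apply/eqP; ring.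
rewrite !big_split /= -!mulr_sumr.
move: v1 v2 v3 v4; rewrite /B; lra.
Qed.

End Flux.

(** * The energy of the profile *)

Section Energy.
Variables (R : realFieldType) (l K rad : nat).
Local Notation L := l.+2.
Local Notation V := (torus L K).
Hypotheses (l_gt0 : (0 < l)%N) (evenL : ~~ odd l) (hK : side K).
Hypotheses (rad2 : (2 <= rad)%N) (radL : (2 * rad < L./2)%N).
Variables (t a1 : 'I_L).
Implicit Types (x y : V) (b : bool).
Local Notation h := (profile R rad).
Local Notation pgap := (profile_gap R rad).
Local Notation zc := (col_offset a1).
Local Notation rc := (row_offset t).
Local Notation dd := (fold_dist l).

(** The levels change only between blocks, at two places of the cycle per level. *)
Lemma fold_dist_step z : (z < L)%N -> let z' := if (z.+1 < L)%N then z.+1 else 0%N in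
  [\/ dd z' = dd z, dd z' = (dd z).+1 /\ z = (2 * dd z).+1
    | dd z = (dd z').+1 /\ z = (L - 2 * dd z' - 1)%N].
Proof.
move=> zL z'; rewrite /z' /fold_dist; case: ltnP => zL'.
  have [E|[E|E]] : minn z.+1./2 (L./2 - z.+1./2) = minn z./2 (L./2 - z./2) \/
     minn z.+1./2 (L./2 - z.+1./2) = (minn z./2 (L./2 - z./2)).+1 \/
     minn z./2 (L./2 - z./2) = (minn z.+1./2 (L./2 - z.+1./2)).+1 by lia.
  - by constructor 1.
  - by constructor 2; split=> //; lia.
  - by constructor 3; split=> //; lia.
by constructor 3; split; lia.
Qed.

Lemma count_torus (P Q : nat -> bool) :
  (\sum_(x : V) (P (zc x) && Q (rc x))%N =
   K * ((\sum_(i < L) P i) * (\sum_(j < L) Q j)))%N.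
Proof.
have -> : (\sum_(x : V) (P (zc x) && Q (rc x))%N =
   \sum_(i < L) \sum_(j < L) \sum_(k < K) (P (i - a1)%R && Q (j - (t + 1))%R))%N.
  rewrite pair_big pair_big /=; apply: eq_bigr => -[[i j] k] _.
  by rewrite /col_offset /row_offset /co /=.
have sh (c : 'I_L) (F : 'I_L -> nat) : (\sum_(i : 'I_L) F (i - c)%R = \sum_(i : 'I_L) F i)%N.
  by rewrite (reindex_inj (addIr c)); apply: eq_bigr => i _; rewrite addrK.
rewrite (sh a1 (fun i : 'I_L => \sum_(j < L) \sum_(k < K) (P i && Q (j - (t + 1))%R)))%N.
rewrite mulnC big_distrl big_distrl /=; apply: eq_bigr => i _.
rewrite (sh (t + 1)%R (fun j : 'I_L => \sum_(k < K) (P i && Q j)%N))%N.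
rewrite big_distrr big_distrl /=; apply: eq_bigr => j _.
rewrite sum_nat_const card_ord mulnC.
by case: (P i); case: (Q j).
Qed.

(** At level [k] the gradient is carried by the lines satisfying [P k] in one
    direction and [Q k] in the other. *)
Lemma energy_bound (u : V -> R) (P Q : nat -> nat -> bool) :
  (forall x, u x ^+ 2 <= \sum_(k < rad) (P k (zc x) && Q k (rc x))%:R * pgap k ^+ 2) ->
  (forall k, (0 < k)%N -> ((\sum_(i < L) P k i) * (\sum_(j < L) Q k j) <= 8 * k)%N) ->
  energy u <= 8 * K%:R / harmonic_sum R rad.
Proof.
move=> uP cnt; rewrite /energy.
apply: (le_trans (ler_sum _ (fun x _ => uP x))); rewrite exchange_big /=.
have -> : 8 * K%:R / harmonic_sum R rad = K%:R * \sum_(k < rad) (8 * k)%:R * pgap k ^+ 2.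
  by rewrite profile_gap_energy //; ring.
rewrite mulr_sumr; apply: ler_sum => k _; rewrite -mulr_suml -natr_sum count_torus.
have [k0|k0] := posnP k; first by rewrite k0 /profile_gap /= expr0n !mulr0.
rewrite mulrA -natrM; apply: ler_wpM2r; first exact: sqr_ge0.
by rewrite ler_nat leq_mul2l cnt // orbT.
Qed.

Lemma single_term (c : nat -> bool) k : (k < rad)%N -> c k ->
  pgap k ^+ 2 <= \sum_(k < rad) (c k)%:R * pgap k ^+ 2.
Proof.
move=> kr ck; rewrite (bigD1 (Ordinal kr)) //= ck mul1r lerDl.
by apply: sumr_ge0 => i _; rewrite mulr_ge0 ?ler0n ?sqr_ge0.
Qed.

Lemma profile_gap_large k : (rad <= k)%N -> pgap k = 0.
Proof. by move=> kr; rewrite /profile_gap [(k < rad)%N]ltnNge kr andbF. Qed.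

Local Ltac sum_nonneg := by apply: sumr_ge0 => i _; rewrite mulr_ge0 ?ler0n ?sqr_ge0.

Lemma energy_row : energy (row_slope R rad t a1 (K := K)) <= 8 * K%:R / harmonic_sum R rad.
Proof.
apply: (energy_bound (P := fun k z => (z == (2 * k).+1) || (z == L - 2 * k - 1)%N)
   (Q := fun k r => (r < 2 * k + 2)%N)) => [x|k k0]; last first.
  apply: (@leq_trans (2 * (2 * k + 2))); last by lia.
  apply: leq_mul; last exact: count_lt.
  apply: (@leq_trans (\sum_(i < L) ((i == (2 * k).+1 :> nat) + (i == (L - 2 * k - 1)%N :> nat)))).
    by apply: leq_sum => i _; do 2 case: eqP.
  by rewrite big_split -[2%N]/(1 + 1)%N; apply: leq_add; apply: count_eq.
rewrite /row_slope /staggered (sign_adj _ l_gt0 evenL hK (adj_translate true x)) mulNr -mulrBr exprMn sign_sqr mul1r.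
have Hz := ltn_ord (zc x).
have Ez : zc (translate true x) = (if ((zc x).+1 < L)%N then (zc x).+1 else 0%N) :> nat.
  rewrite /col_offset co_app addrAC; move: (co true x - a1) => j.
  by have Hj := ltn_ord j; rewrite val_add val_one addn1; case: ifP => // H; lia.
have Er : rc (translate true x) = rc x by rewrite /row_offset (co_appN true).
rewrite /height Er Ez; move: (zc x) (rc x) Hz => [z zL] [r rL] /= _.
have step a a' : a' = a.+1 -> z = (2 * a).+1 \/ z = (L - 2 * a - 1)%N ->
   (h (maxn a r./2) - h (maxn a' r./2)) ^+ 2 <=
   \sum_(k < rad) (((z == (2 * k).+1) || (z == L - 2 * k - 1)%N) && (r < 2 * k + 2)%N)%:R * pgap k ^+ 2.
  move=> -> za; rewrite profile_step //; case: leqP => ra; last sum_nonneg.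
  have [rk|kr] := leqP rad a; first by rewrite profile_gap_large // expr0n; sum_nonneg.
  apply: (single_term (c := fun k => ((z == (2 * k).+1) || (z == L - 2 * k - 1)%N) && (r < 2 * k + 2)%N) kr).
  by apply/andP; split; [case: za => <-; rewrite eqxx ?orbT|lia].
case: (fold_dist_step zL) => [E|[E z1]|[E z1]].
- by rewrite E subrr expr0n; sum_nonneg.
- by apply: (step _ _ E); left.
- by rewrite -sqrrN opprB; apply: (step _ _ E); right.
Qed.

Lemma energy_col : energy (col_slope R rad t a1 (K := K)) <= 8 * K%:R / harmonic_sum R rad.
Proof.
apply: (energy_bound (P := fun k z => (z < 2 * k + 2)%N || (L - 2 * k <= z)%N)
   (Q := fun k r => r == (2 * k).+1)) => [x|k k0]; last first.
  apply: (@leq_trans (8 * k * 1)); last by lia.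
  apply: leq_mul; last exact: count_eq.
  apply: (@leq_trans (\sum_(i < L) ((i < 2 * k + 2)%N + (L - 2 * k <= i)%N))).
    by apply: leq_sum => i _; do 2 case: leqP.
  by rewrite big_split; apply: (leq_trans (leq_add (count_lt _ _) (eq_leq (count_ge _ _)))); lia.
rewrite /col_slope; case: eqP => [_|nt]; first by rewrite expr0n; sum_nonneg.
rewrite /staggered (sign_adj _ l_gt0 evenL hK (adj_translate false x)) mulNr -mulrBr exprMn sign_sqr mul1r.
have Ez : zc (translate false x) = zc x by rewrite /col_offset (co_appN false).
have Er : rc (translate false x) = (rc x).+1 :> nat.
  have nt' : (co false x - (t + 1)) + 1 != 0.
    have -> : (co false x - (t + 1)) + 1 = co false x - t by ring.
    by rewrite subr_eq0; apply/eqP.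
  rewrite /row_offset co_app addrAC; move: (co false x - (t + 1)) nt' => j.
  have Hj := ltn_ord j; rewrite -val_eqE; have -> : val (0 : 'I_L) = 0%N by [].
  by rewrite -[val _]/(nat_of_ord _) val_add val_one addn1; case: ifP => // H; lia.
rewrite /height Er Ez; move: (zc x) (rc x) => [z zL] [r rL] /=.
have [ro|re] := boolP (odd r); last first.
  by rewrite uphalf_half (negPf re) add0n subrr expr0n; sum_nonneg.
rewrite uphalf_half ro add1n.
rewrite !(maxnC (dd z)) profile_step //; case: leqP => zr; last sum_nonneg.
have [rk|kr] := leqP rad r./2; first by rewrite profile_gap_large // expr0n; sum_nonneg.
apply: (single_term (c := fun k => ((z < 2 * k + 2)%N || (L - 2 * k <= z)%N) && (r == (2 * k).+1)) kr).
by move: zr; rewrite /fold_dist; lia.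
Qed.

End Energy.

(** * Defects facing their mirror images *)

Section Axis.
Local Arguments co : simpl never.
Variables (R : realFieldType) (rho : R) (l K rad : nat).
Local Notation L := l.+2.
Local Notation V := (torus L K).
Local Notation e := (@torus_adj L K).
Hypotheses (rho_ge0 : 0 <= rho) (l_gt0 : (0 < l)%N) (evenL : ~~ odd l) (hK : side K).
Hypotheses (rad2 : (2 <= rad)%N) (radL : (2 * rad < L./2)%N).
Implicit Types (x y a : V) (b : bool) (p t : 'I_L) (A B : {set V} * {set V}).
Local Notation Zd := (Zdef e rho).
Local Notation Z := (Zd (set0, set0)).
Local Notation h := (profile R rad).
Local Notation mir := (@reflect_at l K).
Local Notation hemi := (@half_space l K).

(** The constant is 4 (from [uncertainty]) times 28 (from [flux_variance]) times
    16 (8 for each of the two energies). *)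
Definition decay_sq : R := 1792 * K%:R / harmonic_sum R rad.

Lemma top_row t x : co false x = t ->
  x \in rim e (mir false t) (hemi false t) /\ mir false t x = translate false x.
Proof.
move=> xt; have E : mir false t x = translate false x.
  by rewrite /reflect_at /translate; apply: app_eq; rewrite xt /flip; ring.
split=> //; rewrite inE E adj_translate andbT inE xt subrr /=; lia.
Qed.

Lemma axis_core t (a1 : 'I_L) A B :
  (forall x, x \in A.1 :|: A.2 :|: (B.1 :|: B.2) -> co false x = t) ->
  let q := charge (top_charge R rad t a1) (fun x => - top_charge R rad t a1 x) in
  1 <= (q A - q B) ^+ 2 ->
  Zd (mirror (mir false t) A B) ^+ 2 <= decay_sq * Z ^+ 2.
Proof.
move=> row q q1; have Z0 : 0 <= Z by apply: Zdef_ge0.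
have sub (U : {set V}) : U \subset A.1 :|: A.2 :|: (B.1 :|: B.2) ->
    U \subset rim e (mir false t) (hemi false t).
  by move=> /subsetP s; apply/subsetP => x /s /row /top_row[].
have U := uncertainty rho (@torus_adj_sym L K) (reflection_torus l_gt0 evenL hK false t)
  (top_charge R rad t a1) (fun x => - top_charge R rad t a1 x)
  (sub _ (subset_trans (subsetUl A.1 A.2) (subsetUl _ _)))
  (sub _ (subset_trans (subsetUr A.1 A.2) (subsetUl _ _)))
  (sub _ (subset_trans (subsetUl B.1 B.2) (subsetUr _ _)))
  (sub _ (subset_trans (subsetUr B.1 B.2) (subsetUr _ _))).
have F := flux_variance rho_ge0 l_gt0 evenL hK rad2 radL t a1.
have E1 := energy_row R l_gt0 evenL hK rad2 radL t a1.
have E2 := energy_col R l_gt0 evenL hK rad2 radL t a1.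
move: U F; rewrite -/q exprMn; set X := \sum_(w in _) _; set z := Zd (mirror _ _ _) => U F.
have X1 : X <= 448 * K%:R / harmonic_sum R rad * Z.
  apply: (le_trans F); apply: ler_wpM2r => //.
  have -> : 448 * K%:R / harmonic_sum R rad = 28 * (8 * K%:R / harmonic_sum R rad + 8 * K%:R / harmonic_sum R rad).
    by field; apply: harmonic_sum_neq0.
  by apply: ler_wpM2l => //; apply: lerD.
apply: (@le_trans _ _ ((q A - q B) ^+ 2 * z ^+ 2)).
  by rewrite ler_peMl ?sqr_ge0.
apply: (le_trans U); rewrite -mulrA.
apply: (@le_trans _ _ (4 * (448 * K%:R / harmonic_sum R rad * Z * Z))).
  by apply: ler_wpM2l => //; apply: ler_wpM2r.
by rewrite /decay_sq le_eqVlt; apply/orP; left; apply/eqP; field; apply: harmonic_sum_neq0.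
Qed.

(** Columns at distance at most one, in a form that computes in the ring of
    integers modulo the length. *)
Definition near_col (i j : 'I_L) : Prop := exists k, (k <= 2)%N /\ j = i - 1 + k%:R.

Lemma near_col_refl i : near_col i i.
Proof. by exists 1%N; split=> //; ring. Qed.

Lemma near_col_adj x y : e x y -> near_col (co true x) (co true y).
Proof.
case/adjP => [[[] ->]|[[] ->]|/and3P[/eqP E _ _]].
- by exists 2; split=> //; rewrite co_app; ring.
- by rewrite (co_appN false); apply: near_col_refl.
- by exists 0%N; split=> //; rewrite co_app; ring.
- by rewrite (co_appN false); apply: near_col_refl.
by rewrite /co E; apply: near_col_refl.
Qed.

Lemma val_natr n : (n < L)%N -> (n%:R : 'I_L) = n :> nat.
Proof. by move=> nL; rewrite Zp_nat /= modn_small. Qed.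

Definition far_col p (i : 'I_L) : bool :=
  (2 * rad < (flip p i - i)%R)%N && ((flip p i - i)%R < L - 2 * rad)%N.

Lemma height_near (i j : 'I_L) : near_col i j -> h (fold_dist l (j - i)%R) = 1.
Proof.
move=> [k [k2 ->]]; apply: profile_small => //.
have -> : i - 1 + k%:R - i = k%:R - 1 by ring.
case: k k2 => [|[|[|//]]] _.
- have -> : (0%:R - 1 : 'I_L)%R = l.+1 :> nat by rewrite sub0r valE /= subn1.
  by rewrite /fold_dist; lia.
- by rewrite subrr /= /fold_dist; lia.
have -> : 2%:R - 1 = 1 :> 'I_L by ring.
by rewrite val_one /fold_dist; lia.
Qed.

Lemma height_far p (i j : 'I_L) : near_col i j -> far_col p i -> h (fold_dist l (flip p j - i)%R) = 0.
Proof.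
move=> [k [k2 ->]] /andP[f1 f2]; apply: profile_large => //.
have -> : flip p (i - 1 + k%:R) - i = (flip p i - i) + 1 - k%:R by rewrite /flip; ring.
move: (flip p i - i) f1 f2 => m f1 f2; have mL := ltn_ord m.
have -> : (m + 1 - k%:R)%R = (m + 1 - k)%N :> nat.
  have -> : m + 1 - k%:R = (m + 1 - k)%N%:R.
    apply: (addIr k%:R); rewrite subrK -natrD subnK; last by lia.
    by rewrite natrD natr_Zp.
  by apply: val_natr; lia.
by rewrite /fold_dist; lia.
Qed.

Lemma reflect_neq p (i : 'I_L) x : near_col i (co true x) -> far_col p i -> x != mir true p x.
Proof.
move=> ni fi; apply/eqP => /(congr1 (co true)); rewrite co_app => E.
have H1 := height_near ni; have H2 := height_far ni fi.
by move: H1; rewrite [co true x]E H2 => /eqP; rewrite eq_sym oner_eq0.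
Qed.

Lemma top_charge_row t x (a1 : 'I_L) : co false x = t -> top_charge R rad t a1 x = sign_of R x * h (fold_dist l (co true x - a1)%R).
Proof. by move=> E; rewrite /top_charge /top_height E eqxx. Qed.

Lemma top_charge_pair p a x : near_col (co true a) (co true x) -> far_col p (co true a) ->
  \sum_(z in x |: mir true p @: [set x]) top_charge R rad (co false x) (co true a) z = sign_of R x.
Proof.
move=> nx fa; rewrite imset_set1 sum_pair ?(reflect_neq nx fa) //.
rewrite !top_charge_row // co_app.
by rewrite (height_near nx) (height_far nx fa) mulr1 mulr0 addr0.
Qed.

Lemma sign_double_sqr (x : V) : (sign_of R x + sign_of R x) ^+ 2 = 4.
Proof. by have := sign_sqr R x; rewrite !expr2; lra. Qed.

Lemma reflect_comm p t x : mir false t (mir true p x) = mir true p (mir false t x).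
Proof. by rewrite /reflect_at (appC false). Qed.

(** The horizontal mirror is placed on the row of the defects. The charge of the
    two sides differs by one for a single defect and by two for a defect of each
    colour, because adjacent vertices and different colours both change the
    sign. If the two defects lie in adjacent rows the mirror passes between
    them, so that they sit on opposite sides of it. *)
Lemma axis_bound p a A : far_col p (co true a) ->
  [\/ A = ([set a], set0), A = (set0, [set a]) | exists2 a', e a a' & A = ([set a], [set a'])] ->
  Zd (mirror (mir true p) A A) ^+ 2 <= decay_sq * Z ^+ 2.
Proof.
move=> fa; have na := near_col_refl (co true a).
have c0 (x : V) : ~~ (x \in (set0 : {set V})) by rewrite inE.
have row2 (x y : V) t : co false x = t -> y \in x |: mir true p @: [set x] -> co false y = t.
  by move=> xt; rewrite imset_set1 !inE => /orP[]/eqP-> //; rewrite (co_appN true).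
have mE t U W : mirror (mir false t) (U, W) (set0, set0) = (U, W).
  by rewrite /mirror /= !imset0 !setU0.
have m0 : mirror (mir true p) (set0, set0) (set0, set0) = (set0, set0) by rewrite /mirror /= !imset0 !setU0.
case=> [->|->|[a' aa' ->]]; rewrite /mirror /=.
- rewrite imset0 setU0 -(mE (co false a)).
  apply: (@axis_core _ (co true a)); rewrite /charge /= ?big_set0.
    by move=> x; rewrite !setU0; apply: row2.
  by rewrite !addr0 subr0 top_charge_pair // sign_sqr.
- rewrite imset0 setU0 -(mE (co false a)).
  apply: (@axis_core _ (co true a)); rewrite /charge /= ?big_set0.
    by move=> x; rewrite !setU0 set0U; apply: row2.
  by rewrite !addr0 subr0 add0r sumrN top_charge_pair // sqrrN sign_sqr.
have na' := near_col_adj aa'; have sa := sign_adj R l_gt0 evenL hK aa'.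
(* Same row, or one row above or below. *)
have [E|E|E] : [\/ co false a' = co false a, a' = translate false a | a = translate false a'].
  case/adjP: aa' => [[[] ->]|[[] ->]|/and3P[/eqP E _ _]].
  + by constructor 1; rewrite (co_appN true).
  + by constructor 2.
  + by constructor 1; rewrite (co_appN true).
  + by constructor 3.
  + by constructor 1; rewrite /co E.
- rewrite -(mE (co false a)).
  apply: (@axis_core _ (co true a)); rewrite /charge /= ?big_set0.
    by move=> x; rewrite !setU0 in_setU => /orP[]; apply: row2.
  rewrite !addr0 subr0 sumrN top_charge_pair // -E top_charge_pair // sa opprK sign_double_sqr; lra.
- have E' : mir false (co false a) a = a' by rewrite E; case: (top_row (erefl (co false a))).
  have -> : (a |: mir true p @: [set a], a' |: mir true p @: [set a']) =
     mirror (mir false (co false a)) (a |: mir true p @: [set a], set0)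
                                     (set0, a |: mir true p @: [set a]).
    by rewrite /mirror /= imset0 setU0 set0U imsetU1 !imset_set1 reflect_comm E'.
  apply: (@axis_core _ (co true a)); rewrite /charge /= ?big_set0.
    by move=> x; rewrite !setU0 !set0U setUid; apply: row2.
  rewrite add0r addr0 sumrN top_charge_pair // opprK sign_double_sqr; lra.
have E' : mir false (co false a') a' = a by rewrite [RHS]E; case: (top_row (erefl (co false a'))).
have -> : (a |: mir true p @: [set a], a' |: mir true p @: [set a']) =
   mirror (mir false (co false a')) (set0, a' |: mir true p @: [set a'])
                                    (a' |: mir true p @: [set a'], set0).
  by rewrite /mirror /= imset0 setU0 set0U imsetU1 !imset_set1 reflect_comm E'.
apply: (@axis_core _ (co true a)); rewrite /charge /= ?big_set0.
  by move=> x; rewrite !setU0 !set0U setUid; apply: row2.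
by rewrite add0r addr0 sumrN top_charge_pair // -opprD sqrrN sign_double_sqr; lra.
Qed.

End Axis.

(** * Defects far apart *)

Section FarPair.
Variables (R : realFieldType) (rho : R) (l K rad : nat).
Local Notation L := l.+2.
Local Notation V := (torus L K).
Local Notation e := (@torus_adj L K).
Hypotheses (rho_ge0 : 0 <= rho) (l_gt0 : (0 < l)%N) (evenL : ~~ odd l) (hK : side K).
Hypotheses (rad2 : (2 <= rad)%N).
Implicit Types (x y o : V) (p : 'I_L) (A B : {set V} * {set V}).
Local Notation Zd := (Zdef e rho).
Local Notation Z := (Zd (set0, set0)).
Local Notation mir := (@reflect_at l K).
Local Notation hemi := (@half_space l K).
Local Notation decay := (decay_sq R K rad).

(** The defects left at [o] by an endpoint of the two-point function or by the cut
    end of an opened loop. *)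
Definition near_defect o A : Prop :=
  [\/ A = ([set o], set0), A = (set0, [set o]) |
      exists2 o', e o o' & A = ([set o], [set o']) \/ A = ([set o'], [set o])].

Lemma near_defect_col o A y : near_defect o A -> y \in A.1 :|: A.2 ->
  near_col (co true o) (co true y).
Proof.
case=> [->|->|[o' oo' [->|->]]] /=; rewrite ?setU0 ?set0U !inE.
- by move=> /eqP->; apply: near_col_refl.
- by move=> /eqP->; apply: near_col_refl.
- by case/orP=> /eqP->; [apply: near_col_refl|apply: near_col_adj].
- by case/orP=> /eqP->; [apply: near_col_adj|apply: near_col_refl].
Qed.

Lemma near_axis p o A : (2 * rad < L./2)%N -> near_defect o A ->
  (forall j, near_col (co true o) j -> far_col rad p j) ->
  Zd (mirror (mir true p) A A) ^+ 2 <= decay * Z ^+ 2.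
Proof.
move=> radL nA far; case: nA => [E|E|[o' oo' [E|E]]].
- apply: (@axis_bound _ _ _ _ _ rho_ge0 l_gt0 evenL hK rad2 radL p o A); last by constructor 1.
  by apply: far; apply: near_col_refl.
- apply: (@axis_bound _ _ _ _ _ rho_ge0 l_gt0 evenL hK rad2 radL p o A); last by constructor 2.
  by apply: far; apply: near_col_refl.
- apply: (@axis_bound _ _ _ _ _ rho_ge0 l_gt0 evenL hK rad2 radL p o A); last by constructor 3; exists o'.
  by apply: far; apply: near_col_refl.
apply: (@axis_bound _ _ _ _ _ rho_ge0 l_gt0 evenL hK rad2 radL p o' A).
  by apply: far; apply: near_col_adj.
by constructor 3; exists o => //; rewrite torus_adj_sym.
Qed.

Lemma val_neg (i : 'I_L) n : (0 < n < L)%N -> i = - n%:R -> i = (L - n)%N :> nat.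
Proof.
move=> /andP[n0 nL] ->; rewrite val_opp val_natr //; case: eqP => //; lia.
Qed.

Lemma hemi_near p (i j : 'I_L) m : p = i + m%:R -> (1 <= m)%N -> (m + 1 < L./2)%N ->
  near_col i j -> ((p - j)%R < L./2)%N.
Proof.
move=> -> m1 mL [k [k2 ->]].
have -> : i + m%:R - (i - 1 + k%:R) = (m + 1 - k)%N%:R.
  by apply: (addIr k%:R); rewrite -natrD subnK; [rewrite natrD; ring|lia].
by rewrite val_natr; lia.
Qed.

Lemma hemi_far p (i j : 'I_L) m d : p = i + m%:R -> (m + 2 <= d)%N -> (d + 1 <= m + L./2)%N ->
  near_col (i + d%:R) j -> (L./2 <= (p - j)%R)%N.
Proof.
move=> -> m1 mL [k [k2 ->]].
rewrite (@val_neg _ (d + k - (m + 1))%N); [lia|lia|].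
apply: (addIr (d + k - (m + 1))%N%:R); rewrite addNr.
apply: (addIr (m + 1)%N%:R); rewrite -addrA -natrD subnK; last by lia.
by rewrite !natrD; ring.
Qed.

Lemma far_near p (i j : 'I_L) m : p = i + m%:R -> (rad + 1 <= m)%N -> (2 * m + 2 * rad + 3 < L)%N ->
  near_col i j -> far_col rad p j.
Proof.
move=> -> m1 mL [k [k2 ->]]; rewrite /far_col.
have -> : flip (i + m%:R) (i - 1 + k%:R) - (i - 1 + k%:R) = (2 * m + 3 - 2 * k)%N%:R.
  apply: (addIr (2 * k)%N%:R); rewrite -natrD subnK; last by lia.
  by rewrite /flip !natrD ?natrM; ring.
by rewrite val_natr; lia.
Qed.

Lemma far_far p (i j : 'I_L) m d : p = i + m%:R -> (m + rad + 2 <= d)%N ->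
  (2 * d + 2 * rad + 3 < L + 2 * m)%N ->
  near_col (i + d%:R) j -> far_col rad p j.
Proof.
move=> -> m1 mL [k [k2 ->]]; rewrite /far_col.
rewrite (@val_neg _ (2 * d + 2 * k - (2 * m + 3))%N); [lia|lia|].
apply: (addIr (2 * d + 2 * k - (2 * m + 3))%N%:R); rewrite addNr.
apply: (addIr (2 * m + 3)%N%:R); rewrite -addrA -natrD subnK; last by lia.
by rewrite /flip !natrD ?natrM; ring.
Qed.

(** Reflection positivity in the vertical mirror half way between [o] and [x]. *)
Lemma far_pair_half o x A B : near_defect o A -> near_defect x B ->
  let d := nat_of_ord (co true x - co true o) in
  (2 * rad + 8 <= d)%N -> (d <= L./2)%N ->
  Zd (psetU A B) ^+ 2 <= decay * Z ^+ 2.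
Proof.
move=> nA nB d d1 d2; have dL : (d < L)%N by apply: ltn_ord.
have xE : co true x = co true o + d%:R by rewrite natr_Zp addrC subrK.
set m := d./2; set p : 'I_L := co true o + m%:R.
have rf := reflection_torus l_gt0 evenL hK true p; have tK := refl_inv rf.
pose t := mir true p.
pose B' := (t @: B.1, t @: B.2).
have ttK (U : {set V}) : t @: (t @: U) = U.
  by rewrite -imset_comp -[RHS]imset_id; apply: eq_imset => y; apply: tK.
have AH y : y \in A.1 :|: A.2 -> y \in hemi true p.
  move=> /(near_defect_col nA) ny; rewrite inE.
  by apply: (hemi_near (i := co true o) (m := m)) => //; rewrite /m; lia.
have BH y : y \in B.1 :|: B.2 -> y \notin hemi true p.
  move=> /(near_defect_col nB); rewrite xE => ny; rewrite inE -leqNgt.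
  by apply: (hemi_far (i := co true o) (m := m) (d := d)) => //; rewrite /m; lia.
have B'H (U : {set V}) : U \subset B.1 :|: B.2 -> t @: U \subset hemi true p.
  move=> /subsetP UB; apply/subsetP => y; rewrite (mem_timg rf) => /UB /BH.
  by rewrite (refl_half rf) negbK.
have A1 : A.1 \subset hemi true p by apply/subsetP => y yA; apply: AH; rewrite in_setU yA.
have A2 : A.2 \subset hemi true p by apply/subsetP => y yA; apply: AH; rewrite in_setU yA orbT.
have RP := reflection_positivity rho (@torus_adj_sym L K) rf A1 A2
  (B'H _ (subsetUl B.1 B.2)) (B'H _ (subsetUr B.1 B.2)) (B := B').
have E1 : mirror t A B' = psetU A B by rewrite /mirror /= !ttK.
have E2 : mirror t B' B' = mirror t B B by rewrite /mirror /= !ttK !(setUC (t @: _)).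
move: RP; rewrite -/t E1 E2 => RP; apply: (le_trans RP).
have radL : (2 * rad < L./2)%N by lia.
have QA : Zd (mirror t A A) ^+ 2 <= decay * Z ^+ 2.
  apply: (near_axis radL nA) => j nj.
  by apply: (far_near (i := co true o) (m := m)) => //; rewrite /m; lia.
have QB : Zd (mirror t B B) ^+ 2 <= decay * Z ^+ 2.
  apply: (near_axis radL nB) => j; rewrite xE => nj.
  by apply: (far_far (i := co true o) (m := m) (d := d)) => //; rewrite /m; lia.
by have := sqr_ge0 (Zd (mirror t A A) - Zd (mirror t B B)); nra.
Qed.

Lemma far_pair o x A B : near_defect o A -> near_defect x B ->
  let d := nat_of_ord (co true x - co true o) in
  (2 * rad + 8 <= d)%N -> (d + 2 * rad + 8 <= L)%N ->
  Zd (psetU A B) ^+ 2 <= decay * Z ^+ 2.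
Proof.
move=> nA nB d d1 d2; have [dL|dL] := leqP d L./2; first exact: (far_pair_half nA nB).
have -> : psetU A B = psetU B A by rewrite /psetU setUC [A.2 :|: _]setUC.
have E : (co true o - co true x)%R = (L - d)%N :> nat.
  have -> : co true o - co true x = - (co true x - co true o) by ring.
  by rewrite val_opp -/d; case: eqP => // ?; lia.
by apply: (far_pair_half nB nA); rewrite E; lia.
Qed.

(** Defects on one line lie on a mirror, where they can be compared with crossing
    dimers. *)
Lemma line_bound b (t : 'I_L) A : (forall y, y \in A.1 :|: A.2 -> co b y = t) -> Zd A <= Z.
Proof.
move=> line; have -> : A = mirror (@reflect_at l K b t) A (set0, set0).
  by case: A {line} => A1 A2; rewrite /mirror /= !imset0 !setU0.
have on y : co b y = t -> y \in rim e (@reflect_at l K b t) (@half_space l K b t).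
  move=> yt; have E : @reflect_at l K b t y = translate b y.
    by rewrite /reflect_at /translate; apply: app_eq; rewrite yt /flip; ring.
  by rewrite inE E adj_translate andbT inE yt subrr /=; lia.
apply: (Zdef_mirror_le rho_ge0 (@torus_adj_sym L K) (reflection_torus l_gt0 evenL hK b t));
  rewrite ?sub0set //; apply/subsetP => y yA; apply: on; apply: line; by rewrite in_setU yA ?orbT.
Qed.

(** In one column [line_bound] applies directly. Otherwise a vertical mirror
    separates the defects, and after reflection each one shares a row with its
    image. *)
Lemma single_pair_bound o x A B : A = ([set o], set0) ->
  B = ([set x], set0) \/ B = (set0, [set x]) -> Zd (psetU A B) <= Z.
Proof.
move=> EA EB; have [E|ne] := eqVneq (co true o) (co true x).
  apply: (@line_bound true (co true o)) => y.
  by case: EB => ->; rewrite EA /psetU /= !(inE, orbF) => /orP[]/eqP->.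
set d := nat_of_ord (co true x - co true o).
have d0 : (0 < d)%N.
  rewrite lt0n; apply: contraNneq ne => d0; apply/eqP.
  have : co true x - co true o = 0 by apply/val_inj.
  by move/eqP; rewrite subr_eq0 => /eqP.
have dL : (d < L)%N by apply: ltn_ord.
have xE : co true x = co true o + d%:R by rewrite natr_Zp addrC subrK.
pose m := (d - L./2)%N; pose p : 'I_L := co true o + m%:R.
have rf := reflection_torus l_gt0 evenL hK true p; have tK := refl_inv rf.
pose t := mir true p; pose B' := (t @: B.1, t @: B.2).
have ttK (U : {set V}) : t @: (t @: U) = U.
  by rewrite -imset_comp -[RHS]imset_id; apply: eq_imset => y; apply: tK.
have oH : o \in hemi true p.
  rewrite inE; have -> : p - co true o = m%:R by rewrite /p addrC addKr.
  by rewrite val_natr /m; lia.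
have xH : x \notin hemi true p.
  rewrite inE xE -leqNgt (@val_neg _ (d - m)%N); [by rewrite /m; lia|by rewrite /m; lia|].
  apply: (addIr (d - m)%N%:R); rewrite addNr; apply: (addIr m%:R); rewrite -addrA -natrD subnK.
    by rewrite /p; ring.
  by rewrite /m; lia.
have sub1 (z : V) : z \in hemi true p -> [set z] \subset hemi true p by rewrite sub1set.
have A1 : A.1 \subset hemi true p by rewrite EA sub1.
have A2 : A.2 \subset hemi true p by rewrite EA sub0set.
have txH : t x \in hemi true p by rewrite (refl_half rf).
have B1 : B'.1 \subset hemi true p.
  by rewrite /B'; case: EB => -> /=; rewrite ?imset_set1 ?sub1 ?imset0 ?sub0set.
have B2 : B'.2 \subset hemi true p.
  by rewrite /B'; case: EB => -> /=; rewrite ?imset_set1 ?sub1 ?imset0 ?sub0set.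
have RP := reflection_positivity rho (@torus_adj_sym L K) rf A1 A2 B1 B2.
have E1 : mirror t A B' = psetU A B by rewrite /mirror /= !ttK.
have E2 : mirror t B' B' = mirror t B B by rewrite /mirror /= !ttK !(setUC (t @: _)).
have row z y : y \in z |: t @: [set z] -> co false y = co false z.
  by rewrite imset_set1 !inE => /orP[]/eqP-> //; rewrite (co_appN true).
have ZA : Zd (mirror t A A) <= Z.
  apply: (@line_bound false (co false o)) => y.
  by rewrite EA /mirror /= imset0 !setU0; apply: row.
have ZB : Zd (mirror t B B) <= Z.
  apply: (@line_bound false (co false x)) => y.
  by case: EB => ->; rewrite /mirror /= imset0 ?setU0 ?set0U; apply: row.
move: RP; rewrite -/t E1 E2 => RP.
rewrite -(@ler_pXn2r _ 2) ?nnegrE ?Zdef_ge0 //; apply: (le_trans RP).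
by rewrite expr2; apply: ler_pM; rewrite ?Zdef_ge0.
Qed.

End FarPair.

(** * Opening a loop *)

Section CutLoop.
Variables (V : finType) (e : rel V).
Implicit Types (C M g : {set V}) (b r : {set {set V}}) (o x : V) (f : bool).

Definition crosses g C := ~~ [disjoint g & C] && ~~ (g \subset C).

(** The effect on the first colour of exchanging the colours along the arc [C] of a
    loop and deleting the two dimers at its ends. *)
Definition recolour C b r : {set {set V}} :=
  [set g in b | [disjoint g & C]] :|: [set g in r | g \subset C].

(** In both colours together, [C] is joined to its complement by two dimers only.
    The flags tell whether they have the colour of [b]. *)
Definition separated b C f o o' f' x' x : bool :=
  [forall g in b, crosses g C ==> (f && (g == [set o; o'])) || (f' && (g == [set x'; x]))].

Definition inner_rel b r C : rel V := fun u v =>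
  [&& ([set u; v] \in b) || ([set u; v] \in r), u \in C & v \in C].

Definition opened b r C f o o' f' x' x : bool :=
  [&& [&& o \notin C, o' \in C, x' \notin C & x \in C],
      [set o; o'] \in (if f then b else r), [set x'; x] \in (if f' then b else r),
      separated b C f o o' f' x' x, separated r C (~~ f) o o' (~~ f') x' x &
      [forall v in C, connect (inner_rel b r C) o' v]].

(** The vertices left uncovered by the first colour after [recolour]. *)
Definition ends f o o' f' x' x : {set V} :=
  [set (if f then o else o')] :|: [set (if f' then x' else x)].

Lemma openedC b r C f o o' f' x' x :
  opened b r C f o o' f' x' x = opened r b C (~~ f) o o' (~~ f') x' x.
Proof.
rewrite /opened !if_neg !negbK; congr [&& _, _, _ & _].
rewrite andbCA; congr [&& _, _ & _].
apply: eq_forallb => v; congr (_ ==> _); apply: eq_connect => u w.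
by rewrite /inner_rel orbC.
Qed.

Lemma recolour_dimers M b r C f o o' f' x' x :
  b \in dimers e M -> r \in dimers e M -> opened b r C f o o' f' x' x ->
  recolour C b r \in dimers e (ends f o o' f' x' x :|: M).
Proof.
move=> bD rD /and5P[/and4P[oC oC' xC' xC] oo xx sb /andP[sr _]].
have eM d g v : d \in dimers e M -> g \in d -> v \in g -> v \notin M.
  move=> dM gd vg; have [p [q [_ eg pM qM]]] := dimer_edge dM gd.
  by move: vg; rewrite eg !inE => /orP[]/eqP->.
have memR g : g \in recolour C b r -> (g \in b /\ [disjoint g & C]) \/ (g \in r /\ g \subset C).
  by rewrite in_setU !inE => /orP[]/andP[]; [left|right].
(* a recoloured dimer never covers the end left free by an opened dimer *)
have free f1 p q g : p \notin C -> q \in C -> [set p; q] \in (if f1 then b else r) ->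
    g \in recolour C b r -> (if f1 then p else q) \notin g.
  move=> pC qC pq /memR[[gb gC]|[gr gC]]; apply/negP => pg; case: f1 pq pg => pq pg.
  - have E := dimer_uniq bD gb pq pg (set21 _ _).
    by have := disjointFr gC (_ : q \in g); rewrite qC E set22 => /(_ isT).
  - by have := disjointFr gC pg; rewrite qC.
  - by have := subsetP gC _ pg; rewrite (negPf pC).
  - have E := dimer_uniq rD gr pq pg (set22 _ _).
    by have := subsetP gC p; rewrite E set21 (negPf pC) => /(_ isT).
have crossP d f1 f2 g v : separated d C f1 o o' f2 x' x -> g \in d -> v \in g -> 
    crosses g C -> (v \notin C -> (f1 && (v == o)) || (f2 && (v == x'))) /\
                   (v \in C -> (f1 && (v == o')) || (f2 && (v == x))).
  move=> /forall_inP s gd vg cr; have /implyP/(_ cr) := s g gd.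
  case/orP => /andP[-> /eqP E]; move: vg; rewrite E !inE => /orP[]/eqP->;
  by rewrite ?oC ?oC' ?xC ?xC' ?(negPf oC) ?(negPf xC') eqxx ?orbT; split.
apply: in_dimers.
- move=> g /memR[[gd _]|[gd _]].
    by have [p [q [epq -> _ _]]] := dimer_edge bD gd; apply/edgesP; exists p, q.
  by have [p [q [epq -> _ _]]] := dimer_edge rD gd; apply/edgesP; exists p, q.
- move=> g v gR vg; rewrite in_setU negb_or; apply/andP; split; last first.
    by case: (memR _ gR) => -[gd _]; [apply: eM bD gd vg|apply: eM rD gd vg].
  rewrite !inE negb_or; apply/andP; split; apply/eqP => E; move: vg; rewrite E.
    by apply/negP; apply: free oo gR.
  by apply/negP; apply: free xx gR.
move=> v; rewrite in_setU negb_or !inE negb_or => /andP[/andP[vo vx] vM].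
have [vC|vC] := boolP (v \in C).
- have [g gr vg] := dimer_ex rD vM.
  have gC : g \subset C.
    apply/negP => /negP gC; have cr : crosses g C.
      rewrite /crosses gC andbT; apply/negP => dis.
      by have := disjointFr dis vg; rewrite vC.
    have [_ /(_ vC)] := crossP r _ _ g v sr gr vg cr.
    by case: (f) vo => vo; case: (f') vx => vx; rewrite ?(negPf vo) ?(negPf vx).
  exists g; split=> //; first by rewrite in_setU !inE gr gC orbT.
  move=> h /memR[[hb hC]|[hr _]] vh; last exact: dimer_uniq rD hr gr vh vg.
  by have := disjointFr hC vh; rewrite vC.
have [g gb vg] := dimer_ex bD vM.
have gC : [disjoint g & C].
  apply/negP => /negP gC; have cr : crosses g C.
    by rewrite /crosses gC /=; apply: contraNN vC => /subsetP; apply.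
  have [/(_ vC) + _] := crossP b _ _ g v sb gb vg cr.
  by case: (f) vo => vo; case: (f') vx => vx; rewrite ?(negPf vo) ?(negPf vx).
exists g; split=> //; first by rewrite in_setU !inE gb gC.
move=> h /memR[[hb _]|[hr hC]] vh; first exact: dimer_uniq bD hb gb vh vg.
by have := subsetP hC _ vh; rewrite (negPf vC).
Qed.

(** No recoloured dimer leaves [C] while the arc stays connected, so [C] is a
    component and can be read off from the recoloured configuration. *)
Lemma recolour_component b r C f o o' f' x' x :
  opened b r C f o o' f' x' x ->
  C = [set v | connect (fun u v => ([set u; v] \in recolour C b r) ||
                                   ([set u; v] \in recolour C r b)) o' v].
Proof.
move=> /and5P[/and4P[_ oC' _ _] _ _ _ /andP[_ /forall_inP con]].
set g := (fun u v => _); apply/setP => v; rewrite inE; apply/idP/idP => [/con|].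
  apply: connect_sub => p q /and3P[pq pC qC]; apply: connect1.
  have sub : [set p; q] \subset C by rewrite subUset !sub1set pC.
  by rewrite /g /= !in_setU !inE sub !andbT; case/orP: pq => ->; rewrite ?orbT.
have cl : closed g C.
  move=> p q pq; have : [disjoint [set p; q] & C] || ([set p; q] \subset C).
    move: pq; rewrite /g /= !in_setU !inE.
    by case/orP => /orP[]/andP[_ ->]; rewrite ?orbT.
  case/orP => [dis|sub].
    by rewrite !(disjointFr dis) // !inE eqxx ?orbT.
  by move: sub; rewrite subUset !sub1set => /andP[-> ->].
by move=> /(closed_connect cl) <-.
Qed.

Lemma recolour_recover M b r C f o o' f' x' x :
  b \in dimers e M -> r \in dimers e M -> opened b r C f o o' f' x' x ->
  b = [set g | [|| (g \in recolour C b r) && [disjoint g & C],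
      (g \in recolour C r b) && (g \subset C),
      f && (g == [set o; o']) | f' && (g == [set x'; x])]].
Proof.
move=> bD rD /and5P[/and4P[oC oC' xC' xC] oo xx /forall_inP sb _].
have ne d g : d \in dimers e M -> g \in d -> g \subset C -> [disjoint g & C] = false.
  move=> dM gd gC; have [p [q [_ eg _ _]]] := dimer_edge dM gd.
  apply/negP => dis; have pg : p \in g by rewrite eg set21.
  by have := disjointFr dis pg; rewrite (subsetP gC).
apply/setP => g; rewrite [in RHS]inE !in_setU !inE; apply/idP/idP => [gb|].
  rewrite gb; have [dis|meet] := boolP [disjoint g & C]; first by [].
  have [sub|nsub] := boolP (g \subset C); first by rewrite !orbT.
  have /implyP := sb g gb; rewrite /crosses meet nsub => /(_ isT) ->.
  by rewrite !orbT.
case/or4P => [/andP[/orP[/andP[//]|/andP[gr sub]] dis]|/andP[/orP[/andP[gr dis]|/andP[//]] sub]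
             |/andP[f1 /eqP->]|/andP[f1 /eqP->]].
- by rewrite (ne _ _ rD gr sub) in dis.
- by rewrite (ne _ _ rD gr sub) in dis.
- by rewrite f1 in oo.
by rewrite f1 in xx.
Qed.

Lemma recolour_inj M b r C b2 r2 C2 f o o' f' x' x :
  b \in dimers e M -> r \in dimers e M -> opened b r C f o o' f' x' x ->
  b2 \in dimers e M -> r2 \in dimers e M -> opened b2 r2 C2 f o o' f' x' x ->
  recolour C b r = recolour C2 b2 r2 -> recolour C r b = recolour C2 r2 b2 ->
  b = b2 /\ r = r2.
Proof.
move=> bD rD op b2D r2D op2 E1 E2.
have EC : C = C2.
  by rewrite (recolour_component op) (recolour_component op2) E1 E2.
split.
  by rewrite (recolour_recover bD rD op) (recolour_recover b2D r2D op2) E1 E2 EC.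
move: op op2; rewrite (openedC b) (openedC b2) => op op2.
by rewrite (recolour_recover rD bD op) (recolour_recover r2D b2D op2) E1 E2 EC.
Qed.

End CutLoop.

(** * Loops through two given vertices *)

Section LoopWeight.
Variables (V : finType) (e : rel V).
Hypotheses (e_sym : symmetric e) (e_irr : irreflexive e).
Implicit Types (C M g : {set V}) (b r : {set {set V}}) (o x : V) (f : bool).

Lemma dimer_adj M d u v : d \in dimers e M -> [set u; v] \in d -> e u v.
Proof.
move=> dM uvd; have [p [q [epq /setP E _ _]]] := dimer_edge dM uvd.
have pq : p != q by apply: contraTneq epq => ->; rewrite e_irr.
have := E u; have := E v; rewrite !inE !eqxx orbT /=.
move=> /esym/orP[]/eqP vE /esym/orP[]/eqP uE; subst u v => //; last 1 first.
- by have := E p; rewrite !inE (negPf pq) eqxx.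
- by have := E q; rewrite !inE (eq_sym q p) (negPf pq) eqxx.
by rewrite e_sym.
Qed.

(** The arc [C] runs from the successor of [o] to [x] in the cyclic order of the
    loop; the colours of the edges after [o] and [x] are given by the parity of
    their positions. *)
Lemma loop_opened (w : config V) (s : seq V) o x : w \in Omega e ->
  is_loop w s -> o \in s -> x \in s -> o != x ->
  exists o' x' f f' C, [/\ e o o', e x x' & opened (blue w) (red w) C f o o' f' x' x].
Proof.
rewrite inE; move: w => [[M b] r]; rewrite /blue /red /monomers /= => /andP[bD rD].
case; rewrite /blue /red /= => us s0 evN edg os xs ox.
set N := size s in s0 evN edg *; pose i := index o s.
have oddN : odd N = false by apply: negbTE.
pose t n := nth o s ((i + n) %% N).
have tP n : [set t n; t n.+1] \in (if odd (i + n) then r else b).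
  have := edg o ((i + n) %% N)%N (ltn_pmod _ s0); rewrite odd_mod //.
  by rewrite -addn1 modnDml addn1 -addnS.
have iN : (i < N)%N by rewrite /i /N index_mem.
have t0 : t 0%N = o by rewrite /t addn0 modn_small // nth_index.
have tN : t N = o by rewrite /t modnDr modn_small // nth_index.
have tI n m : (n < N)%N -> (m < N)%N -> t n = t m -> n = m.
  move=> nN mN /eqP; rewrite nth_uniq ?ltn_pmod // eqn_modDl => /eqP.
  by rewrite !modn_small.
pose j := index x s.
have jN : (j < N)%N by rewrite /j /N index_mem.
pose m := ((j + N - i) %% N)%N.
have mN : (m < N)%N by rewrite ltn_pmod.
have tm : t m = x.
  rewrite /t /m modnDmr subnKC; last by lia.
  by rewrite modnDr modn_small // nth_index.
have m0 : (0 < m)%N.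
  by rewrite lt0n; apply: contraNneq ox => m0; rewrite -t0 -tm m0.
pose C := [set t n.+1 | n : 'I_m].
have CP v : reflect (exists n, [/\ (0 < n)%N, (n <= m)%N & v = t n]) (v \in C).
  apply: (iffP imsetP) => [[n _ ->]|[[|n] [// _ nm ->]]].
    by exists n.+1; split.
  by exists (Ordinal nm).
have inC n : (0 < n)%N -> (n <= m)%N -> t n \in C by move=> n0 nm; apply/CP; exists n.
have oC : o \notin C.
  apply/CP => -[n [n0 nm]]; rewrite -t0 => /tI E; have := E s0 (leq_ltn_trans nm mN).
  by move=> E0; rewrite -E0 in n0.
have xC' : t m.+1 \notin C.
  have [mN'|mN'] := ltnP m.+1 N.
    apply/CP => -[n [n0 nm]] /tI E; have := E mN' (leq_ltn_trans nm mN).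
    by move=> E0; rewrite -E0 ltnn in nm.
  by have -> : m.+1 = N by [lia|]; rewrite ?tN //; lia.
(* [c] is the parity of the positions of the edges of colour [d] *)
have col c d : d \in dimers e M -> (forall n, odd (i + n) = c -> [set t n; t n.+1] \in d) ->
    separated d C (odd i == c) o (t 1%N) (odd (i + m) == c) (t m.+1) x.
  move=> dM dP; apply/forall_inP => g gd; apply/implyP => /andP[meet nsub].
  have /existsP[v /andP[vg vC]] : [exists v, (v \in g) && (v \in C)].
    by move: meet; rewrite -setI_eq0 => /set0Pn[v]; rewrite in_setI => vv; apply/existsP; exists v.
  have /CP[n [n0 nm vE]] := vC.
  have [E|E] := boolP (odd (i + n) == c).
    have gE : g = [set t n; t n.+1].
      by apply: dimer_uniq dM gd (dP _ (eqP E)) vg _; rewrite vE set21.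
    have [nm'|nm'] := ltnP n m.
      by move: nsub; rewrite gE subUset !sub1set !inC.
    have En : n = m by apply/eqP; rewrite eqn_leq nm nm'.
    by rewrite gE En tm -En E En setUC eqxx orbT.
  have E' : odd (i + n.-1) = c.
    have E2 : (i + n = (i + n.-1).+1)%N by rewrite -addnS prednK.
    by move: E; rewrite E2 /=; case: (odd _); case: (c).
  have gE : g = [set t n.-1; t n].
    by apply: dimer_uniq dM gd _ vg (_ : v \in [set t n.-1; t n]);
      rewrite ?vE ?set22 //; have := dP _ E'; rewrite prednK.
  have [n1|n1] := ltnP 1 n.
    have n0' : (0 < n.-1)%N by rewrite -ltnS prednK.
    by move: nsub; rewrite gE subUset !sub1set !inC // (leq_trans (leq_pred n)).
  have En : n = 1%N by apply/eqP; rewrite eqn_leq n1.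
  by move: E'; rewrite gE En /= addn0 t0 => ->; rewrite !eqxx.
have tP0 := tP 0%N; have tPm := tP m; rewrite addn0 t0 in tP0; rewrite tm in tPm.
exists (t 1%N), (t m.+1), (~~ odd i), (~~ odd (i + m)), C; split.
- by move: tP0; case: ifP => _; [apply: (dimer_adj rD)|apply: (dimer_adj bD)].
- by move: tPm; case: ifP => _; [apply: (dimer_adj rD)|apply: (dimer_adj bD)].
apply/and5P; split.
- by rewrite oC xC' inC //= -tm inC.
- by rewrite if_neg.
- by rewrite if_neg setUC.
- rewrite -!eqbF_neg; apply: col => // n E; by have := tP n; rewrite E.
apply/andP; split.
  have rP n : odd (i + n) = true -> [set t n; t n.+1] \in r.
    by move=> E; have := tP n; rewrite E.
  by have := col true r rD rP; rewrite !eqb_id !negbK.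
apply/forall_inP => v /CP[n [n0 nm ->]].
elim: n n0 nm => // -[|n] IH _ nm; first exact: connect0.
apply: connect_trans (IH isT (ltnW nm)) _; apply: connect1.
rewrite /inner_rel !inC ?(ltnW nm) // !andbT.
by have := tP n.+1; case: ifP => _ ->; rewrite ?orbT.
Qed.

Variables (R : realFieldType) (rho : R).
Hypothesis rho_ge0 : 0 <= rho.
Local Notation Zd := (Zdef e rho).
Local Notation Om := (defect_configs e (set0, set0)).
Local Notation wt w := (rho ^+ #|monomers w|).

(** [recolour] keeps the monomers and is injective once the ends and colours of the
    two deleted dimers are known. *)
Lemma opened_weight o o' x x' f f' :
  \sum_(w in Om | [exists C, opened (blue w) (red w) C f o o' f' x' x]) wt w <=
  Zd (ends f o o' f' x' x, ends (~~ f) o o' (~~ f') x' x).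
Proof.
pose A := (ends f o o' f' x' x, ends (~~ f) o o' (~~ f') x' x).
pose cut (w : config V) := odflt set0 [pick C | opened (blue w) (red w) C f o o' f' x' x].
have cutP w : [exists C, opened (blue w) (red w) C f o o' f' x' x] ->
    opened (blue w) (red w) (cut w) f o o' f' x' x.
  move=> /existsP[C oC]; rewrite /cut; case: pickP => [C' //|/(_ C)].
  by rewrite oC.
pose h (w : config V) : config V :=
  (monomers w, recolour (cut w) (blue w) (red w), recolour (cut w) (red w) (blue w)).
pose F (w : config V) := if w \in defect_configs e A then wt w else 0.
have OmP w : w \in Om -> blue w \in dimers e (monomers w) /\ red w \in dimers e (monomers w).
  by rewrite inE /= !set0U => /and3P[].
have hA w : (w \in Om) && [exists C, opened (blue w) (red w) C f o o' f' x' x] ->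
    h w \in defect_configs e A.
  move=> /andP[/OmP[bD rD] /cutP op]; rewrite in_defect /A /=.
  rewrite (recolour_dimers bD rD op).
  have op2 := op; rewrite openedC in op2; rewrite (recolour_dimers rD bD op2) !andbT.
  have cov f1 p q : [set p; q] \in (if f1 then blue w else red w) ->
      p \notin monomers w /\ q \notin monomers w.
    have gen d : d \in dimers e (monomers w) -> [set p; q] \in d ->
        p \notin monomers w /\ q \notin monomers w.
      move=> dM pq; have [a [c [_ E aM cM]]] := dimer_edge dM pq.
      have : p \in [set a; c] by rewrite -E set21.
      have : q \in [set a; c] by rewrite -E set22.
      by rewrite !inE => /orP[]/eqP-> /orP[]/eqP->.
    by case: f1 => pq; [apply: gen bD pq|apply: gen rD pq].
  have /and5P[_ oo xx _ _] := op.
  have [o1 o2] := cov _ _ _ oo; have [x1 x2] := cov _ _ _ xx.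
  rewrite -setI_eq0; apply/eqP/setP => v; rewrite !inE.
  by apply/negP => /andP[vM]; case: (f) (f') => -[] /= /orP[]/orP[]/eqP vE; move: vM;
    rewrite vE ?(negPf o1) ?(negPf o2) ?(negPf x1) ?(negPf x2).
apply: (@le_trans _ _ (\sum_(w in Om | [exists C, opened (blue w) (red w) C f o o' f' x' x]) F (h w))).
  rewrite le_eqVlt; apply/orP; left; apply/eqP; apply: eq_bigr => w wP.
  by rewrite /F hA.
have -> : Zd A = \sum_w F w by rewrite /Zdef big_mkcond.
apply: sum_inj_le; last by move=> w; rewrite /F; case: ifP => // _; apply: exprn_ge0.
move=> w1 w2 /andP[/OmP[b1 r1] /cutP op1] /andP[/OmP[b2 r2] /cutP op2].
rewrite /h => -[EM E1 E2]; rewrite -EM in b2 r2.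
have [Eb Er] := recolour_inj b1 r1 op1 b2 r2 op2 E1 E2.
by move: w1 w2 EM Eb Er {op1 op2 b1 r1 b2 r2 E1 E2} => [[M1 b1] r1] [[M2 b2] r2]; rewrite /monomers /blue /red /= => -> -> ->.
Qed.

Lemma loop_weight (P : pred (config V)) o x : o != x ->
  (forall w, w \in Om -> P w -> exists s, [/\ is_loop w s, o \in s & x \in s]) ->
  \sum_(w in Om | P w) wt w <=
  \sum_(o' | e o o') \sum_(x' | e x x') \sum_(f : bool) \sum_(f' : bool)
     Zd (ends f o o' f' x' x, ends (~~ f) o o' (~~ f') x' x).
Proof.
move=> ox loopP.
pose Q o' x' f f' (w : config V) := [exists C, opened (blue w) (red w) C f o o' f' x' x].
apply: (@le_trans _ _ (\sum_(o' | e o o') \sum_(x' | e x x') \sum_(f : bool) \sum_(f' : bool)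
    \sum_(w in Om | Q o' x' f f' w) wt w)); last first.
  by do 4 (apply: ler_sum => ? _); apply: opened_weight.
have ge0 (w : config V) : 0 <= wt w by apply: exprn_ge0.
have -> : \sum_(o' | e o o') \sum_(x' | e x x') \sum_(f : bool) \sum_(f' : bool)
    \sum_(w in Om | Q o' x' f f' w) wt w =
   \sum_(w in Om) \sum_(o' | e o o') \sum_(x' | e x x') \sum_(f : bool) \sum_(f' : bool)
     (if Q o' x' f f' w then wt w else 0).
  rewrite [RHS]exchange_big /=; apply: eq_bigr => o' _.
  rewrite [RHS]exchange_big /=; apply: eq_bigr => x' _.
  rewrite [RHS]exchange_big /=; apply: eq_bigr => f _.
  rewrite [RHS]exchange_big /=; apply: eq_bigr => f' _.
  by rewrite big_mkcondr.
rewrite big_mkcondr; apply: ler_sum => w wO.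
have nn o' x' f f' : 0 <= (if Q o' x' f f' w then wt w else 0) by case: ifP.
case: ifP => [Pw|_]; last by do 4 (apply: sumr_ge0 => ? _).
have [s [lp os xs]] := loopP w wO Pw.
have wO' : w \in Omega e by rewrite -defect_configs0.
have [o' [x' [f [f' [C [oo xx op]]]]]] := loop_opened wO' lp os xs ox.
have Qw : Q o' x' f f' w by apply/existsP; exists C.
rewrite (bigD1 o') //= (bigD1 x') //= (bigD1 f) //= (bigD1 f') //= Qw -!addrA lerDl.
rewrite !addr_ge0 //; by do ?(apply: sumr_ge0 => ? _).
Qed.

End LoopWeight.

(** * Summation over the torus *)

Section TorusBounds.
Variables (R : rcfType) (rho : R) (l K rad : nat).
Local Notation L := l.+2.
Local Notation V := (torus L K).
Local Notation e := (@torus_adj L K).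
Hypotheses (rho_ge0 : 0 <= rho) (l_gt0 : (0 < l)%N) (evenL : ~~ odd l) (hK : side K).
Hypotheses (rad2 : (2 <= rad)%N).
Implicit Types (x y o : V) (A B : {set V} * {set V}).
Local Notation Zd := (Zdef e rho).
Local Notation Z := (Zd (set0, set0)).
Local Notation Om := (defect_configs e (set0, set0)).
Local Notation wt w := (rho ^+ #|monomers w|).

Definition decay_rate : R := Num.sqrt (decay_sq R K rad).
Definition far o x : bool :=
  let d := nat_of_ord (co true x - co true o) in
  (2 * rad + 8 <= d)%N && (d + 2 * rad + 8 <= L)%N.

Lemma decay_ge0 : 0 <= decay_sq R K rad.
Proof.
rewrite /decay_sq; apply: divr_ge0; first by rewrite mulr_ge0 ?ler0n.
by apply: le_trans (harmonic_sum_ge1 R rad2).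
Qed.

Lemma far_bound o x A B : near_defect o A -> near_defect x B -> far o x ->
  Zd (psetU A B) <= decay_rate * Z.
Proof.
move=> nA nB /andP[f1 f2].
have B2 := far_pair rho_ge0 l_gt0 evenL hK rad2 nA nB f1 f2.
rewrite -(@ler_pXn2r _ 2) ?nnegrE ?mulr_ge0 ?sqrtr_ge0 ?Zdef_ge0 //.
by rewrite exprMn sqr_sqrtr ?decay_ge0.
Qed.

Lemma degree_le6 o : (#|[set x | e o x]| <= 6)%N.
Proof.
have c1 (P : pred V) : (forall x y, P x -> P y -> x = y) -> (#|[set x | P x]| <= 1)%N.
  move=> u; apply/card_le1_eqP => x y; rewrite !inE => Px Py; first [exact: u|symmetry; exact: u].
pose P1 b : pred V := fun x => x == translate b o.
pose P2 b : pred V := fun x => o == translate b x.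
pose P3 : pred V := fun x => (x.1 == o.1) && (x.2 == o.2.+1 %[mod K])%N.
pose P4 : pred V := fun x => (x.1 == o.1) && (o.2 == x.2.+1 %[mod K])%N.
have n1 b : (#|[set x | P1 b x]| <= 1)%N by apply: c1 => x y /eqP-> /eqP->.
have n2 b : (#|[set x | P2 b x]| <= 1)%N.
  by apply: c1 => x y /eqP E /eqP; rewrite E => /translateI.
have n3 : (#|[set x | P3 x]| <= 1)%N.
  apply: c1 => -[x1 x2] [y1 y2] /andP[/= /eqP-> /eqP E] /andP[/= /eqP-> /eqP E2].
  congr pair; apply/val_inj => /=; move: E; rewrite -E2.
  by rewrite !modn_small ?ltn_ord.
have n4 : (#|[set x | P4 x]| <= 1)%N.
  apply: c1 => -[x1 x2] [y1 y2] /andP[/= /eqP-> /eqP E] /andP[/= /eqP-> /eqP].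
  rewrite E => /eqP; rewrite -(addn1 x2) -(addn1 y2) eqn_modDr => /eqP E2.
  by congr pair; apply/val_inj => /=; move: E2; rewrite !modn_small ?ltn_ord.
have sub : [set x | e o x] \subset [set x | P1 true x] :|: [set x | P1 false x] :|:
   [set x | P2 true x] :|: [set x | P2 false x] :|: [set x | P3 x] :|: [set x | P4 x].
  apply/subsetP => x; rewrite !inE; case/adjP => [[b ->]|[b E]|/and3P[/eqP E _ /orP[]c]].
  - by rewrite /P1; case: b; rewrite eqxx ?orbT.
  - by rewrite /P2 E; case: (b); rewrite eqxx ?orbT.
  - by rewrite /P3 E eqxx c ?orbT.
  - by rewrite /P4 E eqxx c ?orbT.
apply: (leq_trans (subset_leq_card sub)).
have cU (X Y : {set V}) i j : (#|X| <= i -> #|Y| <= j -> #|X :|: Y| <= i + j)%N.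
  by move=> Xi Yj; apply: (leq_trans (leq_card_setU _ _).1); apply: leq_add.
exact: (cU _ _ _ _ (cU _ _ _ _ (cU _ _ _ _ (cU _ _ _ _ (cU _ _ _ _ (n1 _) (n1 _)) (n2 _)) (n2 _)) n3) n4).
Qed.

Lemma near_count o : (\sum_(x : V) ~~ far o x <= K * ((4 * rad + 16) * L))%N.
Proof.
pose P d := ~~ ((2 * rad + 8 <= d)%N && (d + 2 * rad + 8 <= L)%N).
have -> : (\sum_(x : V) ~~ far o x =
           \sum_(x : V) (P (col_offset (co true o) x) && predT (row_offset (co true o) x))%N)%N.
  by apply: eq_bigr => x _; rewrite andbT.
rewrite (@count_torus l K (co true o) (co true o) P predT) leq_mul2l; apply/orP; right; apply: leq_mul; last first.
  by rewrite /= sum_nat_const card_ord muln1.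
apply: (@leq_trans (\sum_(i < L) ((i < 2 * rad + 8)%N + (L - (2 * rad + 7) <= i)%N))).
  by apply: leq_sum => i _; rewrite /P; have := ltn_ord i; do 2 case: leqP => ?; case: leqP => ?; lia.
rewrite big_split; apply: (leq_trans (leq_add (count_lt _ _) (eq_leq (count_ge _ _)))); lia.
Qed.

(** Vertices that are not far from [o] lie in at most [4 * rad + 16] columns. *)
Lemma spread_sum (F : V -> R) (c : R) o : 0 <= c -> (forall x, F x <= Z) ->
  (forall x, far o x -> F x <= c * Z) ->
  \sum_x F x <= ((4 * rad + 16)%:R / L%:R + c) * #|V|%:R * Z.
Proof.
move=> c0 F1 Fc; have Z0 : 0 <= Z by apply: Zdef_ge0.
apply: (@le_trans _ _ (\sum_(x : V) ((~~ far o x : nat)%:R * Z + c * Z))).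
  apply: ler_sum => x _; have [f|f] := boolP (far o x).
    by rewrite /= mul0r add0r Fc.
  by rewrite /= mul1r; apply: (le_trans (F1 x)); rewrite lerDl mulr_ge0.
rewrite big_split /= -mulr_suml -natr_sum sumr_const -[c * Z *+ _]mulr_natr.
have cV : #|V| = (L * L * K)%N by rewrite !card_prod !card_ord.
have L0 : L%:R != 0 :> R by rewrite pnatr_eq0.
have -> : ((4 * rad + 16)%:R / L%:R + c) * #|V|%:R * Z =
   (K * ((4 * rad + 16) * L))%:R * Z + c * Z * #|V|%:R.
  by rewrite cV !natrM; move: (L%:R : R) L0 => Lr L0; field.
by rewrite lerD2r; apply: ler_wpM2r => //; rewrite ler_nat near_count.
Qed.

(** The parity of the distance decides only which colour misses [x]; both cases are
    covered by the same bounds. *)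
Lemma Omega2_weight o x :
  exists B, (B = ([set x], set0) \/ B = (set0, [set x])) /\
    \sum_(w in Omega2 e o x) wt w = Zd (psetU ([set o], set0) B).
Proof.
exists (if odd (gdist e o x) then ([set x], set0) else (set0, [set x])).
split; first by case: ifP; [left|right].
apply: eq_bigl => -[[M b] r]; rewrite in_defect /Omega2 inE /monomers /blue /red /=.
rewrite -disjoints_subset; case: ifP => _ /=.
  by rewrite !setU0 set0U.
by rewrite setU0 set0U.
Qed.

Lemma two_point_sum o :
  \sum_x \sum_(w in Omega2 e o x) wt w <=
  ((4 * rad + 16)%:R / L%:R + decay_rate) * #|V|%:R * Z.
Proof.
apply: (spread_sum (o := o)); first exact: sqrtr_ge0.
  move=> x; have [B [EB ->]] := Omega2_weight o x.
  exact: (single_pair_bound rho_ge0 l_gt0 evenL hK rad2 (erefl _) EB).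
move=> x fx; have [B [EB ->]] := Omega2_weight o x.
apply: far_bound fx; first by constructor 1.
by case: EB => ->; [constructor 1|constructor 2].
Qed.

Lemma ends_split (f f' : bool) o o' x' x :
  (ends f o o' f' x' x, ends (~~ f) o o' (~~ f') x' x) =
  psetU (if f then ([set o], [set o']) else ([set o'], [set o]))
        (if f' then ([set x'], [set x]) else ([set x], [set x'])).
Proof. by rewrite /ends /psetU; case: f; case: f'. Qed.

(** The factor 144 counts six neighbours of each of the two vertices and four
    colourings of the deleted dimers. *)
Lemma loop_sum (P : V -> pred (config V)) o :
  (forall x w, w \in Om -> P x w -> exists s, [/\ is_loop w s, o \in s & x \in s]) ->
  \sum_x \sum_(w in Om | P x w) wt w <=
  ((4 * rad + 16)%:R / L%:R + 144 * decay_rate) * #|V|%:R * Z.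
Proof.
have Z0 : 0 <= Z by apply: Zdef_ge0. have s0 : 0 <= decay_rate by apply: sqrtr_ge0.
move=> loopP; apply: (spread_sum (o := o)); first by rewrite mulr_ge0.
  by move=> x; case/andP: (sub_sum_le e rho_ge0 (P x)).
move=> x fx; have ox : o != x.
  by apply: contraTneq fx => ->; rewrite /far subrr /=; lia.
apply: (le_trans (loop_weight (@torus_adj_sym L K) (@torus_adj_irrefl L K) rho_ge0 ox (loopP x))).
have deg (c : R) y : 0 <= c -> \sum_(y' | e y y') c <= 6 * c.
  move=> c0; rewrite sumr_const -[c *+ _]mulr_natl; apply: ler_wpM2r => //.
  by rewrite ler_nat; have := degree_le6 y; rewrite cardsE.
apply: (@le_trans _ _ (\sum_(o' | e o o') 24 * (decay_rate * Z))); last first.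
  by apply: (le_trans (deg _ _ _)); rewrite ?mulr_ge0 //; lra.
apply: ler_sum => o' oo'.
apply: (@le_trans _ _ (\sum_(x' | e x x') 4 * (decay_rate * Z))); last first.
  by apply: (le_trans (deg _ _ _)); rewrite ?mulr_ge0 //; lra.
apply: ler_sum => x' xx'.
have one f f' : Zd (ends f o o' f' x' x, ends (~~ f) o o' (~~ f') x' x) <= decay_rate * Z.
  rewrite ends_split; apply: far_bound fx.
    by constructor 3; exists o' => //; case: f; [left|right].
  by constructor 3; exists x' => //; case: f'; [right|left].
rewrite !big_bool /=.
have := one true true; have := one true false; have := one false true; have := one false false.
by rewrite /=; lra.
Qed.

End TorusBounds.

(** * The choice of the radius *)

From mathcomp Require Import all_classical all_reals all_analysis.

Import Order.TTheory GRing.Theory Num.Theory.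

Section RealEstimates.
Variable R : realType.

Lemma ln_le_harmonic_sum n : (0 < n)%N -> ln (n%:R : R) <= harmonic_sum R n.
Proof.
elim: n => // -[|n] IH _; first by rewrite ln1 /harmonic_sum big_geq.
have n0 : 0 < n.+1%:R :> R by rewrite ltr0n.
rewrite harmonic_sumS //; have -> : n.+2%:R = n.+1%:R * (1 + n.+1%:R^-1) :> R.
  by rewrite mulrDr mulr1 divff ?lt0r_neq0 // -[n.+2]addn1 natrD.
have i0 : 0 < n.+1%:R^-1 :> R by rewrite invr_gt0.
rewrite lnM ?posrE ?addr_gt0 //; apply: lerD; first exact: IH.
by apply: le_ln1Dx; apply: lt_trans i0; rewrite oppr_lt0.
Qed.

(** A power of two, so that no square root is needed. *)
Lemma radius_ex L : (4 <= L)%N -> exists r, [/\ (2 <= r)%N, (r ^ 2 <= L)%N & (L < 4 * r ^ 2)%N].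
Proof.
move=> L4; have /andP[k1 k2] := @trunc_log_bounds 2 L isT (leq_trans (isT : 0 < 4)%N L4).
set k := trunc_log 2 L in k1 k2.
have kge : (2 <= k)%N.
  by rewrite leqNgt; apply/negP => k2'; have := leq_trans k2 (leq_pexp2l (isT : 0 < 2)%N k2'); lia.
exists (2 ^ k./2)%N; rewrite -expnM; split.
- by rewrite -{1}(expn1 2) leq_exp2l //; lia.
- by apply: leq_trans k1; rewrite leq_exp2l //; lia.
by apply: leq_trans k2 _; rewrite -[4%N]/(2 ^ 2)%N -expnD leq_exp2l //; lia.
Qed.

(** Since [L < 4 * r ^ 2 <= r ^ 4], the logarithms of [r] and [L] are comparable;
    12264 is 24 for the near vertices plus 144 times 85. *)
Lemma final_rate (L K r : nat) : (0 < K)%N -> (2 <= r)%N -> (r ^ 2 <= L)%N -> (L < 4 * r ^ 2)%N ->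
  (4 * r + 16)%:R / L%:R + 144 * decay_rate R K r <=
  12264 * Num.sqrt (K%:R / ln (L%:R : R)).
Proof.
move=> K0 r2 rL Lr; set la := ln (L%:R : R).
have r0 : 0 < r%:R :> R by rewrite ltr0n; lia.
have L0 : 0 < L%:R :> R by rewrite ltr0n; lia.
have K1 : 1 <= K%:R :> R by rewrite ler1n.
have la0 : 0 < la by rewrite ln_gt0 // ltr1n; nia.
have lar : la <= 4 * ln (r%:R : R).
  have -> : 4 * ln (r%:R : R) = ln ((r ^ 4)%:R : R) by rewrite natrX lnXn // mulr_natl.
  rewrite ler_ln ?posrE ?ler_nat ?ltr0n; [|by lia|by rewrite expn_gt0; lia].
  apply: (leq_trans (ltnW Lr)); rewrite (expnD r 2 2) leq_mul2r.
  by apply/orP; right; rewrite (leq_exp2r 2 r (e := 2)).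
have harm_lb : la / 4 <= harmonic_sum R r.
  have := @ln_le_harmonic_sum r (ltnW r2); lra.
set S := Num.sqrt _.
have S0 : 0 <= S by apply: sqrtr_ge0.
have SS : S ^+ 2 = K%:R / la by rewrite sqr_sqrtr // divr_ge0 ?ler0n // ltW.
have d1 : decay_rate R K r <= 85 * S.
  rewrite -(@ler_pXn2r _ 2) ?nnegrE ?mulr_ge0 ?sqrtr_ge0 //.
  rewrite exprMn SS sqr_sqrtr ?decay_ge0 // /decay_sq.
  have H0 : 0 < harmonic_sum R r by lra.
  rewrite ler_pdivrMr //.
  have -> : 85 ^+ 2 * (K%:R / la) * harmonic_sum R r = (85 ^+ 2 * K%:R * harmonic_sum R r) / la by ring.
  rewrite ler_pdivlMr //.
  have : K%:R * la <= K%:R * (4 * harmonic_sum R r) by apply: ler_wpM2l; [lra|lra].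
  have : 0 <= K%:R * harmonic_sum R r by apply: mulr_ge0; lra.
  nra.
have rS : r%:R^-1 <= 2 * S.
  rewrite -(@ler_pXn2r _ 2) ?nnegrE ?mulr_ge0 ?invr_ge0 ?ler0n //.
  rewrite exprMn SS exprVn.
  have -> : 2 ^+ 2 * (K%:R / la) = (4 * K%:R) / la by ring.
  rewrite ler_pdivlMr // mulrC ler_pdivrMr ?exprn_gt0 //.
  have lr1 : ln (r%:R : R) <= r%:R - 1.
    have -> : ln (r%:R : R) = ln (1 + (r%:R - 1)) by congr ln; ring.
    by apply: le_ln1Dx; lra.
  have : r%:R <= r%:R ^+ 2 :> R by rewrite expr2 ler_peMl ?ler0n ?ler1n //; lia.
  have : r%:R ^+ 2 <= K%:R * r%:R ^+ 2 :> R by rewrite ler_peMl // exprn_ge0 // ltW.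
  nra.
have nearL : (4 * r + 16)%:R / L%:R <= 12 * r%:R^-1 :> R.
  rewrite ler_pdivrMr //.
  have -> : 12 * r%:R^-1 * L%:R = (12 * L)%:R / r%:R :> R by rewrite natrM; field; apply: lt0r_neq0.
  by rewrite ler_pdivlMr // -natrM ler_nat; nia.
lra.
Qed.

(** Lengths 1 and 2 have a logarithm below 1, whereas [K] is at least 1. *)
Lemma log_excludes K L : side K -> side L -> K%:R <= Num.sqrt (ln (L%:R : R)) ->
  exists2 l, (0 < l)%N && ~~ odd l & L = l.+2.
Proof.
move=> hK hL KL; have K1 : 1 <= K%:R :> R by rewrite ler1n side_gt0.
have la1 : 1 <= ln (L%:R : R).
  rewrite leNgt; apply/negP => la1; have := le_trans K1 KL; apply/negP; rewrite -ltNge.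
  by rewrite -[X in _ < X]sqrtr1 ltr_sqrt.
have L3 : (2 < L)%N.
  rewrite ltnNge; apply/negP => L2; move: la1; apply/negP; rewrite -ltNge.
  have le2 : L%:R <= 2 :> R by rewrite ler_nat.
  have e2 : 2 < expR 1 :> R by have := @expR_gt1Dx R 1 (oner_neq0 _); lra.
  have L0 : 0 < L%:R :> R by rewrite ltr0n side_gt0.
  rewrite -[X in _ < X](expRK 1) ltr_ln ?posrE ?expR_gt0 //; lra.
exists L.-2; last by lia.
by move: hL L3; rewrite /side; case: L {KL la1} => [|[|[|l]]] //=; rewrite !negbK /=.
Qed.

End RealEstimates.

Theorem theorem1p2 (R : realType) (rho : R) (hrho : 0 <= rho) :
  exists c : R, 0 < c /\
    forall (L K : nat) (hL : side L) (hK : side K),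
      K%:R <= Num.sqrt (ln (L%:R : R)) ->
      forall eps : R, 0 < eps ->
      [/\ Ex (@torus_adj L K) rho (fun w => (loop_size w (origin hL hK))%:R)
            / #|torus L K|%:R
          <= c * Num.sqrt (K%:R / ln L%:R),
          Pr (@torus_adj L K) rho
            (fun w => eps * #|torus L K|%:R
                      < (loop_size w (origin hL hK))%:R)
          <= c * eps^-1 * Num.sqrt (K%:R / ln L%:R) &
          \sum_(x : torus L K)
            (two_point (@torus_adj L K) rho (origin hL hK) x
               / #|torus L K|%:R)
          <= c * Num.sqrt (K%:R / ln L%:R)].
Proof.
exists 12264; split; first by rewrite ltr0n.
move=> L K hL hK KL eps eps0.
have [l /andP[l0 evl] EL] := log_excludes hK hL KL; subst L.
have [r [r2 rL Lr]] : exists r, [/\ (2 <= r)%N, (r ^ 2 <= l.+2)%N & (l.+2 < 4 * r ^ 2)%N].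
  by apply: radius_ex; lia.
have K0 : (0 < K)%N by apply: side_gt0.
move: (origin hL hK) => o.
have rate := final_rate R K0 r2 rL Lr.
set S := Num.sqrt _ in rate *.
set e := @torus_adj l.+2 K.
set N : R := #|torus l.+2 K|%:R.
have N0 : 0 < N by rewrite ltr0n; apply/card_gt0P; exists o.
set Z := partition_function e rho.
have ZE : Zdef e rho (finset.set0, finset.set0) = Z.
  by rewrite /Zdef defect_configs0.
have Z0 : 0 <= Z by rewrite -ZE; apply: Zdef_ge0.
have near0 : 0 <= (4 * r + 16)%:R / l.+2%:R :> R by rewrite divr_ge0 ?ler0n.
have s0 : 0 <= decay_rate R K r by apply: sqrtr_ge0.
have div_bound (X c : R) : 0 <= c -> c <= 12264 * S -> X <= c * N * Z -> X / Z / N <= 12264 * S.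
  move=> c0 cS XZ; rewrite ler_pdivrMr //; apply: (@le_trans _ _ (c * N)); last first.
    by apply: ler_wpM2r => //; apply: ltW.
  have [Zz|Zp] := eqVneq Z 0; first by rewrite Zz invr0 mulr0 mulr_ge0 // ltW.
  by rewrite ler_pdivrMr // lt_neqAle eq_sym Zp.
have loopsize w : (loop_size w o)%:R = \sum_x (x \in loop_vertices w o)%:R :> R.
  by rewrite /loop_size -sum1_card natr_sum big_mkcond; apply: eq_bigr => x _; case: ifP.
have first : Ex e rho (fun w => (loop_size w o)%:R) / N <= 12264 * S.
  have -> : Ex e rho (fun w => (loop_size w o)%:R) =
     (\sum_x \sum_(w in defect_configs e (finset.set0, finset.set0) | x \in loop_vertices w o)
         rho ^+ #|monomers w|) / Z.
    rewrite defect_configs0 mulr_suml /Ex.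
    under [RHS]eq_bigr => x _ do rewrite mulr_suml big_mkcondr.
    rewrite [RHS]exchange_big /=; apply: eq_bigr => w _.
    rewrite loopsize mulr_suml; apply: eq_bigr => x _; rewrite /mass -/Z.
    by case: ifP; rewrite ?mul1r ?mul0r.
  apply: (div_bound _ ((4 * r + 16)%:R / l.+2%:R + 144 * decay_rate R K r)) => //.
    by rewrite addr_ge0 // mulr_ge0.
  rewrite -ZE; apply: (loop_sum hrho l0 evl hK r2 (o := o) (P := fun x w => x \in loop_vertices w o)).
  move=> x w _; rewrite /loop_vertices; case: ifP => _; first by rewrite inE.
  by rewrite inE => /asboolP.
split=> //.
- have -> : 12264 * eps^-1 * S = eps^-1 * (12264 * S) by ring.
  apply: le_trans (ler_wpM2l _ first); last by rewrite invr_ge0 ltW.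
  rewrite /Pr /Ex mulr_suml mulr_sumr big_mkcondr; apply: ler_sum => w _.
  have m0 : 0 <= mass e rho w by rewrite /mass divr_ge0 ?exprn_ge0.
  case: ifP => [big|_]; last first.
    by rewrite mulr_ge0 ?invr_ge0 ?(ltW eps0) // divr_ge0 ?(ltW N0) // mulr_ge0 ?ler0n.
  have -> : eps^-1 * ((loop_size w o)%:R * mass e rho w / N) =
     (loop_size w o)%:R / (eps * N) * mass e rho w.
    by field; rewrite !lt0r_neq0.
  by rewrite ler_peMl // ler_pdivlMr ?mulr_gt0 // mul1r ltW.
have -> : \sum_(x : torus l.+2 K) two_point e rho o x / N =
   (\sum_x \sum_(w in Omega2 e o x) rho ^+ #|monomers w|) / Z / N.
  by rewrite -!mulr_suml.
apply: (div_bound _ ((4 * r + 16)%:R / l.+2%:R + decay_rate R K r)).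
- by rewrite addr_ge0.
- by apply: le_trans rate; rewrite lerD2l ler_peMl // ler1n.
by rewrite -ZE; apply: two_point_sum.
Qed.
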